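(* Let $a,b>0$ be constants with $a+b<\tfrac12$. There exists $\varepsilon_0>0$ such that for every fixed $0<\varepsilon<\varepsilon_0$ the following holds. Consider data $n,s,J,H$ with $n\to\infty$, where all out-degrees and in-degrees are prescribed equal to $s$ (i.e. $s_j=t_j=s$ for all $j$) and every arc of $H$ has both ends in $\{w_1,\dots,w_J\}$, such that uniformly $x_j,y_j=O(n^{1/2+\varepsilon})$; $X=O(n^{1+2\varepsilon})$; $J=O(n^{1/2+\varepsilon})$; and $\frac{(1-2\lambda)^2}{3A}\le a\log n$. Let $G$ be uniformly random in $\mathcal{D}(\boldsymbol{s},\boldsymbol{t})$. Then the probability that the subdigraph of $G$ induced by $\{w_1,\dots,w_J\}$ equals $H_J$ is \[ p^X(1-p)^{J(J-1)-X}\exp\Bigl(\frac{J^2}{n}+\frac{(1-2\lambda)\chi_1}{2An}-\frac{\chi_1^2}{4An^2}-\frac{(n+J)(\chi_2+\chi_2')}{4An^2}-\frac{(1-2\lambda)(\chi_3+\chi_3')}{24A^2n^2}+O(n^{-b})\Bigr). \]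
   Context: A simple digraph has no loops and no multiple arcs. $\mathcal{D}(\boldsymbol{s},\boldsymbol{t})$ is the set of simple digraphs on $\{w_1,\dots,w_n\}$ with out-degree $s_j$ and in-degree $t_j$ at $w_j$; here $\boldsymbol{s}=\boldsymbol{t}=(s,\dots,s)$ for a positive integer $s$. $\lambda=s/n$, $A=\tfrac12\lambda(1-\lambda)$, $p=s/(n-1)$. $H$ is a fixed simple digraph on $\{w_1,\dots,w_n\}$ with out-degrees $x_j$, in-degrees $y_j$ and $X$ arcs; $H_J$ is its subdigraph induced by $\{w_1,\dots,w_J\}$. For $\ell=1,2,3$: $\chi_\ell=\sum_{j=1}^J(x_j-p(J-1))^\ell$, $\chi'_\ell=\sum_{k=1}^J(y_k-p(J-1))^\ell$. Asymptotic notation refers to $n\to\infty$. *)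

(* Defs.v *)
From HB Require Import structures.
From mathcomp Require Import all_boot all_order all_algebra.
From mathcomp Require Import all_classical all_reals all_analysis.
Set Implicit Arguments. Unset Strict Implicit. Unset Printing Implicit Defensive.
Import Order.TTheory GRing.Theory Num.Theory.
Local Open Scope ring_scope.

(* A digraph on vertex set 'I_n (w_{j+1} <-> j) is given by its arc set. *)
Definition digraph (n : nat) := {set ('I_n * 'I_n)}.

(* simple: no loops (multiple arcs are impossible for a set of arcs) *)
Definition loopless n (G : digraph n) : bool := [forall a in G, a.1 != a.2].

Definition outdeg n (G : digraph n) (j : 'I_n) : nat := #|[set a in G | a.1 == j]|.
Definition indeg n (G : digraph n) (j : 'I_n) : nat := #|[set a in G | a.2 == j]|.

Definition Dreg n (s : nat) : {set digraph n} :=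
  [set G : digraph n | loopless G &&
     [forall j, (outdeg G j == s) && (indeg G j == s)]].

Definition induced n (G : digraph n) (J : nat) : digraph n :=
  [set a in G | (a.1 < J)%N && (a.2 < J)%N].

Definition prob_induced (R : realType) n s J (H : digraph n) : R :=
  #|[set G in Dreg n s | induced G J == induced H J]|%:R / #|Dreg n s|%:R.

Definition chi (R : realType) n (H : digraph n) (J : nat) (p : R) (l : nat) : R :=
  \sum_(j < n | (j < J)%N) ((outdeg H j)%:R - p * (J%:R - 1)) ^+ l.
Definition chi' (R : realType) n (H : digraph n) (J : nat) (p : R) (l : nat) : R :=
  \sum_(j < n | (j < J)%N) ((indeg H j)%:R - p * (J%:R - 1)) ^+ l.

(* Main.v *)
(** Let [N(H)] be the number of [s]-regular digraphs inducing [H] on the first [J] vertices.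
Deleting [H], it counts digraphs with prescribed degrees and no arc inside the block.  Two rows
each having exactly one of two given columns may exchange them: this involution preserves all
degrees, so averaging over it compares the probabilities of two arcs out of the same vertex.
Fourth moments of codegrees, again obtained from the involution, control the number of rows that
can be exchanged, and every arc probability follows up to [n^(-3/2+)].  Four arc cells
then express [N(H + e) / N(H)] through such probabilities:
[ln N(H + e) - ln N(H) = ln (p / (1 - p)) + Phi(H + e) - Phi(H) + O(n^(-3/2+))],
where [Phi] is the exponent of the theorem without [J^2 / n].  Adding at most [J^2 = O(n^(1+))]
arcs one by one, the law [P] of the induced subdigraph and the Bernoulli measure [mu] satisfy
[ln (P / mu) = kappa + Phi + o(1)] uniformly over all digraphs on the block.  Both being
probability measures, Jensen's inequality gives [- E_P Phi - o(1) <= kappa <= - E_mu Phi + o(1)],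
and both means of [Phi] are [- J^2 / n + o(1)] because, to that precision, they depend only
on first and second moments of the arc indicators. *)
Require Import Defs.
From HB Require Import structures.
From mathcomp Require Import all_boot all_order all_algebra perm.
From mathcomp Require Import all_classical all_reals all_analysis.
From mathcomp Require Import ring lra zify.
Set Implicit Arguments. Unset Strict Implicit. Unset Printing Implicit Defensive.
Import Order.TTheory GRing.Theory Num.Theory.
Local Open Scope ring_scope.

(** * Exchanging two rows in two columns *)

(** The number of steps dictates the accuracy: up to [(w L)^2] arcs are added, so an error of order
    [1 / n] per arc would be useless, while [L^11 / w^3] leaves [L^13 / w]. Exchanges reach this
    accuracy because the signed differences of two columns add up to a quantity fixed by the
    degrees, apart from two entries in the rows of these columns. A difference of two arc
    probabilities is thus exactly the mean of a bounded quantity over [ndif], and [ndif] is of order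
    [n] up to logarithms. Bounding this mean crudely gives the probabilities up to about [n^(-1/2)];
    putting them back into the same identity yields the remaining accuracy. An arc inside the block
    is out of reach of exchanges, since the block is prescribed. It is therefore traded for cells
    with an end outside. The Jensen step spares an asymptotic count of regular digraphs: total mass
    one determines [kappa]. Powers of [L] absorb both [1 / A], which is at most logarithmic, and all
    numerical constants. *)

Definition free_cell n (J : nat) (e : 'I_n * 'I_n) : bool :=
  (e.1 != e.2) && ~~ ((e.1 < J)%N && (e.2 < J)%N).

Definition completions n (J : nat) (r c : 'I_n -> nat) : {set digraph n} :=
  [set M : digraph n | [forall e in M, free_cell J e] &&
     [forall i, (outdeg M i == r i) && (indeg M i == c i)]].

(** Estimates are proved for one row and two columns; transposition carries them over to one column
    and two rows. *)
Definition transpose n (M : digraph n) : digraph n := [set e | (e.2, e.1) \in M].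

(** Rows [l] and [l'] are left out because an exchange involving them could put an arc on a diagonal
    cell. *)
Definition diffrow n (l l' : 'I_n) (M : digraph n) (i : 'I_n) : bool :=
  [&& i != l, i != l' & ((i, l) \in M) (+) ((i, l') \in M)].

(* Rows [v] and [w] each hold one arc into [{l, l'}]; exchanging them keeps all degrees. *)
Definition flip n (l l' v w : 'I_n) (M : digraph n) : digraph n :=
  if diffrow l l' M v && diffrow l l' M w then
    [set e : 'I_n * 'I_n |
      (if (e.2 == l) || (e.2 == l') then (tperm v w e.1, e.2) else e) \in M]
  else M.

Section Basics.
Variable n : nat.
Implicit Types (M G : digraph n) (r c : 'I_n -> nat).

Lemma outdegE M i : outdeg M i = (\sum_k ((i, k) \in M))%N.
Proof.
rewrite /outdeg.
have -> : [set a in M | a.1 == i] = [set (i, k) | k in [set k | (i, k) \in M]].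
  apply/setP => -[a b]; rewrite !inE /=; apply/andP/imsetP.
    by move=> [aM /eqP <-]; exists b; rewrite ?inE.
  by move=> [k]; rewrite inE => ikM [-> ->].
rewrite card_imset; last by move=> x y [].
by rewrite -sum1_card big_mkcond /=; apply: eq_bigr => k _; rewrite inE; case: (_ \in M).
Qed.

Lemma indegE M i : indeg M i = (\sum_k ((k, i) \in M))%N.
Proof.
rewrite /indeg.
have -> : [set a in M | a.2 == i] = [set (k, i) | k in [set k | (k, i) \in M]].
  apply/setP => -[a b]; rewrite !inE /=; apply/andP/imsetP.
    by move=> [aM /eqP <-]; exists a; rewrite ?inE.
  by move=> [k]; rewrite inE => ikM [-> ->].
rewrite card_imset; last by move=> x y [].
by rewrite -sum1_card big_mkcond /=; apply: eq_bigr => k _; rewrite inE; case: (_ \in M).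
Qed.

Lemma completionsP J r c M :
  reflect [/\ forall e, e \in M -> free_cell J e, forall i, outdeg M i = r i
            & forall i, indeg M i = c i] (M \in completions J r c).
Proof.
rewrite inE; apply: (iffP andP).
  move=> [/forall_inP Mf /forallP deg]; split=> // i.
    by have /andP[/eqP] := deg i.
  by have /andP[_ /eqP] := deg i.
move=> [Mf ro co]; split; first exact/forall_inP.
by apply/forallP => i; rewrite ro co !eqxx.
Qed.

Lemma transposeK : involutive (@transpose n).
Proof. by move=> M; apply/setP => -[a b]; rewrite !inE. Qed.

Lemma mem_transpose M i k : ((i, k) \in transpose M) = ((k, i) \in M).
Proof. by rewrite inE. Qed.

Lemma transpose_completions J r c M :
  (transpose M \in completions J r c) = (M \in completions J c r).
Proof.
suff H r0 c0 M0 : M0 \in completions J c0 r0 -> transpose M0 \in completions J r0 c0.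
  by apply/idP/idP => /H //; rewrite transposeK.
move=> /completionsP[Mf ro co]; apply/completionsP; split.
- move=> [a b]; rewrite inE /= => /Mf /andP[/= ba JJ].
  by rewrite /free_cell /= eq_sym ba /= andbC.
- by move=> i; rewrite outdegE -co indegE; apply: eq_bigr => k _; rewrite inE.
- by move=> i; rewrite indegE -ro outdegE; apply: eq_bigr => k _; rewrite inE.
Qed.

Section Flip.
Variables l l' : 'I_n.

Lemma mem_flip v w M i k : ((i, k) \in flip l l' v w M) =
  if [&& diffrow l l' M v, diffrow l l' M w & (k == l) || (k == l')]
  then (tperm v w i, k) \in M else (i, k) \in M.
Proof.
rewrite /flip; case: (diffrow l l' M v) => //=; case: (diffrow l l' M w) => //=.
by rewrite inE /=; case: ifP.
Qed.

(** Only rows that already differ are permuted, so the set of exchangeable rows is unchanged. This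
    makes [flip] an involution and lets weights built from [dif] and [ndif] pass through it. *)
Lemma diffrow_flip v w M i : diffrow l l' (flip l l' v w M) i = diffrow l l' M i.
Proof.
rewrite {1}/diffrow !mem_flip !eqxx orbT /=.
case Dv: (diffrow l l' M v) => //=; case Dw: (diffrow l l' M w) => //=.
have [vl vl' xv] := and3P Dv; have [wl wl' xw] := and3P Dw.
by case: tpermP => [->|->|_ _] //; rewrite ?Dv ?Dw ?vl ?vl' ?wl ?wl' ?xv ?xw.
Qed.

Lemma flipK v w : involutive (flip l l' v w).
Proof.
move=> M; apply/setP => -[i k]; rewrite !mem_flip !diffrow_flip.
by case: [&& _, _ & _]; rewrite ?tpermK.
Qed.

Lemma flip_col v w M i k : k != l -> k != l' ->
  ((i, k) \in flip l l' v w M) = ((i, k) \in M).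
Proof. by move=> /negbTE kl /negbTE kl'; rewrite mem_flip kl kl' /= !andbF. Qed.

(** With both columns outside the block, the only forbidden cells in them are [(l, l)] and
    [(l', l')], which [diffrow] avoids. Each of the two rows trades one arc for one arc, and each
    column is merely permuted. *)
Lemma flip_completions J r c v w M : l != l' -> (J <= l)%N -> (J <= l')%N ->
  M \in completions J r c -> flip l l' v w M \in completions J r c.
Proof.
move=> ll' Jl Jl' /completionsP[Mf ro co].
case Dv: (diffrow l l' M v); last by rewrite /flip Dv; apply/completionsP.
case Dw: (diffrow l l' M w); last by rewrite /flip Dw andbF; apply/completionsP.
have [vl vl' xv] := and3P Dv; have [wl wl' xw] := and3P Dw.
apply/completionsP; split.
- move=> [i k]; rewrite mem_flip Dv Dw /=; case: ifP => [kl|_]; last exact: Mf.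
  have Jk : (k < J)%N = false by case/orP: kl => /eqP ->; apply/negbTE; rewrite -leqNgt.
  rewrite /free_cell /= Jk andbF andbT => tM; have := Mf _ tM; rewrite /free_cell /= Jk andbF andbT.
  case: tpermP => [->|->|] // _; first by case/orP: kl => /eqP ->.
  by case/orP: kl => /eqP ->.
- move=> i; rewrite -ro !outdegE.
  rewrite (bigD1 l) //= [in RHS](bigD1 l) //= (bigD1 l') 1?eq_sym //=.
  rewrite [in X in _ = (_ + X)%N](bigD1 l') 1?eq_sym //= !addnA.
  congr (_ + _)%N; last first.
    by apply: eq_bigr => k /andP[kl kl']; rewrite flip_col.
  rewrite !mem_flip Dv Dw !eqxx orbT /=.
  by case: tpermP => [->|->|//]; move: xv xw;
    case: (_ \in M); case: (_ \in M); case: (_ \in M); case: (_ \in M).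
- move=> i; rewrite -co !indegE.
  case kl : ((i == l) || (i == l')); last first.
    by apply: eq_bigr => k _; rewrite mem_flip kl !andbF.
  rewrite [RHS](reindex_inj (@perm_inj _ (tperm v w))) /=.
  by apply: eq_bigr => k _; rewrite mem_flip kl Dv Dw.
Qed.

End Flip.
End Basics.

(** * Averages over completions and the resampling identity *)

Definition entry (R : realType) n (M : digraph n) (i k : 'I_n) : R := ((i, k) \in M)%:R.

(** On an empty [S] the value is 0, by the convention for division; non-emptiness is assumed only
    from [mean_cst] on, where constants are averaged. *)
Definition mean (R : realType) (T : finType) (S : {set T}) (f : T -> R) : R :=
  (\sum_(M in S) f M) / #|S|%:R.

Section Mean.
Variables (R : realType) (T : finType) (S : {set T}).
Implicit Types f g : T -> R.

Lemma eq_mean f g : {in S, f =1 g} -> mean S f = mean S g.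
Proof. by move=> fg; rewrite /mean; congr (_ / _); apply: eq_bigr. Qed.

Lemma meanD f g : mean S (fun M => f M + g M) = mean S f + mean S g.
Proof. by rewrite /mean big_split mulrDl. Qed.

Lemma meanN f : mean S (fun M => - f M) = - mean S f.
Proof. by rewrite /mean sumrN mulNr. Qed.

Lemma meanB f g : mean S (fun M => f M - g M) = mean S f - mean S g.
Proof. by rewrite meanD meanN. Qed.

Lemma meanZ a f : mean S (fun M => a * f M) = a * mean S f.
Proof. by rewrite /mean -mulr_sumr mulrA. Qed.

Lemma mean_sum (I : Type) (s : seq I) (P : pred I) (F : I -> T -> R) :
  mean S (fun M => \sum_(i <- s | P i) F i M) = \sum_(i <- s | P i) mean S (F i).
Proof. by rewrite /mean exchange_big /= mulr_suml. Qed.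

Lemma le_mean f g : (forall M, M \in S -> f M <= g M) -> mean S f <= mean S g.
Proof. by move=> fg; rewrite /mean ler_wpM2r ?invr_ge0 ?ler0n // ler_sum. Qed.

Lemma mean_ge0 f : (forall M, M \in S -> 0 <= f M) -> 0 <= mean S f.
Proof. by move=> f0; rewrite /mean mulr_ge0 ?invr_ge0 ?ler0n // sumr_ge0. Qed.

Lemma ler_norm_mean f : `|mean S f| <= mean S (fun M => `|f M|).
Proof.
rewrite /mean normrM [X in _ * X]ger0_norm ?invr_ge0 ?ler0n //.
by rewrite ler_wpM2r ?invr_ge0 ?ler0n // ler_norm_sum.
Qed.

Hypothesis S0 : S != finset.set0.

Lemma mean_cst (a : R) : mean S (fun=> a) = a.
Proof.
rewrite /mean sumr_const -(mulr_natr a) mulfK // pnatr_eq0 -lt0n card_gt0.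
exact: S0.
Qed.

Lemma mean_le f a : (forall M, M \in S -> f M <= a) -> mean S f <= a.
Proof. by move=> fa; rewrite -[leRHS]mean_cst le_mean. Qed.

Lemma mean_norm_le f a : (forall M, M \in S -> `|f M| <= a) -> `|mean S f| <= a.
Proof. by move=> fa; apply: le_trans (ler_norm_mean f) _; apply: mean_le. Qed.

End Mean.

Section Resampling.
Variables (R : realType) (n J : nat) (r c : 'I_n -> nat) (l l' : 'I_n).
Hypotheses (ll' : l != l') (Jl : (J <= l)%N) (Jl' : (J <= l')%N).
Notation S := (completions J r c).
Implicit Types (M : digraph n) (v w u : 'I_n).
Local Notation x := (@entry R n).

(* [sgd] is the signed difference of columns [l] and [l'], which [flip] permutes. *)
Definition dif M w : R := (diffrow l l' M w)%:R.
Definition sgd M w : R := dif M w * (x M w l - x M w l').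
Definition ndif M : R := \sum_w dif M w.

Lemma mean_flip (g : digraph n -> R) v w :
  mean S g = mean S (fun M => g (flip l l' v w M)).
Proof.
rewrite /mean; congr (_ / _).
rewrite (reindex_inj (inv_inj (flipK l l' v w))) /=; apply: eq_bigl => M.
apply/idP/idP => [H|]; last exact: flip_completions.
by rewrite -[M](flipK l l' v w) flip_completions.
Qed.

Lemma dif1 M w : diffrow l l' M w -> dif M w = 1.
Proof. by rewrite /dif => ->. Qed.

Lemma dif0 M w : ~~ diffrow l l' M w -> dif M w = 0.
Proof. by rewrite /dif => /negbTE ->. Qed.

Lemma dif01 M w : 0 <= dif M w <= 1.
Proof. by rewrite /dif; case: diffrow; rewrite ?ler01 lexx. Qed.

Lemma dif_idem M w : dif M w * dif M w = dif M w.
Proof. by rewrite /dif; case: diffrow; rewrite ?mulr1 ?mulr0. Qed.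

Lemma dif_flip v w M u : dif (flip l l' v w M) u = dif M u.
Proof. by rewrite /dif diffrow_flip. Qed.

Lemma ndif_flip v w M : ndif (flip l l' v w M) = ndif M.
Proof. by apply: eq_bigr => u _; rewrite dif_flip. Qed.

Lemma dif_sgd M w : dif M w * sgd M w = sgd M w.
Proof. by rewrite /sgd mulrA dif_idem. Qed.

Lemma norm_sgd M w : `|sgd M w| = dif M w.
Proof.
rewrite /sgd /dif /entry /diffrow; case: (w != l) => /=; last by rewrite mul0r normr0.
case: (w != l') => /=; last by rewrite mul0r normr0.
by case: (_ \in M); case: (_ \in M); rewrite /= ?mul0r ?normr0 // mul1r ?subr0 ?sub0r ?normrN normr1.
Qed.

Lemma sgdE M v : v != l -> v != l' -> x M v l - x M v l' = sgd M v.
Proof.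
rewrite /sgd /dif /diffrow => -> -> /=; rewrite /entry.
by case: (_ \in M); case: (_ \in M); rewrite /= ?mul1r ?subrr ?mulr0.
Qed.

Lemma sgd_flip v w M u : diffrow l l' M v -> diffrow l l' M w ->
  sgd (flip l l' v w M) u = sgd M (tperm v w u).
Proof.
move=> Dv Dw; rewrite /sgd dif_flip /entry !mem_flip !eqxx Dv Dw orbT /=.
congr (_ * _); case: tpermP => [->|->|//]; by rewrite /dif Dv Dw.
Qed.

Lemma ndif_ge0 M : 0 <= ndif M.
Proof. by apply: sumr_ge0 => w _; case/andP: (dif01 M w). Qed.

Lemma ndif_le M : ndif M <= n%:R.
Proof.
rewrite -[n in leRHS]card_ord -sumr_const; apply: ler_sum => w _.
by case/andP: (dif01 M w).
Qed.

Lemma dif_le_ndif M v : dif M v <= ndif M.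
Proof.
rewrite /ndif (bigD1 v) //= lerDl; apply: sumr_ge0 => w _.
by case/andP: (dif01 M w).
Qed.

(** If [v] is exchangeable then [ndif M] is at least 1; if not, both sides are 0. So later weights
    can divide by [ndif] with no positivity assumption. *)
Lemma dif_ndifK M v : dif M v * (ndif M / ndif M) = dif M v.
Proof.
have := dif_le_ndif M v; have [/dif1 ->|/dif0 ->] := boolP (diffrow l l' M v).
  by move=> d1; rewrite mul1r divff // gt_eqF // (lt_le_trans _ d1) ?ltr01.
by rewrite mul0r.
Qed.

(** Exchange [v] with a uniformly chosen row among the [ndif M] exchangeable ones: the weights are
    invariant and the sign at [v] becomes the sign at [w]. The gain is that [\sum_w sgd M w], unlike
    a single sign, is almost determined by the degrees. *)
Lemma mean_resample (Z : digraph n -> R) v :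
  (forall v w M, Z (flip l l' v w M) = Z M) ->
  mean S (fun M => Z M * sgd M v) =
  mean S (fun M => Z M * (dif M v / ndif M) * \sum_w sgd M w).
Proof.
move=> ZI.
transitivity (\sum_w mean S (fun M => Z M * (dif M v * dif M w / ndif M) * sgd M v)).
  rewrite -mean_sum; apply: eq_mean => M _; rewrite -mulr_suml -mulr_sumr.
  rewrite -mulrA; congr (_ * _); rewrite -mulr_suml -mulr_sumr -/(ndif M).
  by rewrite -(mulrA (dif M v)) dif_ndifK dif_sgd.
under [RHS]eq_mean => M _ do rewrite mulr_sumr.
rewrite mean_sum; apply: eq_bigr => w _.
rewrite (mean_flip _ v w); apply: eq_mean => M _.
rewrite ZI !dif_flip ndif_flip -!mulrA; congr (_ * _).
have [Dv|/dif0 Dv] := boolP (diffrow l l' M v); last by rewrite Dv !mul0r.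
have [Dw|/dif0 Dw] := boolP (diffrow l l' M w); last first.
  by rewrite -[sgd M w]dif_sgd Dw !mul0r !mulr0.
by rewrite sgd_flip // tpermL (dif1 Dw) !mul1r.
Qed.

Section Moment.
Variable b : digraph n -> 'I_n -> R.
Hypothesis b01 : forall M w, 0 <= b M w <= 1.
Hypothesis bI : forall v w M u, b (flip l l' v w M) u = b M u.

(** For [b M v = x M v t] this is a difference of two codegrees up to bounded terms, see
    [bal_cod]. *)
Definition bal M : R := \sum_w sgd M w * b M w.

(** Only the terms at [v] and [w] move, and the change factors as
    [(sgd M w - sgd M v) * (b M v - b M w)], with factors at most 2 and 1 in absolute value. *)
Lemma bal_flip v w M : diffrow l l' M v -> diffrow l l' M w ->
  `|bal (flip l l' v w M) - bal M| <= 2.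
Proof.
move=> Dv Dw; have [<-|vw] := eqVneq v w.
  suff -> : flip l l' v v M = M by rewrite subrr normr0 ler0n.
  by apply/setP => -[i k]; rewrite mem_flip tperm1 perm1 if_same.
have -> : bal (flip l l' v w M) - bal M = \sum_u (sgd M (tperm v w u) - sgd M u) * b M u.
  by rewrite -sumrB; apply: eq_bigr => u _; rewrite sgd_flip // bI mulrBl.
rewrite (bigD1 v) //= (bigD1 w) 1?eq_sym //= big1 ?addr0; last first.
  by move=> u /andP[uv uw]; rewrite tpermD 1?eq_sym // subrr mul0r.
rewrite tpermL tpermR.
have := norm_sgd M v; have := norm_sgd M w; rewrite (dif1 Dv) (dif1 Dw).
move=> /eqP; rewrite eqr_norml // => /andP[H1 _] /eqP; rewrite eqr_norml // => /andP[H2 _].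
have := b01 M v; have := b01 M w => /andP[B1 B2] /andP[B3 B4].
case/orP: H1 => /eqP ->; case/orP: H2 => /eqP ->; by rewrite ler_norml; apply/andP; split; lra.
Qed.

(** Stein's method of exchangeable pairs. One factor [bal M] is a sum over pairs [(v, w)] of a
    kernel that changes sign when the two rows are exchanged, plus a remainder carried by the total
    sign. Antisymmetry turns the other [q] factors into a difference of powers, which is of lower
    order. *)
Lemma bal_step q :
  mean S (fun M => bal M ^+ q.+1) =
  2^-1 * (\sum_v \sum_w mean S (fun M => (ndif M)^-1 * (dif M v * dif M w) * (b M v * (sgd M v - sgd M w)) *
     (bal M ^+ q - bal (flip l l' v w M) ^+ q)))
  + mean S (fun M => bal M ^+ q * (((\sum_v dif M v * b M v) / ndif M) * \sum_w sgd M w)).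
Proof.
have E M : bal M ^+ q.+1 =
   (\sum_v \sum_w (ndif M)^-1 * (dif M v * dif M w) * (b M v * (sgd M v - sgd M w)) * bal M ^+ q)
   + bal M ^+ q * (((\sum_v dif M v * b M v) / ndif M) * \sum_w sgd M w).
  have H v : \sum_w (ndif M)^-1 * (dif M v * dif M w) * (b M v * (sgd M v - sgd M w)) =
      sgd M v * b M v - dif M v * b M v / ndif M * \sum_w sgd M w.
    under eq_bigr => w _ do rewrite mulrBr mulrBr.
    rewrite sumrB; congr (_ - _).
      rewrite -mulr_suml -mulr_sumr -mulr_sumr -/(ndif M).
      by rewrite -[in RHS](dif_sgd M v) -[in RHS](dif_ndifK M v); ring.
    rewrite mulr_sumr; apply: eq_bigr => w _.
    by rewrite -[in RHS](dif_sgd M w); ring.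
  under eq_bigr => v _ do rewrite -mulr_suml H.
  by rewrite -mulr_suml sumrB -mulr_suml -mulr_suml exprSr /bal; ring.
under eq_mean => M _ do rewrite E.
rewrite meanD; congr (_ + _).
rewrite mean_sum mulr_sumr; apply: eq_bigr => v _.
rewrite mean_sum mulr_sumr; apply: eq_bigr => w _.
set g := (fun M => _ * bal M ^+ q).
have -> : mean S g = 2^-1 * (mean S g + mean S (fun M => g (flip l l' v w M))).
  rewrite -mean_flip; lra.
rewrite -meanD; congr (_ * _); apply: eq_mean => M _; rewrite /g.
rewrite !dif_flip !ndif_flip bI.
have [Dv|/dif0 Dv] := boolP (diffrow l l' M v); last by rewrite Dv; ring.
have [Dw|/dif0 Dw] := boolP (diffrow l l' M w); last by rewrite Dw; ring.
by rewrite !sgd_flip // tpermL tpermR; ring.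
Qed.

End Moment.
End Resampling.

Section MomentBounds.
Variables (R : realType) (n J : nat) (r c : 'I_n -> nat) (l l' : 'I_n).
Hypotheses (ll' : l != l') (Jl : (J <= l)%N) (Jl' : (J <= l')%N).
Notation S := (completions J r c).
Implicit Types (M : digraph n) (v w u : 'I_n).
Hypothesis S0 : S != finset.set0.
Variable b : digraph n -> 'I_n -> R.
Hypothesis b01 : forall M w, 0 <= b M w <= 1.
Hypothesis bI : forall v w M u, b (flip l l' v w M) u = b M u.
Hypothesis sgd2 : forall M, M \in S -> `|\sum_w sgd R l l' M w| <= 2.
Local Notation bal := (bal l l' b).
Local Notation ndif := (ndif R l l').
Local Notation dif := (dif R l l').
Local Notation sgd := (sgd R l l').

Lemma weight_le1 M : `|(\sum_v dif M v * b M v) / ndif M| <= 1.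
Proof.
have bd : 0 <= \sum_v dif M v * b M v <= ndif M.
  rewrite sumr_ge0 /=; last first.
    by move=> v _; rewrite mulr_ge0 //; case/andP: (b01 M v).
  apply: ler_sum => v _; rewrite ler_piMr //.
  by case/andP: (b01 M v).
have [d0|d0] := eqVneq (ndif M) 0; first by rewrite d0 invr0 mulr0 normr0 ler01.
have dp : 0 < ndif M by rewrite lt_def d0 ndif_ge0.
case/andP: bd => b1 b2.
by rewrite ger0_norm ?divr_ge0 ?ndif_ge0 // ler_pdivrMr // mul1r.
Qed.

Lemma tail_le q M : M \in S ->
  bal M ^+ q * (((\sum_v dif M v * b M v) / ndif M) * \sum_w sgd M w) <= 2 * `|bal M| ^+ q.
Proof.
move=> MS; have := weight_le1 M; move: (_ / _) => W W1.
apply: le_trans (ler_norm _) _; rewrite !normrM normrX mulrC ler_wpM2r ?exprn_ge0 //.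
by rewrite -[leRHS]mul1r ler_pM ?normr_ge0 ?sgd2.
Qed.

Lemma bal_step_le q (K : digraph n -> digraph n -> R) :
  (forall M M', `|bal M' - bal M| <= 2 -> 2 * `|bal M ^+ q - bal M' ^+ q| <= K M M') ->
  mean S (fun M => bal M ^+ q.+1) <=
  2^-1 * (\sum_v \sum_w mean S (fun M => (ndif M)^-1 * (dif M v * dif M w) * K M (flip l l' v w M)))
  + mean S (fun M => 2 * `|bal M| ^+ q).
Proof.
move=> HK; rewrite (bal_step r c ll' Jl Jl' bI) lerD //; last first.
  by apply: le_mean => M MS; exact: tail_le.
rewrite ler_wpM2l // ler_sum // => v _; rewrite ler_sum // => w _.
apply: le_mean => M _; rewrite -mulrA.
have [Dv|/(dif0 R) ->] := boolP (diffrow l l' M v); last by rewrite mul0r mulr0 !mul0r.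
have [Dw|/(dif0 R) ->] := boolP (diffrow l l' M w); last by rewrite !mulr0 !mul0r.
rewrite (dif1 R Dv) (dif1 R Dw) !mulr1 ler_wpM2l ?invr_ge0 ?ndif_ge0 //.
apply: le_trans (ler_norm _) _; rewrite normrM.
apply: le_trans (HK M _ (bal_flip b01 bI Dv Dw)).
rewrite ler_wpM2r // normrM -[2]mul1r ler_pM //.
  by have /andP[b0 b1] := b01 M v; rewrite ger0_norm.
apply: le_trans (ler_normB _ _) _; rewrite !norm_sgd (dif1 R Dv) (dif1 R Dw); lra.
Qed.

(** The weights add up to [ndif M] itself, hence to at most [n]. *)
Lemma sum_weight M (a : R) : 0 <= a ->
  \sum_v \sum_w (ndif M)^-1 * (dif M v * dif M w) * a <= n%:R * a.
Proof.
move=> a0; under eq_bigr => v _ do rewrite -mulr_suml -mulr_sumr -mulr_sumr -/(ndif M) mulrA.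
rewrite -mulr_suml -mulr_suml -mulr_sumr -/(ndif M) ler_wpM2r //.
apply: le_trans (ndif_le R l l' M); have [->|d0] := eqVneq (ndif M) 0; first by rewrite mulr0.
by rewrite mulVf // mul1r.
Qed.

Lemma bal_moment2 : mean S (fun M => bal M ^+ 2) <= 4 * n%:R + 4.
Proof.
have := @bal_step_le 1 (fun _ _ => 4); set m := mean _ _; move=> /(_ _)/wrap[].
  by move=> M M' MM'; rewrite !expr1 distrC; lra.
have H1 : \sum_v \sum_w mean S (fun M => (ndif M)^-1 * (dif M v * dif M w) * 4) <= n%:R * 4.
  under eq_bigr => v _ do rewrite -mean_sum.
  by rewrite -mean_sum; apply: mean_le => // M _; apply: sum_weight.
(* The remainder is absorbed by [2 y <= y^2 / 2 + 2], which leaves [m <= 2 n + m / 2 + 2]. *)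
have H2 : mean S (fun M => 2 * `|bal M| ^+ 1) <= 2^-1 * m + 2.
  rewrite -meanZ -[X in _ + X](mean_cst S0) -meanD; apply: le_mean => M _.
  rewrite expr1 -real_normK ?num_real //; have := sqr_ge0 (`|bal M| - 2); nra.
move=> H; lra.
Qed.

Lemma bal_moment4 : (0 < n)%N -> mean S (fun M => bal M ^+ 4) <= 128 * n%:R ^+ 2.
Proof.
move=> n0; have := @bal_step_le 3 (fun M M' => 6 * (bal M ^+ 2 + bal M' ^+ 2)).
set m := mean _ _; move=> /(_ _)/wrap[].
  move=> M M' MM'.
  have -> : bal M ^+ 3 - bal M' ^+ 3 = (bal M - bal M') * (bal M ^+ 2 + bal M * bal M' + bal M' ^+ 2) by ring.
  have sq : `|bal M ^+ 2 + bal M * bal M' + bal M' ^+ 2| <= 3 / 2 * (bal M ^+ 2 + bal M' ^+ 2).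
    by rewrite ler_norml; apply/andP; split; have := sqr_ge0 (bal M - bal M'); have := sqr_ge0 (bal M + bal M'); nra.
  rewrite normrM distrC.
  have := ler_pM (normr_ge0 _) (normr_ge0 _) MM' sq; lra.
set m2 := mean S (fun M => bal M ^+ 2).
have m2le : m2 <= 4 * n%:R + 4 by exact: bal_moment2.
(* The weights are invariant, so the squares before and after the exchange have the same weighted
   mean, and [6 + 6 = 12]. *)
have H1 : \sum_v \sum_w mean S (fun M => (ndif M)^-1 * (dif M v * dif M w) * (6 * (bal M ^+ 2 + bal (flip l l' v w M) ^+ 2)))
   <= n%:R * (12 * m2).
  have H v w : mean S (fun M => (ndif M)^-1 * (dif M v * dif M w) * (6 * (bal M ^+ 2 + bal (flip l l' v w M) ^+ 2)))
     = mean S (fun M => (ndif M)^-1 * (dif M v * dif M w) * (12 * bal M ^+ 2)).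
    transitivity (mean S (fun M => (ndif M)^-1 * (dif M v * dif M w) * (6 * bal M ^+ 2)) * 2).
      rewrite mulr_natr mulr2n [in X in _ + X](mean_flip r c ll' Jl Jl' _ v w) -meanD.
      by apply: eq_mean => M _; rewrite !ndif_flip !dif_flip; ring.
    by rewrite mulrC -meanZ; apply: eq_mean => M _; ring.
  under eq_bigr => v _ do under eq_bigr => w _ do rewrite H.
  under eq_bigr => v _ do rewrite -mean_sum.
  rewrite -mean_sum -!meanZ; apply: le_mean => M _; apply: sum_weight.
  by rewrite mulr_ge0 // sqr_ge0.
(* By [2 y^3 <= y^4 / 2 + 2 y^2] half of the fourth moment is absorbed. Then [m <= (12 n + 4) m2],
   and [16 n * 8 n] is the origin of 128. *)
have H2 : mean S (fun M => 2 * `|bal M| ^+ 3) <= 2^-1 * m + 2 * m2.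
  rewrite -!meanZ -meanD; apply: le_mean => M _.
  have E2 : bal M ^+ 2 = `|bal M| ^+ 2 by rewrite real_normK ?num_real.
  have -> : bal M ^+ 4 = (bal M ^+ 2) ^+ 2 by rewrite -exprM.
  rewrite E2; move: `|bal M| => y; have := sqr_ge0 (y ^+ 2 - 2 * y); nra.
have n1 : 1 <= n%:R :> R by rewrite ler1n.
move=> H; have : m <= (12 * n%:R + 4) * m2 by lra.
move=> H3; apply: le_trans H3 _.
have : (12 * n%:R + 4) * m2 <= (12 * n%:R + 4) * (4 * n%:R + 4) by rewrite ler_wpM2l //; lra.
nra.
Qed.

End MomentBounds.

(** * Codegrees *)

(* In the application [w = n^(1/2)] and [L = n^(2 eps)]; every error is some [L^k / w^j]. *)
Record regime (R : realType) (n s J : nat) (L w : R) : Prop := Regime {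
  rg_w0 : 0 < w;
  rg_w2 : w ^+ 2 = n%:R;
  rg_L : 100 <= L;
  rg_Lw : L ^+ 60 <= w;
  rg_J : J%:R <= w * L;
  rg_s0 : (0 < s)%N;
  rg_sn : (s < n)%N;
  rg_A : 1 <= L * (2^-1 * (s%:R / n%:R) * (1 - s%:R / n%:R))
}.

(* The degrees left by a digraph on the block and at most two further arcs. *)
Definition near_regular n (J s : nat) (r : 'I_n -> nat) : Prop :=
  [/\ forall i, (r i <= s)%N,
      forall i, (s <= r i + (if (i < J)%N then J.+1 else 1))%N
    & (\sum_(i < n | (J <= i)%N) (s - r i) <= 2)%N].

Definition cod (R : realType) n (M : digraph n) (l t : 'I_n) : R :=
  \sum_i entry R M i l * entry R M i t.

(** Cauchy-Schwarz, read off from the nonnegative double sum of [(y i - y j)^2]. *)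
Lemma sqr_sum_le (R : realType) (I : finType) (T : pred I) (y : I -> R) :
  (\sum_(i | T i) y i) ^+ 2 <= #|T|%:R * \sum_(i | T i) y i ^+ 2.
Proof.
have : 0 <= \sum_(i | T i) \sum_(j | T j) (y i - y j) ^+ 2.
  by apply: sumr_ge0 => i _; apply: sumr_ge0 => j _; exact: sqr_ge0.
have -> : \sum_(i | T i) \sum_(j | T j) (y i - y j) ^+ 2 =
  2 * (#|T|%:R * \sum_(i | T i) y i ^+ 2) - 2 * (\sum_(i | T i) y i) ^+ 2.
  transitivity (\sum_(i | T i) (#|T|%:R * y i ^+ 2 - 2 * y i * (\sum_(j | T j) y j) + \sum_(j | T j) y j ^+ 2)).
    apply: eq_bigr => i _.
    rewrite mulr_sumr mulr_natl -sumr_const -sumrB -big_split /=.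
    by apply: eq_bigr => j _; ring.
  rewrite big_split /= sumrB sumr_const -mulr_sumr -mulr_suml -mulr_sumr -mulr_natl.
  ring.
by rewrite subr_ge0 ler_pM2l.
Qed.

Lemma pow4_sum_le (R : realType) (I : finType) (T : pred I) (y : I -> R) :
  (\sum_(i | T i) y i) ^+ 4 <= #|T|%:R ^+ 3 * \sum_(i | T i) y i ^+ 4.
Proof.
rewrite -[4%N]/(2 * 2)%N exprM.
have H := sqr_sum_le T y.
have H2 := sqr_sum_le T (fun i => y i ^+ 2).
have : ((\sum_(i | T i) y i) ^+ 2) ^+ 2 <= (#|T|%:R * \sum_(i | T i) y i ^+ 2) ^+ 2.
  by rewrite lerXn2r // ?nnegrE ?sqr_ge0 // mulr_ge0 // sumr_ge0 // => i _; exact: sqr_ge0.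
move=> /le_trans; apply; rewrite exprMn (exprSr _ 2) -mulrA ler_wpM2l ?sqr_ge0 //.
by apply: le_trans H2 _; under eq_bigr do rewrite -exprM.
Qed.

Lemma pow4_add_le (R : realType) (a b : R) : (a + b) ^+ 4 <= 8 * (a ^+ 4 + b ^+ 4).
Proof.
have h1 : (a + b) ^+ 2 <= 2 * (a ^+ 2 + b ^+ 2) by have := sqr_ge0 (a - b); nra.
have h2 : (a ^+ 2 + b ^+ 2) ^+ 2 <= 2 * (a ^+ 4 + b ^+ 4).
  by have := sqr_ge0 (a ^+ 2 - b ^+ 2); nra.
have h3 : ((a + b) ^+ 2) ^+ 2 <= (2 * (a ^+ 2 + b ^+ 2)) ^+ 2.
  by rewrite lerXn2r // ?nnegrE ?sqr_ge0 // mulr_ge0 // addr_ge0 ?sqr_ge0.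
move: h3; rewrite -exprM => h3; apply: le_trans h3 _; nra.
Qed.

Section Sums.
Variables (R : realType) (n J : nat) (r c : 'I_n -> nat).
Notation S := (completions J r c).
Local Notation x := (@entry R n).
Implicit Types (M : digraph n) (i k l t v : 'I_n).

Lemma entry01 M i k : 0 <= x M i k <= 1.
Proof. by rewrite /entry; case: (_ \in M); rewrite ?ler01 lexx. Qed.

Lemma entry_ge0 M i k : 0 <= x M i k. Proof. by case/andP: (entry01 M i k). Qed.

Lemma entry_le1 M i k : x M i k <= 1. Proof. by case/andP: (entry01 M i k). Qed.

Lemma entry_idem M i k : x M i k * x M i k = x M i k.
Proof. by rewrite /entry; case: (_ \in M); rewrite ?mulr1 ?mulr0. Qed.

Lemma entry_transpose M i k : x (transpose M) i k = x M k i.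
Proof. by rewrite /entry mem_transpose. Qed.

Lemma entry_loop M i : M \in S -> x M i i = 0.
Proof.
move=> /completionsP[Mf _ _]; rewrite /entry; case: (boolP (_ \in M)) => // /Mf.
by rewrite /free_cell /= eqxx.
Qed.

Lemma entry_block M i k : M \in S -> (i < J)%N -> (k < J)%N -> x M i k = 0.
Proof.
move=> /completionsP[Mf _ _] iJ kJ; rewrite /entry; case: (boolP (_ \in M)) => // /Mf.
by rewrite /free_cell /= iJ kJ andbF.
Qed.

Lemma entry_row_sum M i : M \in S -> \sum_k x M i k = (r i)%:R.
Proof. by move=> /completionsP[_ <- _]; rewrite outdegE natr_sum. Qed.

Lemma entry_col_sum M k : M \in S -> \sum_i x M i k = (c k)%:R.
Proof. by move=> /completionsP[_ _ <-]; rewrite indegE natr_sum. Qed.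

Lemma row_restrict M i (T : pred 'I_n) : M \in S ->
  (r i)%:R - #|predC T|%:R <= \sum_(k | T k) x M i k <= (r i)%:R.
Proof.
move=> MS.
have -> : (r i)%:R = \sum_(k | T k) x M i k + \sum_(k | ~~ T k) x M i k.
  by rewrite -(entry_row_sum i MS) (bigID T).
have H1 : \sum_(k | ~~ T k) x M i k <= #|predC T|%:R.
  by rewrite -sum1_card natr_sum; apply: ler_sum => k _; exact: entry_le1.
have H2 : 0 <= \sum_(k | ~~ T k) x M i k by apply: sumr_ge0 => k _; exact: entry_ge0.
apply/andP; split; lra.
Qed.

Section Pair.
Variables l l' : 'I_n.
Hypothesis ll' : l != l'.

(** [sgd] drops the rows [l] and [l']. Their diagonal cells are empty, and the last two terms
    correct for the other cell of each. *)
Lemma sum_sgdM M (g : 'I_n -> R) : M \in S ->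
  \sum_v sgd R l l' M v * g v =
  \sum_v (x M v l - x M v l') * g v + x M l l' * g l - x M l' l * g l'.
Proof.
move=> MS; rewrite [in LHS](bigD1 l) //= [in RHS](bigD1 l) //=.
rewrite [in LHS](bigD1 l') 1?eq_sym //= [in X in _ = _ + X + _ - _](bigD1 l') 1?eq_sym //=.
rewrite {1 2}/sgd /dif /diffrow !eqxx /= andbF !mul0r !(entry_loop _ MS).
rewrite (eq_bigr (fun v => (x M v l - x M v l') * g v)); first ring.
by move=> v /andP[vl vl']; rewrite sgdE.
Qed.

Lemma sum_sgd M : M \in S ->
  \sum_v sgd R l l' M v = (c l)%:R - (c l')%:R - x M l' l + x M l l'.
Proof.
move=> MS; rewrite (eq_bigr (fun v => sgd R l l' M v * 1)); last by move=> *; rewrite mulr1.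
rewrite (sum_sgdM (fun=> 1) MS); under eq_bigr do rewrite mulr1.
by rewrite sumrB !entry_col_sum //; ring.
Qed.

Lemma bal_cod M t : M \in S ->
  bal l l' (fun M v => x M v t) M =
  cod R M l t - cod R M l' t + x M l l' * x M l t - x M l' l * x M l' t.
Proof.
move=> MS; rewrite /bal sum_sgdM // /cod -sumrB; congr (_ + _ - _).
by apply: eq_bigr => v _; rewrite mulrBl.
Qed.

(** The number of rows where two 0-1 columns differ is the sum of their squared differences, hence a
    sum of column degrees minus twice a codegree. This is why codegrees have to be controlled. *)
Lemma ndif_cod M : M \in S ->
  ndif R l l' M = (c l)%:R + (c l')%:R - x M l' l - x M l l' - 2 * cod R M l l'.
Proof.
move=> MS.
have -> : ndif R l l' M = \sum_v sgd R l l' M v * (x M v l - x M v l').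
  apply: eq_bigr => v _; rewrite /sgd /dif /entry /diffrow.
  case: (v != l) => /=; last by rewrite !mul0r.
  case: (v != l') => /=; last by rewrite !mul0r.
  by case: (_ \in M); case: (_ \in M) => /=; ring.
rewrite sum_sgdM // !entry_loop //.
rewrite (eq_bigr (fun v => x M v l + x M v l' - 2 * (x M v l * x M v l'))); last first.
  by move=> v _; have := entry_idem M v l; have := entry_idem M v l'; lra.
rewrite sumrB big_split /= !entry_col_sum // -mulr_sumr /cod.
have := entry_idem M l l'; have := entry_idem M l' l; lra.
Qed.

End Pair.
End Sums.

Definition outside n (J : nat) (X : seq 'I_n) : pred 'I_n :=
  [pred k : 'I_n | (J <= k)%N && (k \notin X)].

Lemma card_predC_outside n J (X : seq 'I_n) : (#|predC (outside J X)| <= J + size X)%N.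
Proof.
have -> : #|predC (outside J X)| = #|predU [pred k : 'I_n | (k < J)%N] (mem X)|.
  by apply: eq_card => k; rewrite !inE negb_and negbK -ltnNge.
apply: leq_trans (leq_addr #|predI [pred k : 'I_n | (k < J)%N] (mem X)| _) _.
rewrite cardUI leq_add ?card_size //.
rewrite cardE -(size_map val) -[X in (_ <= X)%N](size_iota 0); apply: uniq_leq_size.
  by rewrite map_inj_uniq ?enum_uniq //; exact: val_inj.
by move=> _ /mapP[k + ->]; rewrite mem_enum => kJ; rewrite mem_iota.
Qed.

Section Regime.
Variables (R : realType) (n s J : nat) (L w : R).
Hypothesis rg : regime n s J L w.
Local Notation lam := (s%:R / n%:R : R).
Local Notation A := (2^-1 * lam * (1 - lam) : R).

Lemma rg_L1 : 1 <= L. Proof. have := rg_L rg; lra. Qed.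

Lemma rg_L0 : 0 < L. Proof. have := rg_L rg; lra. Qed.

Lemma rg_pow k : (k <= 60)%N -> L ^+ k <= w.
Proof. by move=> k60; apply: le_trans (rg_Lw rg); rewrite ler_weXn2l ?rg_L1. Qed.

Lemma rg_Lk1 k : 1 <= L ^+ k. Proof. by rewrite exprn_ege1 ?rg_L1. Qed.

Lemma rg_w1 : 1 <= w. Proof. by have := @rg_pow 0 isT; rewrite expr0. Qed.

Lemma rg_n0 : 0 < n%:R :> R. Proof. by rewrite -(rg_w2 rg) exprn_gt0 ?(rg_w0 rg). Qed.

Lemma rg_s_gt0 : 0 < s%:R :> R. Proof. by rewrite ltr0n (rg_s0 rg). Qed.

Lemma rg_s_lt : s%:R < n%:R :> R. Proof. by rewrite ltr_nat (rg_sn rg). Qed.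

Lemma lam_gt0 : 0 < lam. Proof. by rewrite divr_gt0 ?rg_s_gt0 ?rg_n0. Qed.

Lemma lam_lt1 : lam < 1. Proof. by rewrite ltr_pdivrMr ?rg_n0 // mul1r rg_s_lt. Qed.

Lemma A_gt0 : 0 < A.
Proof. by rewrite mulr_gt0 ?subr_gt0 ?lam_lt1 // mulr_gt0 ?lam_gt0. Qed.

Lemma invA_le : A^-1 <= L.
Proof. by rewrite -[A^-1]mul1r ler_pdivrMr ?A_gt0 // (rg_A rg). Qed.

Lemma sE : s%:R = lam * n%:R :> R.
Proof. by rewrite divfK // gt_eqF ?rg_n0. Qed.

Lemma rg_J_small : 100 * J%:R <= n%:R :> R.
Proof.
rewrite -(rg_w2 rg); have := rg_J rg; have := rg_L rg; have := @rg_pow 2 isT; have := rg_w0 rg.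
move=> w0 L2 L4 Jw.
have : w * (L * 100) <= w * w by rewrite ler_pM2l //; nra.
nra.
Qed.

Lemma rg_n_large : 100 <= n%:R :> R.
Proof.
have := rg_L rg; have := @rg_pow 1 isT; rewrite -(rg_w2 rg) expr1 => Lw L4.
nra.
Qed.

Section Model.
Variables r c : 'I_n -> nat.
Hypotheses (nr : near_regular J s r) (nc : near_regular J s c).
Notation S := (completions J r c).
Hypothesis S0 : S != finset.set0.
Local Notation x := (@entry R n).
Implicit Types (M : digraph n) (i k l t v : 'I_n).

Lemma near_out (d : 'I_n -> nat) i : near_regular J s d -> (J <= i)%N ->
  s%:R - 1 <= ((d i)%:R : R) <= s%:R.
Proof.
move=> [H1 H2 _] Ji; have := H2 i; rewrite ltnNge Ji /= => H3.
by rewrite lerBlDr natr1 !ler_nat H1 andbT -addn1.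
Qed.

Lemma near_all (d : 'I_n -> nat) i : near_regular J s d ->
  s%:R - J%:R - 1 <= ((d i)%:R : R) <= s%:R.
Proof.
move=> [H1 H2 _]; have := H2 i => H3.
rewrite -addrA -opprD lerBlDr natr1 -natrD !ler_nat H1 andbT.
by apply: leq_trans H3 _; rewrite leq_add2l; case: ifP.
Qed.

Lemma sum_sgd_le2 l l' M : l != l' -> (J <= l)%N -> (J <= l')%N -> M \in S ->
  `|\sum_v sgd R l l' M v| <= 2.
Proof.
move=> ll' Jl Jl' MS; rewrite (sum_sgd R ll' MS).
have := near_out nc Jl; have := near_out nc Jl'.
have := entry01 R M l l'; have := entry01 R M l' l.
by rewrite ler_norml; move=> /andP[? ?] /andP[? ?] /andP[? ?] /andP[? ?]; apply/andP; split; lra.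
Qed.

(** Column [t] is untouched by exchanges in [l] and [l'], so it is an admissible weight for
    [bal_moment4]. The terms that separate [bal] from the codegree difference cost at most 1. *)
Lemma cod_diff4 l l' t : l != l' -> (J <= l)%N -> (J <= l')%N -> t != l -> t != l' ->
  mean S (fun M => (cod R M l t - cod R M l' t) ^+ 4) <= 8 * (128 * n%:R ^+ 2 + 1).
Proof.
move=> ll' Jl Jl' tl tl'.
have n0 : (0 < n)%N by have := rg_n0; rewrite ltr0n.
have H := @bal_moment4 R n J r c l l' ll' Jl Jl' S0 (fun M v => x M v t)
  (fun M v => entry01 R M v t).
have bI v w' M u : x (flip l l' v w' M) u t = x M u t.
  by rewrite /entry flip_col.
have {H}H := H bI (fun M => @sum_sgd_le2 l l' M ll' Jl Jl') n0.
apply: le_trans (_ : mean S (fun M => 8 * (bal l l' (fun M v => x M v t) M ^+ 4 + 1)) <= _); last first.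
  by rewrite meanZ meanD (mean_cst S0) ler_pM2l // lerD2r.
apply: le_mean => M MS; rewrite (bal_cod R ll' t MS).
set y := cod R M l t - cod R M l' t; set d := x M l l' * _; set e := x M l' l * _.
have -> : y ^+ 4 = ((y + d - e) + (e - d)) ^+ 4 by congr (_ ^+ _); ring.
apply: le_trans (pow4_add_le _ _) _; rewrite ler_pM2l // lerD2l.
have dle : 0 <= d <= 1.
  by rewrite /d mulr_ge0 ?entry_ge0 //= mulr_ile1 ?entry_ge0 ?entry_le1.
have ele : 0 <= e <= 1.
  by rewrite /e mulr_ge0 ?entry_ge0 //= mulr_ile1 ?entry_ge0 ?entry_le1.
have : `|e - d| <= 1 by rewrite ler_norml; apply/andP; split; lra.
by move=> /(exprn_ile1 4 (normr_ge0 _)); rewrite -normrX ger0_norm // exprn_even_ge0.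
Qed.

Lemma card_outside_bounds (X : seq 'I_n) : (size X <= 10)%N ->
  n%:R - J%:R - (size X)%:R <= (#|outside J X|%:R : R) <= n%:R
  /\ n%:R <= 2 * #|outside J X|%:R :> R.
Proof.
move=> X10; have H := card_predC_outside J X.
have {}H : (n <= #|outside J X| + (J + size X))%N.
  by rewrite -[n in (n <= _)%N]card_ord -(cardC (outside J X)) leq_add2l.
have H0 : (#|outside J X| <= n)%N by rewrite -[n in (_ <= n)%N]card_ord max_card.
have H1 : n%:R - J%:R - (size X)%:R <= #|outside J X|%:R :> R.
  by rewrite -addrA -opprD -natrD lerBlDr -natrD ler_nat.
have H2 : #|outside J X|%:R <= n%:R :> R by rewrite ler_nat.
rewrite H1 H2; split=> //.
have X10' : (size X)%:R <= 10 :> R by rewrite (ler_nat _ _ 10).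
have HJ := rg_J_small; have Hn := rg_n_large; lra.
Qed.

Lemma row_outside M i (X : seq 'I_n) : M \in S ->
  s%:R - 2 * J%:R - 1 - (size X)%:R <= \sum_(k | outside J X k) x M i k <= s%:R.
Proof.
move=> MS; have /andP[H1 H2] := row_restrict R i (outside J X) MS.
have /andP[H3 H4] := near_all i nr.
have : #|predC (outside J X)|%:R <= J%:R + (size X)%:R :> R.
  by rewrite -natrD ler_nat card_predC_outside.
by move=> H5; apply/andP; split; lra.
Qed.

(** The codegree is compared with its average over other columns [l']. That average is almost
    deterministic: summing over [l'] first leaves row sums times [x M i t], fixed by the degrees up
    to [O(J n)]. Division by the number of columns leaves a deviation [O(J)], of size [w L]. *)
Lemma cod_moment4 l t : l != t -> (J <= l)%N -> (J <= t)%N ->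
  mean S (fun M => (cod R M l t - s%:R ^+ 2 / n%:R) ^+ 4) <= L ^+ 7 * n%:R ^+ 2.
Proof.
move=> lt Jl Jt.
pose T := outside J [:: l; t].
have [/andP[K1 K2] K3] := @card_outside_bounds [:: l; t] isT.
set K : R := #|outside J [:: l; t]|%:R in K1 K2 K3.
have n0 := rg_n0; have K0 : 0 < K by lra.
have dev M : M \in S -> `|\sum_(l' | T l') cod R M l' t - K * (s%:R ^+ 2 / n%:R)| <= n%:R * (3 * J%:R + 6).
  move=> MS.
  have E : \sum_(l' | T l') cod R M l' t = \sum_i (\sum_(l' | T l') x M i l') * x M i t.
    by rewrite /cod exchange_big /=; apply: eq_bigr => i _; rewrite mulr_suml.
  have J0 : 0 <= J%:R :> R by rewrite ler0n.
  have s0 := rg_s_gt0; have sn := rg_s_lt.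
  have Hi i : s%:R - 2 * J%:R - 3 <= \sum_(l' | T l') x M i l' <= s%:R.
    have := row_outside i [:: l; t] MS; rewrite -/T /= => /andP[? ?].
    by apply/andP; split; lra.
  have U : \sum_(l' | T l') cod R M l' t <= s%:R * (c t)%:R.
    rewrite E -(entry_col_sum R t MS) mulr_sumr; apply: ler_sum => i _.
    by rewrite ler_wpM2r ?entry_ge0 //; case/andP: (Hi i).
  have D : (s%:R - 2 * J%:R - 3) * (c t)%:R <= \sum_(l' | T l') cod R M l' t.
    rewrite E -(entry_col_sum R t MS) mulr_sumr; apply: ler_sum => i _.
    by rewrite ler_wpM2r ?entry_ge0 //; case/andP: (Hi i).
  have /andP[c1 c2] := near_out nc Jt.
  have c0 : 0 <= (c t)%:R :> R by [].
  have X1 : `|\sum_(l' | T l') cod R M l' t - s%:R ^+ 2| <= n%:R * (2 * J%:R + 4).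
    by rewrite ler_norml; apply/andP; split; nra.
  have X2 : `|s%:R ^+ 2 - K * (s%:R ^+ 2 / n%:R)| <= n%:R * (J%:R + 2).
    have -> : s%:R ^+ 2 - K * (s%:R ^+ 2 / n%:R) = (n%:R - K) * (lam * s%:R).
      by field; rewrite gt_eqF.
    have := lam_gt0; have := lam_lt1; move: lam => y y1 y0; rewrite /= in K1.
    have ys : 0 <= y * s%:R <= n%:R by apply/andP; split; nra.
    by rewrite ler_norml; apply/andP; split; nra.
  by rewrite -(subrK (s%:R ^+ 2) (\sum_(l' | _) _)) -addrA; apply: le_trans (ler_normD _ _) _; lra.
have pw M : M \in S -> (cod R M l t - s%:R ^+ 2 / n%:R) ^+ 4 <=
   8 * ((\sum_(l' | T l') (cod R M l t - cod R M l' t) ^+ 4) / K + (6 * J%:R + 12) ^+ 4).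
  move=> MS.
  have -> : cod R M l t - s%:R ^+ 2 / n%:R = (\sum_(l' | T l') (cod R M l t - cod R M l' t)) / K +
     (\sum_(l' | T l') cod R M l' t - K * (s%:R ^+ 2 / n%:R)) / K.
    rewrite sumrB sumr_const -[#|_|%R]/#|outside J [:: l; t]| -mulr_natl -/K.
    by field; rewrite !gt_eqF.
  apply: le_trans (pow4_add_le _ _) _; rewrite ler_pM2l // lerD //.
    rewrite expr_div_n ler_pdivrMr ?exprn_gt0 //; apply: le_trans (pow4_sum_le _ _) _.
    rewrite -[#|T|%:R]/K [K ^+ 4]exprS mulrA divfK ?gt_eqF // mulrC //.
  rewrite -[leLHS]ger0_norm; last by rewrite exprn_even_ge0.
  rewrite normrX lerXn2r ?nnegrE //.
  rewrite normrM normfV (gtr0_norm K0) ler_pdivrMr //.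
  apply: le_trans (dev M MS) _; have := ler0n R J; nra.
apply: le_trans (le_mean pw) _; rewrite meanZ meanD (mean_cst S0).
have -> : mean S (fun M => (\sum_(l' | T l') (cod R M l t - cod R M l' t) ^+ 4) / K) =
   (\sum_(l' | T l') mean S (fun M => (cod R M l t - cod R M l' t) ^+ 4)) / K.
  by rewrite -mean_sum mulrC -meanZ; apply: eq_mean => M _; rewrite mulrC.
have : (\sum_(l' | T l') mean S (fun M => (cod R M l t - cod R M l' t) ^+ 4)) / K <= 8 * (128 * n%:R ^+ 2 + 1).
  rewrite ler_pdivrMr // [leRHS]mulrC.
  have -> : K * (8 * (128 * n%:R ^+ 2 + 1)) = \sum_(l' | T l') (8 * (128 * n%:R ^+ 2 + 1)).
    by rewrite sumr_const /K mulr_natl.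
  apply: ler_sum => l' /andP[Jl']; rewrite !inE negb_or => /andP[l'l l't].
  by apply: cod_diff4 => //; rewrite eq_sym.
move: (_ / K) => z zle.
have w0 := rg_w0 rg; have w2 := rg_w2 rg; have Jw := rg_J rg; have L100 := rg_L rg.
have wL : 12 <= w * L by have := rg_w1; nra.
have J4 : (6 * J%:R + 12) ^+ 4 <= 2401 * (L ^+ 4 * n%:R ^+ 2).
  have -> : 2401 * (L ^+ 4 * n%:R ^+ 2) = (7 * (w * L)) ^+ 4 by rewrite -w2; ring.
  have J0 : 0 <= J%:R :> R by [].
  by apply: lerXn2r; rewrite ?nnegrE; lra.
have n1 : 1 <= n%:R ^+ 2 :> R by rewrite exprn_ege1 //; have := rg_n_large; lra.
have L4 : 1 <= L ^+ 4 by exact: rg_Lk1.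
(* Three powers of [L], at least [10^6], pay for the constants, chiefly [8 * 2401] and
   [64 * 128]. *)
have L7 : 100 * (100 * (100 * L ^+ 4)) <= L ^+ 7.
  have Lp : 0 <= L by lra.
  rewrite -[7%N]/(1 + (1 + (1 + 4)))%N !exprD !expr1.
  by do 2! (rewrite ler_pM //; [rewrite !mulr_ge0 //; lra|]); rewrite ler_pM //; lra.
set y := n%:R ^+ 2 in n1 J4 zle *.
apply: le_trans (_ : (100 * (100 * (100 * L ^+ 4))) * y <= _); last by rewrite ler_wpM2r //; lra.
have : y <= L ^+ 4 * y by rewrite ler_peMl //; lra.
lra.
Qed.

End Model.
End Regime.

Lemma mean_transpose (R : realType) n J (r c : 'I_n -> nat) (f : digraph n -> R) :
  mean (completions J r c) f = mean (completions J c r) (fun M => f (transpose M)).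
Proof.
have E : completions J c r = [set transpose M | M in completions J r c].
  apply/setP => M; rewrite (can_imset_pre _ (@transposeK n)) [RHS]inE.
  by rewrite transpose_completions.
rewrite /mean E (card_imset _ (inv_inj (@transposeK n))); congr (_ / _).
rewrite big_imset /=; last by move=> M M' _ _; exact: (inv_inj (@transposeK n)).
by apply: eq_bigr => M _; rewrite transposeK.
Qed.

Lemma completions_neq0_transpose n J (r c : 'I_n -> nat) :
  completions J r c != finset.set0 -> completions J c r != finset.set0.
Proof.
move=> /set0Pn[M MS]; apply/set0Pn; exists (transpose M).
by rewrite transpose_completions.
Qed.

Section Regime.
Variables (R : realType) (n s J : nat) (L w : R).
Hypothesis rg : regime n s J L w.
Local Notation lam := (s%:R / n%:R : R).
Local Notation A := (2^-1 * lam * (1 - lam) : R).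
Local Notation D := (4 * A * n%:R : R).

Lemma rg_D_gt0 : 0 < D.
Proof. by rewrite mulr_gt0 ?(rg_n0 rg) // mulr_gt0 ?(A_gt0 rg). Qed.

Lemma rg_invD : D^-1 <= L / (4 * w ^+ 2).
Proof.
rewrite (rg_w2 rg); move: A (A_gt0 rg) (invA_le rg) => a a0 aL.
have n0 := rg_n0 rg.
have -> : (4 * a * n%:R)^-1 = a^-1 / (4 * n%:R) by field; rewrite !gt_eqF.
by rewrite ler_wpM2r // invr_ge0 mulr_ge0.
Qed.

Lemma rg_L100 k : (k < 60)%N -> 100 * L ^+ k <= w.
Proof.
move=> k60; apply: le_trans (rg_pow rg k60); rewrite exprS ler_wpM2r ?(rg_L rg) //.
by rewrite exprn_ge0 // ltW ?(rg_L0 rg).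
Qed.

Section Model.
Variables r c : 'I_n -> nat.
Hypotheses (nr : near_regular J s r) (nc : near_regular J s c).
Notation S := (completions J r c).
Hypothesis S0 : S != finset.set0.
Local Notation x := (@entry R n).
Implicit Types (M : digraph n) (i k l t v : 'I_n).

Section Pair.
Variables l l' : 'I_n.
Hypotheses (ll' : l != l') (Jl : (J <= l)%N) (Jl' : (J <= l')%N).

(** Up to an error of 4, [ndif] is [2 s] minus twice a codegree, and [2 s - 2 s^2 / n] is exactly
    [D], the typical number of exchangeable rows. *)
Lemma ndif_moment4 : mean S (fun M => (ndif R l l' M - D) ^+ 4) <= L ^+ 9 * n%:R ^+ 2.
Proof.
have H := cod_moment4 rg nr nc S0 ll' Jl Jl'.
apply: le_trans (_ : mean S (fun M => 8 * (4 ^+ 4 + 16 * (cod R M l l' - s%:R ^+ 2 / n%:R) ^+ 4)) <= _).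
  apply: le_mean => M MS; rewrite (ndif_cod R ll' MS).
  have /andP[a1 a2] := near_out R nc Jl; have /andP[b1 b2] := near_out R nc Jl'.
  have /andP[d1 d2] := entry01 R M l l'; have /andP[e1 e2] := entry01 R M l' l.
  set u := (c l)%:R - s%:R + ((c l')%:R - s%:R) - x M l' l - x M l l'.
  have -> : (c l)%:R + (c l')%:R - x M l' l - x M l l' - 2 * cod R M l l' - D =
     u + (- 2) * (cod R M l l' - s%:R ^+ 2 / n%:R).
    by rewrite /u; field; rewrite gt_eqF ?(rg_n0 rg).
  apply: le_trans (pow4_add_le _ _) _; rewrite ler_pM2l // lerD //.
    have : `|u| <= 4 by rewrite ler_norml /u; apply/andP; split; lra.
    have -> : u ^+ 4 = `|u| ^+ 4 by rewrite -normrX ger0_norm // exprn_even_ge0.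
    by move=> ?; apply: lerXn2r; rewrite ?nnegrE.
  by rewrite exprMn le_eqVlt; apply/orP; left; apply/eqP; congr (_ * _); ring.
rewrite meanZ meanD (mean_cst S0) meanZ.
have n1 : 1 <= n%:R ^+ 2 :> R by rewrite exprn_ege1 //; have := rg_n_large rg; lra.
have L7 := rg_Lk1 rg 7; have L100 := rg_L rg.
have -> : L ^+ 9 = L * L * L ^+ 7 by ring.
move: H L7; set y := n%:R ^+ 2 in n1 *; set z := L ^+ 7 => H L7.
have zy : 1 <= z * y by rewrite -[1]mulr1 ler_pM //; lra.
have LL : 100 * 100 <= L * L by nra.
have : 100 * 100 * (z * y) <= L * L * (z * y) by rewrite ler_wpM2r //; lra.
lra.
Qed.

(** The danger lies in completions with few exchangeable rows, where the inverse is only bounded by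
    1. If [ndif] is below [D / 2], this 1 is at most [16 t^4 / D^4], where [t] is the deviation; the
    fourth moment makes it negligible against [w^-3], whereas a second moment would leave about
    [w^-2]. Otherwise the error is at most [2 t / D^2]. *)
Lemma mean_inv_ndif v :
  mean S (fun M => dif R l l' M v * `|(ndif R l l' M)^-1 - D^-1|) <= L ^+ 5 / w ^+ 3.
Proof.
have D0 := rg_D_gt0; have w0 := rg_w0 rg; have L0 := rg_L0 rg.
have w2 := rg_w2 rg.
(* The cut [tau = L^3 w] is the typical size of the deviation; [t <= tau + t^4 / tau^3] then bounds
   a first moment by the fourth. *)
have tau0 : 0 < L ^+ 3 * w by rewrite mulr_gt0 ?exprn_gt0.
have pw M : dif R l l' M v * `|(ndif R l l' M)^-1 - D^-1| <=
   2 / D ^+ 2 * (L ^+ 3 * w) +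
   (2 / D ^+ 2 / (L ^+ 3 * w) ^+ 3 + 16 / D ^+ 4) * (ndif R l l' M - D) ^+ 4.
  set tau := L ^+ 3 * w; set d := ndif R l l' M.
  have rhs0 : 0 <= 2 / D ^+ 2 * tau + (2 / D ^+ 2 / tau ^+ 3 + 16 / D ^+ 4) * (d - D) ^+ 4.
    by rewrite addr_ge0 // mulr_ge0 ?exprn_even_ge0 // ?addr_ge0 // ?divr_ge0 ?exprn_ge0 // ltW.
  have [/(dif1 R) dv|/(dif0 R) ->] := boolP (diffrow l l' M v); last by rewrite mul0r.
  have d1 : 1 <= d by rewrite -dv dif_le_ndif.
  rewrite dv mul1r; clear dv.
  have d0 : 0 < d by lra.
  move: D D0 rhs0 => e e0 rhs0.
  have -> : d^-1 - e^-1 = (e - d) / (d * e) by field; rewrite !gt_eqF.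
  rewrite normrM normfV distrC [`|d * e|]gtr0_norm ?mulr_gt0 //.
  have -> : (d - e) ^+ 4 = `|d - e| ^+ 4 by rewrite -normrX ger0_norm // exprn_even_ge0.
  set t := `|d - e|.
  have t0 : 0 <= t := normr_ge0 _.
  have [de|de] := leP (e / 2) d.
    apply: le_trans (_ : 2 / e ^+ 2 * t <= _).
      have -> : 2 / e ^+ 2 * t = t / (e / 2 * e) by field; rewrite gt_eqF.
      by rewrite ler_wpM2l // lef_pV2 ?posrE ?mulr_gt0 ?divr_gt0 // ler_wpM2r // ltW.
    have -> : 2 / e ^+ 2 * tau + (2 / e ^+ 2 / tau ^+ 3 + 16 / e ^+ 4) * t ^+ 4 =
      2 / e ^+ 2 * (tau + t ^+ 4 / tau ^+ 3) + 16 / e ^+ 4 * t ^+ 4 by field; rewrite !gt_eqF.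
    rewrite ler_wpDr //; first by rewrite mulr_ge0 ?exprn_ge0 // divr_ge0 ?exprn_ge0 // ltW.
    rewrite ler_wpM2l //; first by rewrite divr_ge0 ?exprn_ge0 // ltW.
    have [tt|tt] := leP t tau.
      by rewrite ler_wpDr // divr_ge0 ?exprn_ge0 // ltW.
    apply: ler_wpDl; first exact: ltW.
    rewrite ler_pdivlMr ?exprn_gt0 // (exprS t 3) ler_wpM2l //.
    by apply: lerXn2r; rewrite ?nnegrE //; exact: ltW.
  have te : e / 2 <= t by rewrite /t distrC ger0_norm; lra.
  apply: le_trans (_ : 16 / e ^+ 4 * t ^+ 4 <= _).
    apply: le_trans (_ : 1 <= _).
      by rewrite ler_pdivrMr ?mulr_gt0 // mul1r /t distrC ger0_norm; [nra|lra].
    have -> : 16 / e ^+ 4 * t ^+ 4 = (t / (e / 2)) ^+ 4 by field; rewrite gt_eqF.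
    by rewrite exprn_ege1 // ler_pdivlMr ?divr_gt0 // mul1r.
  have -> : 2 / e ^+ 2 * tau + (2 / e ^+ 2 / tau ^+ 3 + 16 / e ^+ 4) * t ^+ 4 =
    (2 / e ^+ 2 * tau + 2 / e ^+ 2 / tau ^+ 3 * t ^+ 4) + 16 / e ^+ 4 * t ^+ 4 by ring.
  rewrite ler_wpDl // addr_ge0 // mulr_ge0 ?exprn_ge0 // ?divr_ge0 ?exprn_ge0 //; exact: ltW.
apply: le_trans (le_mean (fun M _ => pw M)) _.
rewrite meanD (mean_cst S0) meanZ.
have m4 : mean S (fun M => (ndif R l l' M - D) ^+ 4) <= L ^+ 9 * w ^+ 2 ^+ 2.
  by rewrite w2 ndif_moment4.
set h := L / (4 * w ^+ 2).
have Di0 : 0 <= D^-1 by rewrite invr_ge0 ltW.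
have h0 : 0 <= h by rewrite divr_ge0 ?mulr_ge0 ?exprn_ge0 //; exact: ltW.
have gh (q : nat) : D^-1 ^+ q <= h ^+ q by apply: lerXn2r; rewrite ?nnegrE ?rg_invD.
have L80 : L ^+ 8 / w <= 1 by rewrite ler_pdivrMr // mul1r (rg_pow rg).
apply: le_trans (_ : 2 * h ^+ 2 * (L ^+ 3 * w) + (2 * h ^+ 2 / (L ^+ 3 * w) ^+ 3 + 16 * h ^+ 4) *
   (L ^+ 9 * w ^+ 2 ^+ 2) <= _).
  have m0 : 0 <= mean S (fun M => (ndif R l l' M - D) ^+ 4).
    by apply: mean_ge0 => M _; rewrite exprn_even_ge0.
  have t1 := ltW tau0; have t2 : 0 <= (L ^+ 3 * w)^-1 ^+ 3 by rewrite exprn_ge0 // invr_ge0.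
  have g2 := gh 2; have g4 := gh 4; rewrite -!exprVn in g2 g4 *.
  have p2 : 0 <= D^-1 ^+ 2 by rewrite exprn_ge0.
  have p4 : 0 <= D^-1 ^+ 4 by rewrite exprn_ge0.
  have h2 : 0 <= h ^+ 2 by rewrite exprn_ge0.
  rewrite lerD //; first by rewrite ler_wpM2r // ler_wpM2l.
  apply: ler_pM => //; first by apply: addr_ge0; apply: mulr_ge0 => //; apply: mulr_ge0.
  by apply: lerD; [rewrite ler_wpM2r // ler_wpM2l | rewrite ler_wpM2l].
have -> : 2 * h ^+ 2 * (L ^+ 3 * w) + (2 * h ^+ 2 / (L ^+ 3 * w) ^+ 3 + 16 * h ^+ 4) *
   (L ^+ 9 * w ^+ 2 ^+ 2) = (L ^+ 5 / w ^+ 3) * (1 / 8 + 1 / 8 / L ^+ 3 + 1 / 16 * (L ^+ 8 / w)).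
  by rewrite /h; field; rewrite !gt_eqF.
rewrite -[leRHS]mulr1 ler_wpM2l ?divr_ge0 ?exprn_ge0 ?ltW //.
have L3 : (L ^+ 3)^-1 <= 1 by rewrite invf_le1 ?exprn_gt0 // (rg_Lk1 rg).
lra.
Qed.

Lemma mean_weight (Y : digraph n -> R) v :
  (forall M, M \in S -> `|Y M| <= 1) ->
  `|mean S (fun M => Y M * (dif R l l' M v / ndif R l l' M)) -
    mean S (fun M => Y M * dif R l l' M v) / D| <= L ^+ 5 / w ^+ 3.
Proof.
move=> Y1; rewrite [X in _ - X]mulrC -meanZ -meanB.
apply: le_trans (ler_norm_mean _ _) _; apply: le_trans (mean_inv_ndif v).
apply: le_mean => M MS.
have -> : Y M * (dif R l l' M v / ndif R l l' M) - D^-1 * (Y M * dif R l l' M v) =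
  Y M * (dif R l l' M v * ((ndif R l l' M)^-1 - D^-1)) by ring.
rewrite normrM -[leRHS]mul1r ler_pM // ?Y1 // normrM ler_wpM2r // ger0_norm //.
Qed.

Lemma mean_weight0 v :
  mean S (fun M => dif R l l' M v / ndif R l l' M) <= L / w ^+ 2.
Proof.
have H1 : mean S (fun M => dif R l l' M v / ndif R l l' M) <=
    mean S (fun M => D^-1 + dif R l l' M v * `|(ndif R l l' M)^-1 - D^-1|).
  apply: le_mean => M _; have /andP[d0 d1] := dif01 R l l' M v.
  have D0 : 0 <= D^-1 by rewrite invr_ge0 ltW ?rg_D_gt0.
  have := ler_norm ((ndif R l l' M)^-1 - D^-1); move: `|_| => t tt.
  by nra.
apply: le_trans H1 _; rewrite meanD (mean_cst S0).
have H2 := mean_inv_ndif v; have H3 := rg_invD.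
have w0 := rg_w0 rg; have L0 := rg_L0 rg.
have H4 : L ^+ 5 / w ^+ 3 <= L / w ^+ 2 / 2.
  have -> : L ^+ 5 / w ^+ 3 = L / w ^+ 2 * (L ^+ 4 / w) by field; rewrite gt_eqF.
  have p0 : 0 <= L / w ^+ 2 by rewrite divr_ge0 ?exprn_ge0 //; exact: ltW.
  rewrite ler_wpM2l // ler_pdivrMr //.
  have := @rg_L100 4 isT; have := rg_Lk1 rg 4; lra.
have H5 : L / (4 * w ^+ 2) = L / w ^+ 2 / 4 by field; rewrite gt_eqF.
apply: le_trans (lerD H3 H2) _; rewrite H5.
apply: le_trans (lerD (lexx _) H4) _.
have : 0 <= L / w ^+ 2 by rewrite divr_ge0 ?exprn_ge0 //; exact: ltW.
move: (L / w ^+ 2) => y; lra.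
Qed.

(** After resampling, the sum of signs is at most 2 and the weight has mean at most [L / w^2]. An
    observable [Y] left invariant by the exchanges costs nothing, which later gives approximate
    independence. *)
Lemma mean_compare (Y : digraph n -> R) v : v != l -> v != l' ->
  (forall M, `|Y M| <= 1) -> (forall a b M, Y (flip l l' a b M) = Y M) ->
  `|mean S (fun M => Y M * x M v l) - mean S (fun M => Y M * x M v l')| <= 2 * (L / w ^+ 2).
Proof.
move=> vl vl' Y1 YI; rewrite -meanB.
have -> : mean S (fun M => Y M * x M v l - Y M * x M v l') = mean S (fun M => Y M * sgd R l l' M v).
  by apply: eq_mean => M _; rewrite -mulrBr sgdE.
rewrite (mean_resample r c ll' Jl Jl') //.
apply: le_trans (ler_norm_mean _ _) _.
apply: le_trans (_ : mean S (fun M => 2 * (dif R l l' M v / ndif R l l' M)) <= _); last first.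
  by rewrite meanZ ler_pM2l // mean_weight0.
apply: le_mean => M MS.
rewrite normrM mulrC; apply: ler_pM => //.
  exact: (sum_sgd_le2 R nc ll' Jl Jl' MS).
have q0 : 0 <= dif R l l' M v / ndif R l l' M by rewrite mulr_ge0 // invr_ge0 ndif_ge0.
by rewrite normrM (ger0_norm q0) -[leRHS]mul1r ler_wpM2r.
Qed.

End Pair.
End Model.
End Regime.

(** * Arc probabilities *)

Section Regime.
Variables (R : realType) (n s J : nat) (L w : R).
Hypothesis rg : regime n s J L w.
Local Notation lam := (s%:R / n%:R : R).
Local Notation A := (2^-1 * lam * (1 - lam) : R).
Local Notation D := (4 * A * n%:R : R).
Local Notation x := (@entry R n).
Implicit Types (M : digraph n) (i k l t v : 'I_n).

Section Model.
Variables r c : 'I_n -> nat.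
Hypotheses (nr : near_regular J s r) (nc : near_regular J s c).
Notation S := (completions J r c).
Hypothesis S0 : S != finset.set0.

(** Averaging [mean_compare] over columns [l'] replaces the entry by the row sum, which is [s] up to
    [O(J)]; the resulting [J / n] is the dominant error. [X] lists columns to avoid so that [Y]
    survives the exchanges. *)
Lemma mean_average (Y : digraph n -> R) v l (X : seq 'I_n) :
  (size X <= 3)%N -> (J <= l)%N -> v != l -> (forall M, `|Y M| <= 1) ->
  (forall l', l' \notin X -> l' != v -> l' != l ->
     forall a b M, Y (flip l l' a b M) = Y M) ->
  `|mean S (fun M => Y M * x M v l) - lam * mean S Y| <= L ^+ 2 / w.
Proof.
move=> X3 Jl vl Y1 YI.
pose T := outside J (v :: l :: X).
have Xs : (size (v :: l :: X) <= 10)%N by rewrite /=; lia.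
have [/andP[K1 K2] K3] := card_outside_bounds rg Xs.
set K : R := #|outside J (v :: l :: X)|%:R in K1 K2 K3.
have X5 : (size (v :: l :: X))%:R <= 5 :> R by rewrite (ler_nat _ _ 5) /=; lia.
have n0 := rg_n0 rg; have K0 : 0 < K by lra.
have w0 := rg_w0 rg; have w2 := rg_w2 rg; have L0 := rg_L0 rg.
set m := mean S (fun M => Y M * x M v l).
have H1 : `|K * m - \sum_(l' | T l') mean S (fun M => Y M * x M v l')| <= K * (2 * (L / w ^+ 2)).
  have EK a : \sum_(l' | T l') a = K * a by rewrite sumr_const /K mulr_natl.
  rewrite -!EK -sumrB; apply: le_trans (ler_norm_sum _ _ _) _.
  apply: ler_sum => l' /andP[Jl']; rewrite !inE !negb_or => /and3P[l'v l'l l'X].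
  apply: (mean_compare rg nr nc S0) => //; first by rewrite eq_sym.
    by rewrite eq_sym.
  by move=> a b M; apply: YI.
have H2 : `|\sum_(l' | T l') mean S (fun M => Y M * x M v l') - s%:R * mean S Y| <= 2 * J%:R + 6.
  rewrite -mean_sum -meanZ -meanB; apply: mean_norm_le => // M MS.
  rewrite -mulr_sumr [s%:R * _]mulrC -mulrBr normrM -[leRHS]mul1r ler_pM //.
  have /andP[a1 a2] := row_outside R nr v (v :: l :: X) MS.
  have := ler0n R J; rewrite ler_norml /T; move=> J0; apply/andP; split; lra.
have Ym : `|mean S Y| <= 1 by apply: mean_norm_le.
have H3 : `|s%:R * mean S Y - K * (lam * mean S Y)| <= J%:R + 5.
  have -> : s%:R * mean S Y - K * (lam * mean S Y) = (n%:R - K) * lam * mean S Y.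
    by field; rewrite gt_eqF.
  have l0 := lam_gt0 rg; have l1 := lam_lt1 rg.
  rewrite -[leRHS]mulr1 normrM ler_pM // -[leRHS]mulr1 normrM ler_pM //; last first.
    by rewrite gtr0_norm // ltW.
  by rewrite ger0_norm; lra.
have H : `|K * (m - lam * mean S Y)| <= K * (2 * (L / w ^+ 2)) + (3 * J%:R + 11).
  set P := \sum_(l' | T l') _ in H1 H2.
  have -> : K * (m - lam * mean S Y) = (K * m - P) + ((P - s%:R * mean S Y) + (s%:R * mean S Y - K * (lam * mean S Y))).
    by ring.
  apply: le_trans (ler_normD _ _) _; apply: lerD => //.
  by apply: le_trans (ler_normD _ _) _; lra.
rewrite normrM (gtr0_norm K0) in H.
have JL := rg_J rg; have L100 := rg_L rg; have w1 := rg_w1 rg.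
have H4 : 3 * J%:R + 11 <= K * (8 * (L / w)).
  have -> : K * (8 * (L / w)) = 8 * L * K / w by field; rewrite gt_eqF.
  rewrite ler_pdivlMr //.
  have : w ^+ 2 <= 2 * K by rewrite w2.
  move=> wK; have : 8 * L * w ^+ 2 <= 8 * L * (2 * K) by rewrite ler_wpM2l //; lra.
  have : J%:R * w <= w * L * w by rewrite ler_wpM2r //; lra.
  have : 11 * w <= L * w ^+ 2 by rewrite expr2 mulrA ler_pM2r //; nra.
  lra.
have H5 : 2 * (L / w ^+ 2) <= 2 * (L / w).
  rewrite ler_pM2l // ler_pM2l // lef_pV2 ?posrE ?exprn_gt0 //; nra.
have H6 : 10 * (L / w) <= L ^+ 2 / w.
  by rewrite mulrA ler_pM2r ?invr_gt0 //; nra.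
rewrite -(ler_pM2l K0); apply: le_trans H _.
have : K * (2 * (L / w ^+ 2)) <= K * (2 * (L / w)) by rewrite ler_pM2l.
have : K * (10 * (L / w)) <= K * (L ^+ 2 / w) by rewrite ler_pM2l.
move: (L / w ^+ 2) (L / w) (L ^+ 2 / w) H4 => y1 y2 y3; lra.
Qed.

Lemma mean_entry v l : (J <= l)%N -> v != l -> `|mean S (fun M => x M v l) - lam| <= L ^+ 2 / w.
Proof.
move=> Jl vl; have := @mean_average (fun=> 1) v l [::] isT Jl vl.
rewrite (mean_cst S0) mulr1.
have -> : mean S (fun M => 1 * x M v l) = mean S (fun M => x M v l).
  by apply: eq_mean => M _; rewrite mul1r.
by apply=> // M; rewrite normr1.
Qed.

Lemma norm_entry M i k : `|x M i k| <= 1.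
Proof. by rewrite ger0_norm ?entry_ge0 ?entry_le1. Qed.

(** With [x M v l] as the observable, the two entries of row [v] are nearly independent, and
    [2 lam (1 - lam) = 4 A]. *)
Lemma mean_dif v l l' : (J <= l)%N -> (J <= l')%N -> l != l' -> v != l -> v != l' ->
  `|mean S (fun M => dif R l l' M v) - 4 * A| <= L ^+ 3 / w.
Proof.
move=> Jl Jl' ll' vl vl'.
have E1 := mean_entry Jl vl; have E2 := mean_entry Jl' vl'.
have E3 : `|mean S (fun M => x M v l * x M v l') - lam * mean S (fun M => x M v l)| <= L ^+ 2 / w.
  apply: (@mean_average (fun M => x M v l) v l' [:: l]) => //.
    by move=> M; exact: norm_entry.
  move=> l2 l2l l2v l2l' a b M; rewrite /entry flip_col //.
  by move: l2l; rewrite inE eq_sym.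
have -> : mean S (fun M => dif R l l' M v) =
    mean S (fun M => x M v l) + mean S (fun M => x M v l') - 2 * mean S (fun M => x M v l * x M v l').
  rewrite -meanZ -meanD -meanB; apply: eq_mean => M _.
  rewrite /dif /diffrow vl vl' /= /entry.
  by case: (_ \in M); case: (_ \in M) => /=; ring.
have l0 := lam_gt0 rg; have l1 := lam_lt1 rg.
have w0 := rg_w0 rg; have L100 := rg_L rg.
have LL : 6 * (L ^+ 2 / w) <= L ^+ 3 / w.
  rewrite mulrA ler_pM2r ?invr_gt0 // (exprS _ 2) ler_wpM2r ?exprn_ge0 //; lra.
move: E1 E2 E3 LL; move: (mean _ _) => m1; move: (mean _ _) => m2; move: (mean _ _) => m3.
move: (L ^+ 2 / w) (L ^+ 3 / w) => e e3; move: lam l0 l1 => y y0 y1.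
rewrite !ler_norml => /andP[a1 a2] /andP[b1 b2] /andP[d1 d2] LL.
by apply/andP; split; nra.
Qed.

End Model.

Section Model2.
Variables r c : 'I_n -> nat.
Hypotheses (nr : near_regular J s r) (nc : near_regular J s c).
Notation S := (completions J r c).
Hypothesis S0 : S != finset.set0.

Lemma mean_average_col (Y : digraph n -> R) i l v :
  (J <= i)%N -> l != i -> (forall M, `|Y M| <= 1) ->
  (forall i', i' != v -> i' != l -> i' != i ->
     forall a b M, Y (transpose (flip i i' a b M)) = Y (transpose M)) ->
  `|mean S (fun M => Y M * x M i l) - lam * mean S Y| <= L ^+ 2 / w.
Proof.
move=> Ji li Y1 YI; rewrite !(mean_transpose J r c).
have -> : mean (completions J c r) (fun M => Y (transpose M) * x (transpose M) i l) =
  mean (completions J c r) (fun M => Y (transpose M) * x M l i).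
  by apply: eq_mean => M _; rewrite entry_transpose.
apply: (mean_average nc nr (completions_neq0_transpose S0) (X := [:: v])) => //.
by move=> i'; rewrite inE => *; apply: YI.
Qed.

(** [dif] at [v] reads row [v] only, while the transposed exchange moves entries of the rows [i] and
    [i'], both different from [v]. *)
Lemma mean_dif_entry v l l' i k : (J <= i)%N -> v != i -> k != i ->
  `|mean S (fun M => dif R l l' M v * x M i k) - lam * mean S (fun M => dif R l l' M v)| <= L ^+ 2 / w.
Proof.
move=> Ji vi ki; apply: (@mean_average_col _ i k v) => //.
  by move=> M; rewrite ger0_norm //; case/andP: (dif01 R l l' M v).
move=> i' i'v i'l i'i a b M; have vi' : v != i' by rewrite eq_sym.
by rewrite /dif /diffrow !mem_transpose !flip_col.
Qed.

(** The bootstrap. By resampling, the difference is the mean of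
    [(g - x M l' l + x M l l') * dif / ndif], and [ndif] may be replaced by [D]. By the first-order
    bounds both entries have the same mean given [dif], up to a small error, and cancel, while [dif]
    has mean about [4 A]. As [4 A / D = 1 / n], only [g / n] survives. *)
Lemma mean_entry_diff v l l' : (J <= l)%N -> (J <= l')%N -> v != l -> v != l' ->
  `|mean S (fun M => x M v l) - mean S (fun M => x M v l') - ((c l)%:R - (c l')%:R) / n%:R| <= L ^+ 6 / w ^+ 3.
Proof.
move=> Jl Jl' vl vl'; have w0 := rg_w0 rg; have L0 := rg_L0 rg.
have [<-|ll'] := eqVneq l l'.
  by rewrite !subrr mul0r subr0 normr0 divr_ge0 ?exprn_ge0 //; exact: ltW.
have n0 := rg_n0 rg; have D0 := rg_D_gt0 rg.
have l'l : l' != l by rewrite eq_sym.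
set g := (c l)%:R - (c l')%:R.
have g1 : `|g| <= 1.
  have /andP[a1 a2] := near_out R nc Jl; have /andP[b1 b2] := near_out R nc Jl'.
  by rewrite ler_norml /g; apply/andP; split; lra.
(* The bracket is at most 2 in absolute value; half of it is admissible for [mean_weight]. *)
pose Y M := (g - x M l' l + x M l l') / 2.
have Y1 M : `|Y M| <= 1.
  have /andP[d1 d2] := entry01 R M l l'; have /andP[e1 e2] := entry01 R M l' l.
  move: g1; rewrite !ler_norml /Y => /andP[? ?]; apply/andP; split; lra.
have E : mean S (fun M => x M v l) - mean S (fun M => x M v l') =
  2 * mean S (fun M => Y M * (dif R l l' M v / ndif R l l' M)).
  rewrite -meanB -meanZ.
  transitivity (mean S (fun M => 1 * sgd R l l' M v)).
    by apply: eq_mean => M _; rewrite mul1r sgdE.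
  rewrite (mean_resample r c ll' Jl Jl') //; apply: eq_mean => M MS.
  by rewrite (sum_sgd R ll' MS) /Y -/g; move: (_ / ndif R l l' M) => q; field.
have W := mean_weight rg nr nc S0 ll' Jl Jl' v (fun M _ => Y1 M).
have F : 2 * mean S (fun M => Y M * dif R l l' M v) =
   g * mean S (fun M => dif R l l' M v) - mean S (fun M => dif R l l' M v * x M l' l)
   + mean S (fun M => dif R l l' M v * x M l l').
  by rewrite -!meanZ -meanB -meanD; apply: eq_mean => M _; rewrite /Y; field.
have d1 := mean_dif_entry l l' Jl' vl' ll'.
have d2 := mean_dif_entry l l' Jl vl l'l.
have d3 := mean_dif nr nc S0 Jl Jl' ll' vl vl'.
set m := mean S (fun M => dif R l l' M v) in F d1 d2 d3.
have G : `|2 * mean S (fun M => Y M * dif R l l' M v) - g * (4 * A)| <= L ^+ 3 / w + 2 * (L ^+ 2 / w).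
  rewrite F.
  set m1 := mean S (fun M => dif R l l' M v * x M l' l) in d1 *.
  set m2 := mean S (fun M => dif R l l' M v * x M l l') in d2 *.
  have -> : g * m - m1 + m2 - g * (4 * A) = g * (m - 4 * A) + ((m2 - lam * m) - (m1 - lam * m)) by ring.
  apply: le_trans (ler_normD _ _) _; apply: lerD.
    by rewrite normrM -[leRHS]mul1r ler_pM.
  by apply: le_trans (ler_normB _ _) _; lra.
have -> : mean S (fun M => x M v l) - mean S (fun M => x M v l') - g / n%:R =
   2 * (mean S (fun M => Y M * (dif R l l' M v / ndif R l l' M)) - mean S (fun M => Y M * dif R l l' M v) / D)
   + (2 * mean S (fun M => Y M * dif R l l' M v) - g * (4 * A)) / D.
  rewrite E; move: D0; rewrite pmulr_lgt0 // => A0.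
  move: A A0 => a a0; field; rewrite !gt_eqF //; lra.
apply: le_trans (ler_normD _ _) _; rewrite !normrM [`|2|]ger0_norm // normfV (gtr0_norm D0).
apply: le_trans (_ : 2 * (L ^+ 5 / w ^+ 3) + (L ^+ 3 / w + 2 * (L ^+ 2 / w)) * (L / (4 * w ^+ 2)) <= _).
  apply: lerD; first by rewrite ler_pM2l.
  by apply: ler_pM => //; [rewrite invr_ge0 ltW|exact: (rg_invD rg)].
have -> : 2 * (L ^+ 5 / w ^+ 3) + (L ^+ 3 / w + 2 * (L ^+ 2 / w)) * (L / (4 * w ^+ 2)) =
  (2 * L ^+ 5 + L ^+ 4 / 4 + L ^+ 3 / 2) / w ^+ 3 by field; rewrite gt_eqF.
rewrite ler_pM2r ?invr_gt0 ?exprn_gt0 //.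
have L100 := rg_L rg.
have L4 : L ^+ 4 <= L ^+ 5 by rewrite ler_weXn2l // (rg_L1 rg).
have L3 : L ^+ 3 <= L ^+ 5 by rewrite ler_weXn2l // (rg_L1 rg).
have : 100 * L ^+ 5 <= L ^+ 6 by rewrite (exprS _ 5) ler_wpM2r // exprn_ge0 // ltW.
have := exprn_gt0 5 L0.
lra.
Qed.

End Model2.
End Regime.

(** * Counting completions through a single cell *)

Section CellRelation.
Variables (R : realType) (n J : nat).
Implicit Types (r c : 'I_n -> nat) (M : digraph n).

(** It holds for an empty set too, so [cell_relation] can be used to prove non-emptiness. *)
Lemma card_mean (r c : 'I_n -> nat) (f : digraph n -> R) :
  #|completions J r c|%:R * mean (completions J r c) f = \sum_(M in completions J r c) f M.
Proof.
rewrite /mean; have [S0|S0] := eqVneq #|completions J r c| 0%N.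
  rewrite S0 mul0r big1 // => M MS.
  by move/eqP: S0; rewrite cards_eq0 => /eqP S0; rewrite S0 inE in MS.
by rewrite mulrC divfK // pnatr_eq0.
Qed.

Lemma outdegD1 M (a v i : 'I_n) : (a, v) \in M ->
  outdeg M i = (outdeg (M :\ (a, v)) i + (i == a))%N.
Proof.
move=> avM; rewrite !outdegE; have [->|ia] := eqVneq i a; last first.
  rewrite addn0; apply: eq_bigr => k _; rewrite !inE xpair_eqE (negbTE ia) //=.
rewrite (bigD1 v) //= avM [in RHS](bigD1 v) //= !inE eqxx addnC add0n; congr (_ + _)%N.
by apply: eq_bigr => k kv; rewrite !inE xpair_eqE (negbTE kv) andbF.
Qed.

Lemma indegD1 M (a v k : 'I_n) : (a, v) \in M ->
  indeg M k = (indeg (M :\ (a, v)) k + (k == v))%N.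
Proof.
move=> avM; rewrite !indegE; have [->|kv] := eqVneq k v; last first.
  rewrite addn0; apply: eq_bigr => i _; rewrite !inE xpair_eqE (negbTE kv) andbF //=.
rewrite (bigD1 a) //= avM [in RHS](bigD1 a) //= !inE eqxx addnC add0n; congr (_ + _)%N.
by apply: eq_bigr => i ia; rewrite !inE xpair_eqE (negbTE ia).
Qed.

(* Deleting [(a, v)] maps the completions containing it onto those of the smaller degrees avoiding it. *)
Lemma cell_relation (r c r' c' : 'I_n -> nat) (a v : 'I_n) : free_cell J (a, v) ->
  (forall i, r i = r' i + (i == a))%N -> (forall k, c k = c' k + (k == v))%N ->
  #|completions J r c|%:R * mean (completions J r c) (fun M => entry R M a v) =
  #|completions J r' c'|%:R * (1 - mean (completions J r' c') (fun M => entry R M a v)).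
Proof.
move=> fav rE cE; rewrite card_mean mulrBr mulr1 card_mean -sum1_card natr_sum -sumrB.
transitivity (\sum_(M in completions J r c | (a, v) \in M) 1 : R).
  by rewrite [RHS]big_mkcondr /=; apply: eq_bigr => M _; rewrite /entry; case: (_ \in M).
transitivity (\sum_(M in completions J r' c' | (a, v) \notin M) 1 : R); last first.
  rewrite [LHS]big_mkcondr /=; apply: eq_bigr => M _; rewrite /entry.
  by case: (_ \in M); rewrite /= ?subrr ?subr0.
rewrite (reindex_onto (fun M => (a, v) |: M) (fun M => M :\ (a, v))) /=; last first.
  by move=> M /andP[_ avM]; rewrite finset.setD1K.
apply: eq_bigl => M; rewrite !inE eqxx andbT.
have [avM|avM] := boolP ((a, v) \in M); rewrite ?andbF ?andbT.
  apply/negbTE; rewrite negb_and; apply/orP; right; apply/eqP => E.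
  by move: avM; rewrite -E !inE eqxx.
rewrite finset.setU1K // eqxx andbT.
have avU : (a, v) \in (a, v) |: M by rewrite !inE eqxx.
have ro i := @outdegD1 _ _ _ i avU; have co i := @indegD1 _ _ _ i avU.
rewrite finset.setU1K // in ro co.
congr (_ && _).
  apply/forall_inP/forall_inP => H e eM; first by apply: H; rewrite !inE eM orbT.
  by move: eM; rewrite !inE => /orP[/eqP ->|/H].
by apply: eq_forallb => i; rewrite ro co rE cE !eqn_add2r.
Qed.

End CellRelation.

Section Regime.
Variables (R : realType) (n s J : nat) (L w : R).
Hypothesis rg : regime n s J L w.
Local Notation lam := (s%:R / n%:R : R).
Local Notation A := (2^-1 * lam * (1 - lam) : R).
Local Notation x := (@entry R n).
Local Notation m := (n%:R - J%:R : R).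
Local Notation del := (L ^+ 7 / w ^+ 3 : R).
Implicit Types (M : digraph n) (i k l t v : 'I_n).

Lemma rg_m : n%:R <= 2 * (m - 2).
Proof. have := rg_J_small rg; have := rg_n_large rg; lra. Qed.

Lemma card_geq : #|[pred k : 'I_n | (J <= k)%N]|%:R = m.
Proof.
have Jn : (J <= n)%N by rewrite -(ler_nat R); have := rg_J_small rg; have := ler0n R J; lra.
rewrite -natrB //; congr _%:R.
have E := cardC [pred k : 'I_n | (J <= k)%N]; rewrite card_ord in E.
suff F : #|predC [pred k : 'I_n | (J <= k)%N]| = J by rewrite -[in RHS]E F addnK.
have inj : injective (widen_ord Jn).
  by move=> i j /(congr1 val) /= ij; apply: val_inj.
rewrite -[RHS]card_ord -[RHS](fintype.card_image inj).
apply: eq_card => k; rewrite !inE -ltnNge; apply/idP/fintype.imageP.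
  by move=> kJ; exists (Ordinal kJ) => //; apply: val_inj.
by move=> [j _ ->] /=.
Qed.

Lemma sum_deficit (d : 'I_n -> nat) (T : pred 'I_n) : near_regular J s d -> (forall l, T l -> (J <= l)%N) ->
  0 <= \sum_(l | T l) (s%:R - (d l)%:R : R) <= 2.
Proof.
move=> [d1 d2 d3] TJ; rewrite sumr_ge0 /=; last by move=> l _; rewrite subr_ge0 ler_nat d1.
apply: le_trans (_ : (\sum_(l < n | (J <= l)%N) (s - d l))%N%:R <= _); last by rewrite (ler_nat _ _ 2).
rewrite natr_sum (eq_bigr (fun l => (s - d l)%:R)); last by move=> l _; rewrite natrB.
rewrite [leRHS](bigID T) /= [X in _ <= X + _](eq_bigl T) ?lerDl ?sumr_ge0 // => l /=.
by case Tl: (T l); rewrite ?andbF // andbT; exact: TJ.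
Qed.

Section Model.
Variables r c : 'I_n -> nat.
Hypotheses (nr : near_regular J s r) (nc : near_regular J s c).
Notation S := (completions J r c).
Hypothesis S0 : S != finset.set0.

(** The columns of [T] fall short of [s] by at most 2 in total, so replacing all their degrees by
    [s] costs only [2 / n] for the whole sum. *)
Lemma mean_entry_sum v l (T : pred 'I_n) : (J <= l)%N -> v != l ->
  (forall l', T l' -> (J <= l')%N && (v != l')) ->
  `|#|T|%:R * mean S (fun M => x M v l) - \sum_(l' | T l') mean S (fun M => x M v l')
     - #|T|%:R * (((c l)%:R - s%:R) / n%:R)| <= #|T|%:R * (L ^+ 6 / w ^+ 3) + 2 / n%:R.
Proof.
move=> Jl vl TJ.
have EK (a : R) : \sum_(l' | T l') a = #|T|%:R * a by rewrite sumr_const mulr_natl.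
have D := sum_deficit nc (fun l' Tl' => proj1 (andP (TJ l' Tl'))).
have -> : #|T|%:R * mean S (fun M => x M v l) - \sum_(l' | T l') mean S (fun M => x M v l')
     - #|T|%:R * (((c l)%:R - s%:R) / n%:R) =
  \sum_(l' | T l') (mean S (fun M => x M v l) - mean S (fun M => x M v l') - ((c l)%:R - (c l')%:R) / n%:R)
  + (\sum_(l' | T l') (s%:R - (c l')%:R)) / n%:R.
  rewrite mulr_suml -big_split /= -!EK -!sumrB; apply: eq_bigr => l' _; ring.
apply: le_trans (ler_normD _ _) _; apply: lerD.
  rewrite -EK; apply: le_trans (ler_norm_sum _ _ _) _; apply: ler_sum => l' /TJ /andP[Jl' vl'].
  exact: (mean_entry_diff rg nr nc S0).
have n0 := rg_n0 rg; case/andP: D => D1 D2.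
by rewrite normrM normfV (gtr0_norm n0) ler_pM2r ?invr_gt0 // ger0_norm.
Qed.

(** A row of the block has all its arcs outside the block, so its entries over the [m] outer columns
    sum to exactly [r v]. *)
Lemma mean_entry_block v l : (v < J)%N -> (J <= l)%N ->
  `|mean S (fun M => x M v l) - (r v)%:R / m - ((c l)%:R - s%:R) / n%:R| <= del.
Proof.
move=> vJ Jl; pose T := [pred k : 'I_n | (J <= k)%N].
have neq l' : (J <= l')%N -> v != l'.
  by move=> Jl'; apply: contraTneq vJ => ->; rewrite -leqNgt.
have H := @mean_entry_sum v l T Jl (neq _ Jl).
have {H} := H (fun l' Tl' => introT andP (conj Tl' (neq l' Tl'))).
rewrite card_geq.
have -> : \sum_(l' | T l') mean S (fun M => x M v l') = (r v)%:R.
  rewrite -mean_sum -[RHS](mean_cst S0); apply: eq_mean => M MS.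
  rewrite -(entry_row_sum R v MS) [RHS](bigID T) /= [X in _ = _ + X]big1 ?addr0 // => l' Tl'.
  by apply: (entry_block _ MS) => //; rewrite ltnNge.
have mn := rg_m; have n100 := rg_n_large rg; have n0 := rg_n0 rg.
have m0 : 0 < m by lra.
have w0 := rg_w0 rg; have w1 := rg_w1 rg; have w2 := rg_w2 rg; have L100 := rg_L rg.
move=> H; rewrite -(ler_pM2l m0) -[X in X * `|_|](gtr0_norm m0) -normrM.
have -> : m * (mean S (fun M => x M v l) - (r v)%:R / m - ((c l)%:R - s%:R) / n%:R) =
  m * mean S (fun M => x M v l) - (r v)%:R - m * (((c l)%:R - s%:R) / n%:R).
  by field; rewrite !gt_eqF.
apply: le_trans H _.
have H2 : 2 / n%:R <= m * (L ^+ 6 / w ^+ 3).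
  have -> : 2 / n%:R = 2 * w / w ^+ 3 by rewrite -w2; field; rewrite gt_eqF.
  rewrite mulrA ler_pM2r ?invr_gt0 ?exprn_gt0 //.
  have L6 := rg_Lk1 rg 6.
  have : m * 1 <= m * L ^+ 6 by rewrite ler_pM2l.
  rewrite -w2 in mn n100 *; have := rg_pow rg (isT : (1 <= 60)%N); rewrite expr1; nra.
have H3 : 2 * (L ^+ 6 / w ^+ 3) <= del.
  rewrite mulrA ler_pM2r ?invr_gt0 ?exprn_gt0 // (exprS _ 6) ler_wpM2r ?exprn_ge0 //; lra.
have : m * (2 * (L ^+ 6 / w ^+ 3)) <= m * del by rewrite ler_pM2l.
lra.
Qed.

End Model.

Section Model2.
Variables r c : 'I_n -> nat.
Hypotheses (nr : near_regular J s r) (nc : near_regular J s c).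
Notation S := (completions J r c).
Hypothesis S0 : S != finset.set0.

Lemma mean_entry_block_col i k : (J <= i)%N -> (k < J)%N ->
  `|mean S (fun M => x M i k) - (c k)%:R / m - ((r i)%:R - s%:R) / n%:R| <= del.
Proof.
move=> Ji kJ; rewrite mean_transpose.
have -> : mean (completions J c r) (fun M => x (transpose M) i k) = mean (completions J c r) (fun M => x M k i).
  by apply: eq_mean => M _; rewrite entry_transpose.
exact: (mean_entry_block nc nr (completions_neq0_transpose S0)).
Qed.

(** The arcs from [i] into the block are subtracted through the column estimates, about [1 / m] of
    all block column degrees; the rest of the row is shared by the [m - 1] outer columns other than
    [i]. A deficit of [r i] shifts the block part by at most [J / n], which is negligible after
    division by [m - 1]. *)
Lemma mean_entry_out i l : (J <= i)%N -> (J <= l)%N -> i != l ->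
  `|mean S (fun M => x M i l) - ((r i)%:R - (\sum_(k < n | (k < J)%N) (c k)%:R) / m) / (m - 1)
    - ((c l)%:R - s%:R) / n%:R| <= del.
Proof.
move=> Ji Jl il; pose T := [pred k : 'I_n | (J <= k)%N && (k != i)].
have TJ l' : T l' -> (J <= l')%N && (i != l') by rewrite /T /= (eq_sym i).
have H := @mean_entry_sum r c nr nc S0 i l T Jl il TJ.
have mn := rg_m; have n100 := rg_n_large rg; have n0 := rg_n0 rg.
have m0 : 0 < m by lra.
have m1 : 0 < m - 1 by lra.
have cT : #|T|%:R = m - 1.
  rewrite -card_geq (cardD1 i [pred k : 'I_n | (J <= k)%N]) inE /= Ji natrD /= [_ + #|_|%:R]addrC addrK.
  by congr (_%:R); apply: eq_card => k; rewrite !inE andbC.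
rewrite cT in H.
have w0 := rg_w0 rg; have w1 := rg_w1 rg; have w2 := rg_w2 rg; have L100 := rg_L rg.
have J0 : 0 <= J%:R :> R by [].
have cJ : #|[pred k : 'I_n | (k < J)%N]|%:R = J%:R :> R.
  have := cardC [pred k : 'I_n | (J <= k)%N]; rewrite card_ord => /(congr1 (fun q => q%:R : R)).
  rewrite natrD card_geq.
  have -> : #|[predC [pred k : 'I_n | (J <= k)%N]]| = #|[pred k : 'I_n | (k < J)%N]|.
    by apply: eq_card => k; rewrite !inE -ltnNge.
  lra.
set B := \sum_(k < n | (k < J)%N) (c k)%:R.
set P := \sum_(k < n | (k < J)%N) mean S (fun M => x M i k).
have E1 : \sum_(l' | T l') mean S (fun M => x M i l') = (r i)%:R - P.
  rewrite /P -!mean_sum -[X in X - _](mean_cst S0 (r i)%:R) -meanB; apply: eq_mean => M MS.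
  rewrite -(entry_row_sum R i MS) [in RHS](bigID (fun k : 'I_n => (k < J)%N)) /=.
  rewrite [X in _ = X - _]addrC addrK [RHS](bigD1 i) -?leqNgt //= (entry_loop R _ MS) add0r.
  by apply: eq_bigl => k; rewrite -leqNgt.
have E2 : `|P - B / m - J%:R * (((r i)%:R - s%:R) / n%:R)| <= J%:R * del.
  have EK (a : R) : J%:R * a = \sum_(k < n | (k < J)%N) a.
    by rewrite -cJ sumr_const mulr_natl.
  rewrite !EK /P /B mulr_suml -!sumrB; apply: le_trans (ler_norm_sum _ _ _) _.
  by apply: ler_sum => k kJ; exact: mean_entry_block_col.
have E3 : `|J%:R * (((r i)%:R - s%:R) / n%:R)| <= J%:R / n%:R :> R.
  have /andP[r1 r2] := near_out R nr Ji.
  rewrite normrM (ger0_norm J0); apply: ler_wpM2l => //.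
  rewrite normrM normfV (gtr0_norm n0) -[leRHS]mul1r ler_pM2r ?invr_gt0 // ler_norml; apply/andP; split; lra.
rewrite E1 in H.
rewrite -(ler_pM2l m1) -[X in X * `|_|](gtr0_norm m1) -normrM.
have -> : (m - 1) * (mean S (fun M => x M i l) - ((r i)%:R - B / m) / (m - 1) - ((c l)%:R - s%:R) / n%:R) =
  ((m - 1) * mean S (fun M => x M i l) - ((r i)%:R - P) - (m - 1) * (((c l)%:R - s%:R) / n%:R))
  - ((P - B / m - J%:R * (((r i)%:R - s%:R) / n%:R)) + J%:R * (((r i)%:R - s%:R) / n%:R)).
  by field; rewrite !gt_eqF.
apply: le_trans (ler_normB _ _) _; apply: le_trans (lerD H (ler_normD _ _)) _.
apply: le_trans (lerD (lexx _) (lerD E2 E3)) _.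
have wi : 0 < (w ^+ 3)^-1 by rewrite invr_gt0 exprn_gt0.
have -> : 2 / n%:R = 2 * w / w ^+ 3 by rewrite -w2; field; rewrite gt_eqF.
have -> : J%:R / n%:R = J%:R * w / w ^+ 3 by rewrite -w2; field; rewrite gt_eqF.
have -> : (m - 1) * (L ^+ 6 / w ^+ 3) + 2 * w / w ^+ 3 + (J%:R * del + J%:R * w / w ^+ 3) =
  ((m - 1) * L ^+ 6 + 2 * w + (J%:R * L ^+ 7 + J%:R * w)) / w ^+ 3 by ring.
rewrite [leRHS]mulrA ler_pM2r //.
have Jw := rg_J rg; have L8 := rg_pow rg (isT : (8 <= 60)%N).
have L6 := rg_Lk1 rg 6; have L60 := le_trans ler01 L6.
have a1 : J%:R * w <= 2 * L * (m - 1).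
  apply: le_trans (_ : w * L * w <= _); first by rewrite ler_pM2r.
  have : L * w ^+ 2 <= L * (2 * (m - 2)) by rewrite w2 ler_wpM2l //; lra.
  have : 0 <= L by lra.
  nra.
have a2 : J%:R * L ^+ 7 <= 2 * (m - 1).
  apply: le_trans (_ : w * w <= _); last by rewrite -expr2 w2; lra.
  apply: le_trans (_ : (w * L) * L ^+ 7 <= _); first by rewrite ler_wpM2r // exprn_ge0 //; lra.
  by rewrite -mulrA -exprS ler_pM2l.
have a3 : 2 * w <= 2 * (m - 1).
  have := rg_pow rg (isT : (1 <= 60)%N); rewrite expr1 => Lw.
  have : w * 100 <= w * w by rewrite ler_pM2l //; lra.
  have := w2; rewrite expr2; lra.
have a4 : 100 * L ^+ 6 * (m - 1) <= (m - 1) * L ^+ 7.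
  by rewrite [leRHS]mulrC ler_pM2r // (exprS _ 6) ler_wpM2r //; lra.
have a5 : L * (m - 1) <= L ^+ 6 * (m - 1).
  by rewrite ler_pM2r // -[leLHS]expr1 ler_weXn2l // (rg_L1 rg).
have a6 : (m - 1) <= L ^+ 6 * (m - 1) by rewrite ler_peMl // ltW.
lra.
Qed.

End Model2.
End Regime.

(** * Adding one arc to the block *)

Lemma near_regularI n J s (d : 'I_n -> nat) (i0 : 'I_n) :
  (forall i, d i <= s)%N -> (forall i : 'I_n, (i < J)%N -> (s <= d i + J.+1)%N) ->
  (forall i : 'I_n, (J <= i)%N -> (s <= d i + (i == i0))%N) -> near_regular J s d.
Proof.
move=> d1 d2 d3; split=> // [i|].
  case: ltnP => iJ; first exact: d2.
  by apply: leq_trans (d3 i iJ) _; rewrite leq_add2l leq_b1.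
apply: leq_trans (_ : \sum_(i < n | (J <= i)%N) (i == i0) <= _)%N.
  by apply: leq_sum => i Ji; rewrite leq_subLR d3.
rewrite big_mkcond (bigD1 i0) //= big1 ?addn0; first by case: ifP; rewrite ?eqxx.
by move=> i /negbTE ->; case: ifP.
Qed.

Section Regime.
Variables (R : realType) (n s J : nat) (L w : R).
Hypothesis rg : regime n s J L w.
Local Notation lam := (s%:R / n%:R : R).
Local Notation A := (2^-1 * lam * (1 - lam) : R).
Local Notation x := (@entry R n).
Local Notation m := (n%:R - J%:R : R).
Local Notation del := (L ^+ 7 / w ^+ 3 : R).
Implicit Types (M : digraph n) (i k l t v : 'I_n).

Lemma rg_lam : 2 / L <= lam /\ 2 / L <= 1 - lam.
Proof.
have l0 := lam_gt0 rg; have l1 := lam_lt1 rg; have L0 := rg_L0 rg; have A1 := rg_A rg.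
split; rewrite ler_pdivrMr //; nra.
Qed.

Lemma rg_L2w : L ^+ 2 / w < 2 / L.
Proof.
have L0 := rg_L0 rg; have w0 := rg_w0 rg.
rewrite ltr_pdivrMr // mulrAC ltr_pdivlMr //.
have := rg_L100 rg (isT : (3 < 60)%N); rewrite (exprSr _ 2).
have : 0 < L ^+ 2 * L by rewrite mulr_gt0 // exprn_gt0.
lra.
Qed.

(** These probabilities stay near [lam], which is at distance at least [2 / L] from 0 and 1; hence
    no factor of a cell relation vanishes. *)
Lemma mean_entry01 r c v l : near_regular J s r -> near_regular J s c ->
  completions J r c != finset.set0 -> v != l -> (J <= v)%N || (J <= l)%N ->
  0 < mean (completions J r c) (fun M => x M v l) < 1.
Proof.
move=> nr nc S0 vl Jvl.
have : `|mean (completions J r c) (fun M => x M v l) - lam| <= L ^+ 2 / w.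
  have [Jl|lJ] := leqP J l; first exact: (mean_entry rg nr nc S0).
  move: Jvl; rewrite [X in _ || X]leqNgt lJ orbF => Jv.
  rewrite mean_transpose.
  have -> : mean (completions J c r) (fun M => x (transpose M) v l) = mean (completions J c r) (fun M => x M l v).
    by apply: eq_mean => M _; rewrite entry_transpose.
  by apply: (mean_entry rg nc nr (completions_neq0_transpose S0)); rewrite // eq_sym.
have [l0 l1] := rg_lam; have := rg_L2w.
by rewrite ler_norml => ? /andP[? ?]; apply/andP; split; lra.
Qed.

(* [S0] and [S3] are the completions before and after adding the arc [(j, k)] to the block;
   the cells [(j, l)], [(i, k)] and [(i, l)] link them through [S1] and [S2]. *)
Section Step.
Variables (r c : 'I_n -> nat) (j k i l : 'I_n).
Hypotheses (r_le : forall v, (r v <= s)%N) (c_le : forall v, (c v <= s)%N).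
Hypotheses (r_out : forall v : 'I_n, (J <= v)%N -> r v = s) (c_out : forall v : 'I_n, (J <= v)%N -> c v = s).
Hypotheses (r_in : forall v : 'I_n, (v < J)%N -> (s <= r v + J)%N)
           (c_in : forall v : 'I_n, (v < J)%N -> (s <= c v + J)%N).
Hypotheses (jJ : (j < J)%N) (kJ : (k < J)%N) (Ji : (J <= i)%N) (Jl : (J <= l)%N) (il : i != l).
Hypotheses (rj : (r j < s)%N) (ck : (c k < s)%N).

Let r0 v := (r v + (v == j))%N.
Let c0 v := (c v + (v == k))%N.
Let c1 v := (c v - (v == l) + (v == k))%N.
Let r2 v := (r v - (v == i))%N.
Let c2 v := (c v - (v == l))%N.
Let S0 := completions J r0 c0.
Let S1 := completions J r c1.
Let S2 := completions J r2 c2.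
Let S3 := completions J r c.
Let B : R := \sum_(v < n | (v < J)%N) (c v)%:R.

Let s0 : (0 < s)%N := rg_s0 rg.
Let ji : j != i. Proof. by apply: contraTneq jJ => ->; rewrite -leqNgt. Qed.
Let jl : j != l. Proof. by apply: contraTneq jJ => ->; rewrite -leqNgt. Qed.
Let ki : k != i. Proof. by apply: contraTneq kJ => ->; rewrite -leqNgt. Qed.
Let kl : k != l. Proof. by apply: contraTneq kJ => ->; rewrite -leqNgt. Qed.

Let near_r : near_regular J s r.
Proof.
apply: (near_regularI (i0 := i)) => // v Jv; last by rewrite r_out // leq_addr.
by apply: leq_trans (r_in Jv) _; rewrite leq_add2l.
Qed.

Let near_c : near_regular J s c.
Proof.
apply: (near_regularI (i0 := i)) => // v Jv; last by rewrite c_out // leq_addr.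
by apply: leq_trans (c_in Jv) _; rewrite leq_add2l.
Qed.

Let near_r0 : near_regular J s r0.
Proof.
apply: (near_regularI (i0 := i)) => v; rewrite /r0.
- by have [->|] := eqVneq v j; rewrite ?addn1 ?addn0.
- by move=> /r_in; lia.
- by move=> /r_out ->; rewrite -addnA leq_addr.
Qed.

Let near_c0 : near_regular J s c0.
Proof.
apply: (near_regularI (i0 := i)) => v; rewrite /c0.
- by have [->|] := eqVneq v k; rewrite ?addn1 ?addn0.
- by move=> /c_in; lia.
- by move=> /c_out ->; rewrite -addnA leq_addr.
Qed.

Let near_r2 : near_regular J s r2.
Proof.
apply: (near_regularI (i0 := i)) => v; rewrite /r2.
- by apply: leq_trans (leq_subr _ _) (r_le v).
- by move=> /r_in; case: (v == i) => /=; lia.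
- by move=> /r_out ->; case: (v == i) => /=; lia.
Qed.

Let near_c2 : near_regular J s c2.
Proof.
apply: (near_regularI (i0 := l)) => v; rewrite /c2.
- by apply: leq_trans (leq_subr _ _) (c_le v).
- by move=> /c_in; case: (v == l) => /=; lia.
- by move=> /c_out ->; case: (v == l) => /=; lia.
Qed.

Let near_c1 : near_regular J s c1.
Proof.
apply: (near_regularI (i0 := l)) => v; rewrite /c1.
- have [->|_] := eqVneq v k; first by move: ck; lia.
  by have := c_le v; lia.
- by move=> vJ; have := c_in vJ; case: (v == l) => /=; lia.
- by move=> /c_out ->; case: (v == l) => /=; lia.
Qed.

(** The path from [S0] to [S3] deletes [(j, l)], deletes [(i, k)] and adds [(i, l)]. In the end the
    degrees at [i] and [l] are restored, and those at [j] and [k] have dropped by one. *)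
Let rel1 : #|S0|%:R * mean S0 (fun M => x M j l) = #|S1|%:R * (1 - mean S1 (fun M => x M j l)).
Proof.
apply: cell_relation => //.
- by rewrite /free_cell /= jl [X in _ && ~~ X]andbC ltnNge Jl.
- by move=> v; rewrite /c0 /c1; have [->|_] := eqVneq v l; rewrite ?(c_out Jl) /=; lia.
Qed.

Let rel2 : #|S1|%:R * mean S1 (fun M => x M i k) = #|S2|%:R * (1 - mean S2 (fun M => x M i k)).
Proof.
apply: cell_relation => //.
- by rewrite /free_cell /= eq_sym ki ltnNge Ji.
- by move=> v; rewrite /r2; have [->|_] := eqVneq v i; rewrite ?(r_out Ji) /=; lia.
Qed.

Let rel3 : #|S3|%:R * mean S3 (fun M => x M i l) = #|S2|%:R * (1 - mean S2 (fun M => x M i l)).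
Proof.
apply: cell_relation => //.
- by rewrite /free_cell /= il ltnNge Ji.
- by move=> v; rewrite /r2; have [->|_] := eqVneq v i; rewrite ?(r_out Ji) /=; lia.
- by move=> v; rewrite /c2; have [->|_] := eqVneq v l; rewrite ?(c_out Jl) /=; lia.
Qed.

Lemma propagate (S S' : {set digraph n}) (a b : R) :
  #|S|%:R * a = #|S'|%:R * b -> (S != finset.set0 -> 0 < a) -> S != finset.set0 -> S' != finset.set0.
Proof.
move=> E a0 S0n; have {}a0 := a0 S0n; apply/negP => /eqP S'0.
move: E; rewrite S'0 cards0 mul0r => /eqP; rewrite mulf_eq0 (gt_eqF a0) orbF.
by rewrite pnatr_eq0 cards_eq0 (negbTE S0n).
Qed.

(** Every estimate of a mean presupposes a nonempty set, so non-emptiness has to be carried along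
    the three relations, in both directions. *)
Lemma step_neq0 : (S0 != finset.set0) = (S3 != finset.set0).
Proof.
have e1 S r' c' v u : S = completions J r' c' -> near_regular J s r' -> near_regular J s c' -> v != u -> (J <= v)%N || (J <= u)%N ->
   S != finset.set0 -> 0 < mean S (fun M => x M v u) /\ 0 < 1 - mean S (fun M => x M v u).
  by move=> -> nr nc vu Jvu Sn; have /andP[H1 H2] := mean_entry01 nr nc Sn vu Jvu; rewrite subr_gt0.
have ik : i != k by rewrite eq_sym.
apply/idP/idP => H.
  have H1 : S1 != finset.set0.
    by apply: (propagate rel1) H => H; have [] := e1 _ _ _ j l (erefl S0) near_r0 near_c0 jl _ H; rewrite ?Jl ?orbT.
  have H2 : S2 != finset.set0.
    by apply: (propagate rel2) H1 => H1; have [] := e1 _ _ _ i k (erefl S1) near_r near_c1 ik _ H1; rewrite ?Ji.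
  apply: (propagate (esym rel3)) H2 => H2.
  by have [] := e1 _ _ _ i l (erefl S2) near_r2 near_c2 il _ H2; rewrite ?Ji.
have H2 : S2 != finset.set0.
  by apply: (propagate rel3) H => H; have [] := e1 _ _ _ i l (erefl S3) near_r near_c il _ H; rewrite ?Ji.
have H1 : S1 != finset.set0.
  by apply: (propagate (esym rel2)) H2 => H2; have [] := e1 _ _ _ i k (erefl S2) near_r2 near_c2 ik _ H2; rewrite ?Ji.
apply: (propagate (esym rel1)) H1 => H1.
by have [] := e1 _ _ _ j l (erefl S1) near_r near_c1 jl _ H1; rewrite ?Jl ?orbT.
Qed.

(** The three relations are chained so that the sizes of [S1] and [S2] drop out. The terms [- n^-1]
    reflect that column [l] or row [i] has degree [s - 1] in the intermediate sets. *)
Lemma step_ratio : S3 != finset.set0 -> exists a1 a2 a3 a4 a5 a6 : R,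
  [/\ `|a1 - ((r j)%:R + 1) / m| <= del, `|a2 - ((r j)%:R / m - n%:R^-1)| <= del,
      `|a3 - ((c k)%:R + 1) / m| <= del & `|a4 - ((c k)%:R / m - n%:R^-1)| <= del] /\
  [/\ `|a5 - ((s%:R - 1 - B / m) / (m - 1) - n%:R^-1)| <= del,
      `|a6 - (s%:R - B / m) / (m - 1)| <= del &
      #|S3|%:R * ((1 - a2) * (1 - a4) * a6) = #|S0|%:R * (a1 * a3 * (1 - a5))].
Proof.
move=> H3; have H0 : S0 != finset.set0 by rewrite step_neq0.
have ik : i != k by rewrite eq_sym.
have H2 : S2 != finset.set0.
  apply: (propagate rel3) H3 => H.
  by have := mean_entry01 near_r near_c H il; rewrite Ji => /(_ isT)/andP[].
have H1 : S1 != finset.set0.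
  apply: (propagate rel1) H0 => H.
  by have := mean_entry01 near_r0 near_c0 H jl; rewrite Jl orbT => /(_ isT)/andP[].
exists (mean S0 (fun M => x M j l)), (mean S1 (fun M => x M j l)),
  (mean S1 (fun M => x M i k)), (mean S2 (fun M => x M i k)), (mean S2 (fun M => x M i l)),
  (mean S3 (fun M => x M i l)).
have P0 := mean_entry_block rg near_r0 near_c0 H0 jJ Jl.
have P1 := mean_entry_block rg near_r near_c1 H1 jJ Jl.
have P2 := mean_entry_block_col rg near_r near_c1 H1 Ji kJ.
have P3 := mean_entry_block_col rg near_r2 near_c2 H2 Ji kJ.
have P4 := mean_entry_out rg near_r2 near_c2 H2 Ji Jl il.
have P5 := mean_entry_out rg near_r near_c H3 Ji Jl il.
have n0 := rg_n0 rg.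
have B2 : \sum_(v < n | (v < J)%N) (c2 v)%:R = B.
  apply: eq_bigr => v vJ; rewrite /c2; have [vl|_] := eqVneq v l; last by rewrite subn0.
  by move: vJ; rewrite vl ltnNge Jl.
have lk : (l == k) = false by rewrite eq_sym (negbTE kl).
have lj : (l == j) = false by rewrite eq_sym (negbTE jl).
have s1 : (s - 1)%N%:R = s%:R - 1 :> R by rewrite natrB.
split; [split|split].
- by move: P0; rewrite /r0 /c0 !eqxx lk (c_out Jl) addn0 subrr mul0r subr0 natrD.
- move: P1; rewrite /c1 eqxx lk (c_out Jl) addn0 s1.
  have -> : s%:R - 1 - s%:R = -1 :> R by ring.
  by rewrite mulN1r opprK opprB addrA addrAC.
- by move: P2; rewrite /c1 eqxx (negbTE kl) (r_out Ji) subn0 subrr mul0r subr0 natrD.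
- move: P3; rewrite /r2 /c2 eqxx (negbTE kl) (r_out Ji) subn0 s1.
  have -> : s%:R - 1 - s%:R = -1 :> R by ring.
  by rewrite mulN1r opprK opprB addrA addrAC.
- move: P4; rewrite B2 /r2 /c2 !eqxx (r_out Ji) (c_out Jl) s1.
  have -> : s%:R - 1 - s%:R = -1 :> R by ring.
  by rewrite mulN1r opprK opprB addrA addrAC.
- by move: P5; rewrite (r_out Ji) (c_out Jl) subrr mul0r subr0.
have := rel1; have := rel2; have := rel3.
move: (mean S0 _) (mean S1 _) (mean S1 _) (mean S2 _) (mean S2 _) (mean S3 _).
move: #|S0|%:R #|S1|%:R #|S2|%:R #|S3|%:R => N0 N1 N2 N3 a1 a2 a3 a4 a5 a6 E3 E2 E1.
transitivity (N3 * a6 * ((1 - a2) * (1 - a4))); first ring.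
rewrite E3; transitivity (N2 * (1 - a4) * ((1 - a2) * (1 - a5))); first ring.
rewrite -E2; transitivity (N1 * (1 - a2) * (a3 * (1 - a5))); first ring.
by rewrite -E1; ring.
Qed.

End Step.
End Regime.

(** * Second-order expansion of logarithms *)

Section LnTaylor.
Import numFieldNormedType.Exports.
Local Open Scope classical_set_scope.

(** The function [f z = ln z - z + (z - 1)^2 / 2] has derivative [(z - 1)^2 / z], at most [2 y^2]
    between 1 and [1 + y]; the mean value theorem supplies the third factor [|y|]. *)
Lemma ln_taylor2 (R : realType) (y : R) : `|y| <= 2^-1 ->
  `|ln (1 + y) - y + y ^+ 2 / 2| <= 2 * `|y| ^+ 3.
Proof.
move=> y2; pose f (z : R) : R := ln z - z + 2^-1 * ((z - 1) * (z - 1)).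
have fd (z : R) : 0 < z -> is_derive z 1 f (z^-1 - 1 + (z - 1)).
  move=> z0; rewrite /f; apply: is_derive_eq.
    apply: is_deriveD; first by apply: is_deriveB; exact: is_derive1_ln.
  by rewrite /GRing.scale /=; field; rewrite gt_eqF.
have fc (a b : R) : 0 < a -> {within `[a, b], continuous f}.
  move=> a0; apply: derivable_within_continuous => z.
  rewrite in_itv /= => /andP[az _]; have z0 : 0 < z by apply: lt_le_trans az.
  by have := fd z z0 => /@ex_derive.
have y2' := y2; move: y2'; rewrite ler_norml => /andP[y3 y4].
have key (a b : R) : 0 < a -> a <= b -> (forall z, a <= z <= b -> `|z^-1 - 1 + (z - 1)| <= 2 * `|y| ^+ 2) ->
    `|f b - f a| <= 2 * `|y| ^+ 2 * (b - a).
  move=> a0 ab H.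
  have der z : z \in `]a, b[%R -> is_derive z 1 f (z^-1 - 1 + (z - 1)).
    by rewrite in_itv /= => /andP[az _]; apply: fd; apply: lt_trans az.
  have [z zab ->] := MVT_segment ab der (fc a b a0).
  rewrite normrM (ger0_norm (_ : 0 <= b - a)) ?subr_ge0 // ler_wpM2r ?subr_ge0 //.
  by apply: H; move: zab; rewrite in_itv.
have bnd z : 2^-1 <= z -> `|z - 1| <= `|y| -> `|z^-1 - 1 + (z - 1)| <= 2 * `|y| ^+ 2.
  move=> z2 zy; have z0 : 0 < z by lra.
  have -> : z^-1 - 1 + (z - 1) = (z - 1) ^+ 2 / z by field; rewrite gt_eqF.
  rewrite normrM normrX mulrC ler_pM //.
  - by rewrite normfV gtr0_norm // -(invrK 2) lef_pV2 ?posrE.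
  - by apply: lerXn2r; rewrite ?nnegrE.
have f1 : f 1 = -1 by rewrite /f ln1; ring.
have E : ln (1 + y) - y + y ^+ 2 / 2 = f (1 + y) - f 1.
  by rewrite f1 /f; field.
rewrite E (exprSr _ 2) mulrA; have [y0|y0] := leP 0 y.
  have yE := ger0_norm y0; have y1E : 1 + y - 1 = y by ring.
  apply: le_trans (key 1 (1 + y) ltr01 _ _) _; last by rewrite y1E yE.
    lra.
  move=> z /andP[z1 z2]; apply: bnd; first lra.
  by rewrite yE ger0_norm; lra.
have yE := ltr0_norm y0; rewrite distrC.
apply: le_trans (key (1 + y) 1 _ _ _) _; first lra.
- lra.
- move=> z /andP[z1 z2]; apply: bnd; first lra.
  by rewrite yE ler_norml; apply/andP; split; lra.
- by rewrite [X in _ <= _ * X]yE opprD addrA subrr add0r.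
Qed.

End LnTaylor.

Section Regime.
Variables (R : realType) (n s J : nat) (L w : R).
Hypothesis rg : regime n s J L w.
Local Notation lam := (s%:R / n%:R : R).
Local Notation A := (2^-1 * lam * (1 - lam) : R).
Local Notation p := (s%:R / (n%:R - 1) : R).

Lemma rg_small k : (k < 60)%N -> 100 * (L ^+ k * w^-1) <= 1.
Proof.
move=> k60; have w0 := rg_w0 rg; rewrite mulrA ler_pdivrMr // mul1r.
exact: (rg_L100 rg).
Qed.

Lemma rg_u0 : 0 < w^-1. Proof. by rewrite invr_gt0 (rg_w0 rg). Qed.

Lemma rg_nV : n%:R^-1 = w^-1 ^+ 2. Proof. by rewrite -(rg_w2 rg) exprVn. Qed.

Lemma rg_J_n : 0 <= (J%:R / n%:R : R) <= L * w^-1.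
Proof.
have n0 := rg_n0 rg; have w0 := rg_w0 rg.
rewrite divr_ge0 //= ler_pdivrMr // -(rg_w2 rg).
have -> : L * w^-1 * w ^+ 2 = w * L by field; rewrite gt_eqF.
exact: rg_J rg.
Qed.

Lemma rg_p_lam : 0 <= p - lam <= 2 * w^-1 ^+ 2.
Proof.
have n0 := rg_n0 rg; have n100 := rg_n_large rg; have l0 := lam_gt0 rg; have l1 := lam_lt1 rg.
have -> : p - lam = lam / (n%:R - 1) by field; rewrite !gt_eqF //; lra.
have n1 : 0 < n%:R - 1 :> R by lra.
rewrite (divr_ge0 (ltW l0) (ltW n1)) /= ler_pdivrMr //.
rewrite -rg_nV; apply: le_trans (ltW l1) _.
have -> : 2 * n%:R^-1 * (n%:R - 1) = 2 - 2 / n%:R :> R by field; rewrite gt_eqF.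
have : 2 / n%:R <= 1 :> R by rewrite ler_pdivrMr //; lra.
lra.
Qed.

Lemma rg_p : [/\ 0 < p < 1, 1 <= L * p & 1 <= L * (1 - p)].
Proof.
have /andP[p1 p2] := rg_p_lam; have [l1 l2] := rg_lam rg; have L0 := rg_L0 rg.
have s2 : 2 * w^-1 ^+ 2 <= 1 / L.
  rewrite ler_pdivlMr // expr2 mulrA.
  have := @rg_small 1 isT; have u0 := rg_u0; have := @rg_small 0 isT; rewrite expr1 expr0; nra.
have e2 : 2 / L = 1 / L + 1 / L by lra.
have q0 : 0 < 1 / L by rewrite divr_gt0.
have E a : 1 <= L * a = (1 / L <= a) by rewrite ler_pdivrMr // mulrC.
by rewrite !E; split; [apply/andP; split|..]; lra.
Qed.

(** [g0] is of order [1 / w] and [g1] of order [1 / w^2], so only the square of [g0] matters at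
    second order. Division by [q >= 1 / L] costs nothing but powers of [L]. *)
Lemma ln_expand (q a g0 g1 : R) : 1 <= L * q ->
  `|a - q - g0 - g1| <= L ^+ 8 * w^-1 ^+ 3 -> `|g0| <= 2 * (L * w^-1) -> `|g1| <= 2 * (L ^+ 2 * w^-1 ^+ 2) ->
  0 < a /\ `|ln (a / q) - ((g0 + g1) / q - g0 ^+ 2 / (2 * q ^+ 2))| <= L ^+ 10 * w^-1 ^+ 3.
Proof.
move=> Lq; set u := w^-1; set h := a - q => ha hg0 hg1.
have u0 : 0 < u := rg_u0; have L100 := rg_L rg; have L0 := rg_L0 rg.
have q0 : 0 < q by move: Lq; rewrite -(pmulr_rgt0 _ L0); exact: lt_le_trans ltr01.
have qL : q^-1 <= L by rewrite -[q^-1]mul1r ler_pdivrMr.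
have q10 : 0 < q^-1 by rewrite invr_gt0.
have S6 : 100 * (L ^+ 6 * u) <= 1 by exact: rg_small.
have S1 : 100 * (L * u) <= 1 by have := @rg_small 1 isT; rewrite expr1.
have S2 : 100 * (L ^+ 2 * u) <= 1 by exact: rg_small.
have Lu0 : 0 < L * u by rewrite mulr_gt0.
have L2u0 : 0 < L ^+ 2 * u ^+ 2 by rewrite mulr_gt0 ?exprn_gt0.
have t8 : L ^+ 8 * u ^+ 3 <= L ^+ 2 * u ^+ 2.
  have -> : L ^+ 8 * u ^+ 3 = L ^+ 2 * u ^+ 2 * (L ^+ 6 * u) by ring.
  by rewrite ler_piMr ?(ltW L2u0) //; lra.
have t2 : 3 * (L ^+ 2 * u ^+ 2) <= L * u.
  have -> : L ^+ 2 * u ^+ 2 = (L * u) * (L * u) by ring.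
  nra.
have hd : `|h - g0| <= 3 * (L ^+ 2 * u ^+ 2).
  have -> : h - g0 = (h - g0 - g1) + g1 by ring.
  by apply: le_trans (ler_normD _ _) _; lra.
have hh : `|h| <= 3 * (L * u).
  have -> : h = (h - g0) + g0 by ring.
  by apply: le_trans (ler_normD _ _) _; lra.
have hs : `|h + g0| <= 5 * (L * u) by apply: le_trans (ler_normD _ _) _; lra.
pose y := h / q.
have yle : `|y| <= 3 * (L ^+ 2 * u).
  rewrite /y normrM (gtr0_norm q10); apply: le_trans (_ : 3 * (L * u) * L <= _); last by rewrite le_eqVlt; apply/orP; left; apply/eqP; ring.
  by apply: ler_pM => //; exact: ltW.
have aE : a / q = 1 + y by rewrite /y /h; field; rewrite gt_eqF.
have y2 : `|y| <= 2^-1 by lra.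
split.
  have : 0 < 1 + y by move: y2; rewrite ler_norml => /andP[? ?]; lra.
  by rewrite -aE pmulr_lgt0.
have T := ln_taylor2 y2; rewrite aE.
have E : ln (1 + y) - ((g0 + g1) / q - g0 ^+ 2 / (2 * q ^+ 2)) =
   (ln (1 + y) - y + y ^+ 2 / 2) + (h - g0 - g1) / q - (h - g0) * (h + g0) / 2 * (q^-1 * q^-1).
  by rewrite /y; field; rewrite gt_eqF.
rewrite E; apply: le_trans (ler_normB _ _) _.
apply: le_trans (lerD (ler_normD _ _) (lexx _)) _.
have b1 : `|ln (1 + y) - y + y ^+ 2 / 2| <= 54 * (L ^+ 6 * u ^+ 3).
  apply: le_trans T _.
  have : `|y| ^+ 3 <= (3 * (L ^+ 2 * u)) ^+ 3.
    apply: lerXn2r; rewrite ?nnegrE //; rewrite mulr_ge0 // mulr_ge0 ?exprn_ge0 //; exact: ltW.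
  have -> : (3 * (L ^+ 2 * u)) ^+ 3 = 27 * (L ^+ 6 * u ^+ 3) by ring.
  lra.
have b2 : `|(h - g0 - g1) / q| <= L ^+ 9 * u ^+ 3.
  rewrite normrM (gtr0_norm q10); apply: le_trans (_ : L ^+ 8 * u ^+ 3 * L <= _).
    by apply: ler_pM => //; exact: ltW.
  by rewrite le_eqVlt; apply/orP; left; apply/eqP; ring.
have b3 : `|(h - g0) * (h + g0) / 2 * (q^-1 * q^-1)| <= 8 * (L ^+ 5 * u ^+ 3).
  rewrite !normrM (gtr0_norm q10) normfV [`|2|]ger0_norm //.
  apply: le_trans (_ : (3 * (L ^+ 2 * u ^+ 2)) * (5 * (L * u)) / 2 * (L * L) <= _).
    have q11 : 0 <= q^-1 := ltW q10.
    apply: ler_pM; [by rewrite !mulr_ge0|by rewrite mulr_ge0| |by apply: ler_pM].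
    by rewrite ler_pM2r ?invr_gt0 //; apply: ler_pM.
  have -> : (3 * (L ^+ 2 * u ^+ 2)) * (5 * (L * u)) / 2 * (L * L) = 15 / 2 * (L ^+ 5 * u ^+ 3) by field.
  have : 0 <= L ^+ 5 * u ^+ 3 by rewrite mulr_ge0 ?exprn_ge0 //; exact: ltW.
  lra.
have u3 : 0 <= u ^+ 3 by rewrite exprn_ge0 // ltW.
have c1 : L ^+ 6 * u ^+ 3 <= L ^+ 9 * u ^+ 3 by rewrite ler_wpM2r // ler_weXn2l // (rg_L1 rg).
have c2 : L ^+ 5 * u ^+ 3 <= L ^+ 9 * u ^+ 3 by rewrite ler_wpM2r // ler_weXn2l // (rg_L1 rg).
have c3 : 100 * (L ^+ 9 * u ^+ 3) <= L ^+ 10 * u ^+ 3.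
  by rewrite mulrA ler_wpM2r // (exprS _ 9) ler_wpM2r // exprn_ge0 // ltW.
have c4 : 0 <= L ^+ 9 * u ^+ 3 by rewrite mulr_ge0 // exprn_ge0 // ltW.
apply: le_trans (lerD (lerD b1 b2) b3) _; lra.
Qed.

(* Second-order expansion of the logarithm of the ratio in [step_ratio]. *)
Definition step_main (d d' chi1 : R) : R :=
  let v := p * (1 - p) in
  let D := d * (n%:R + J%:R) / n%:R ^+ 2 in let D' := d' * (n%:R + J%:R) / n%:R ^+ 2 in
  - ((D + D') / v) - (1 - 2 * p) * (D ^+ 2 + D' ^+ 2) / (2 * v ^+ 2)
  - chi1 / n%:R ^+ 2 / v - 2 / n%:R / (1 - p).

(** All six numbers are close to [p], and setting them equal to [p] turns the quotient into
    [p / (1 - p)]. Each logarithm is expanded around this point separately. *)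
Lemma step_log (d d' chi1 a1 a2 a3 a4 a5 a6 : R) :
  let D := d * (n%:R + J%:R) / n%:R ^+ 2 in let D' := d' * (n%:R + J%:R) / n%:R ^+ 2 in
  let Q := chi1 / n%:R ^+ 2 in let e := L ^+ 8 * w^-1 ^+ 3 in
  `|d| <= J%:R -> `|d'| <= J%:R -> `|chi1| <= J%:R ^+ 2 ->
  `|a1 - (p - D)| <= e -> `|a2 - (p - D - 2 / n%:R)| <= e ->
  `|a3 - (p - D')| <= e -> `|a4 - (p - D' - 2 / n%:R)| <= e ->
  `|a5 - (p + Q - 2 / n%:R)| <= e -> `|a6 - (p + Q)| <= e ->
  [/\ 0 < a1, 0 < 1 - a2, 0 < a3, 0 < 1 - a4 & 0 < 1 - a5 /\ 0 < a6] /\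
  `|ln (a1 * a3 * (1 - a5) / ((1 - a2) * (1 - a4) * a6)) - ln (p / (1 - p)) - step_main d d' chi1|
    <= 6 * (L ^+ 10 * w^-1 ^+ 3).
Proof.
move=> D D' Q e dJ d'J cJ h1 h2 h3 h4 h5 h6.
have [/andP[p0 p1] Lp Lq] := rg_p.
have q0 : 0 < 1 - p by lra.
have n0 := rg_n0 rg; have u0 := rg_u0; have L0 := rg_L0 rg; have L1 := rg_L1 rg.
have /andP[Jn0 Jn] := rg_J_n.
have S1 : 100 * (L * w^-1) <= 1 by have := @rg_small 1 isT; rewrite expr1.
have Db (b : R) : `|b| <= J%:R -> `|b * (n%:R + J%:R) / n%:R ^+ 2| <= 2 * (L * w^-1).
  move=> bJ; have -> : b * (n%:R + J%:R) / n%:R ^+ 2 = b / n%:R * (1 + J%:R / n%:R).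
    by field; rewrite gt_eqF.
  rewrite normrM mulrC; apply: ler_pM => //.
    by rewrite ger0_norm; lra.
  rewrite normrM normfV (gtr0_norm n0); apply: le_trans Jn.
  by rewrite ler_pM2r ?invr_gt0.
have DD := Db _ dJ; have DD' := Db _ d'J.
have G2 : `|2 / n%:R : R| <= 2 * (L ^+ 2 * w^-1 ^+ 2).
  rewrite rg_nV ger0_norm ?ler_pM2l //; last by rewrite mulr_ge0 // exprn_ge0 // ltW.
  by rewrite ler_peMl ?exprn_ege1 // exprn_ge0 // ltW.
have Qb : `|Q| <= L ^+ 2 * w^-1 ^+ 2.
  rewrite /Q normrM normfV normrX (gtr0_norm n0) -exprMn.
  apply: le_trans (_ : (J%:R / n%:R) ^+ 2 <= _).
    by rewrite exprMn exprVn ler_pM2r ?invr_gt0 ?exprn_gt0.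
  by apply: lerXn2r; rewrite ?nnegrE // mulr_ge0 //; exact: ltW.
have G3 : `|2 / n%:R - Q| <= 2 * (L ^+ 2 * w^-1 ^+ 2).
  apply: le_trans (ler_normB _ _) _.
  have -> : `|2 / n%:R : R| = 2 * w^-1 ^+ 2.
    by rewrite ger0_norm rg_nV // mulr_ge0 // exprn_ge0 // ltW.
  have : 2 * w^-1 ^+ 2 <= L ^+ 2 * w^-1 ^+ 2.
    rewrite ler_wpM2r ?exprn_ge0 //; first exact: ltW.
    by have := rg_L rg; nra.
  lra.
have L2u2 : 0 <= L ^+ 2 * w^-1 ^+ 2 by rewrite mulr_ge0 ?exprn_ge0 //; exact: ltW.
have Lu : 0 <= L * w^-1 by rewrite mulr_ge0 //; exact: ltW.
have z1 : `|0 : R| <= 2 * (L ^+ 2 * w^-1 ^+ 2) by rewrite normr0 mulr_ge0.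
have z0 : `|0 : R| <= 2 * (L * w^-1) by rewrite normr0 mulr_ge0.
have [] := @ln_expand p a1 (- D) 0 Lp _ _ z1.
- by move: h1; congr (`|_| <= _); ring.
- by rewrite normrN.
move=> b1 e1.
have [] := @ln_expand (1 - p) (1 - a2) D (2 / n%:R) Lq _ DD G2.
  by move: h2; rewrite -normrN; congr (`|_| <= _); ring.
move=> b2 e2.
have [] := @ln_expand p a3 (- D') 0 Lp _ _ z1.
- by move: h3; congr (`|_| <= _); ring.
- by rewrite normrN.
move=> b3 e3.
have [] := @ln_expand (1 - p) (1 - a4) D' (2 / n%:R) Lq _ DD' G2.
  by move: h4; rewrite -normrN; congr (`|_| <= _); ring.
move=> b4 e4.
have [] := @ln_expand (1 - p) (1 - a5) 0 (2 / n%:R - Q) Lq _ z0 G3.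
  by move: h5; rewrite -normrN; congr (`|_| <= _); ring.
move=> b5 e5.
have [] := @ln_expand p a6 0 Q Lp _ z0 _.
- by move: h6; congr (`|_| <= _); ring.
- by apply: le_trans Qb _; lra.
move=> b6 e6.
split; first by [].
have -> : ln (a1 * a3 * (1 - a5) / ((1 - a2) * (1 - a4) * a6)) - ln (p / (1 - p)) =
  ln (a1 / p) - ln ((1 - a2) / (1 - p)) + (ln (a3 / p) - ln ((1 - a4) / (1 - p))) +
  (ln ((1 - a5) / (1 - p)) - ln (a6 / p)).
  move: (p) p0 q0 => y y0 yq.
  have P13 : 0 < a1 * a3 by rewrite mulr_gt0.
  have P24 : 0 < (1 - a2) * (1 - a4) by rewrite mulr_gt0.
  rewrite (ln_div (mulr_gt0 P13 b5)) ?posrE ?(mulr_gt0 P24 b6) //.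
  rewrite (lnM P13 b5) (lnM b1 b3) (lnM P24 b6) (lnM b2 b4).
  by rewrite !ln_div ?posrE //; ring.
have -> : step_main d d' chi1 =
  ((- D + 0) / p - (- D) ^+ 2 / (2 * p ^+ 2)) - ((D + 2 / n%:R) / (1 - p) - D ^+ 2 / (2 * (1 - p) ^+ 2))
  + (((- D' + 0) / p - (- D') ^+ 2 / (2 * p ^+ 2)) - ((D' + 2 / n%:R) / (1 - p) - D' ^+ 2 / (2 * (1 - p) ^+ 2)))
  + (((0 + (2 / n%:R - Q)) / (1 - p) - 0 ^+ 2 / (2 * (1 - p) ^+ 2)) - ((0 + Q) / p - 0 ^+ 2 / (2 * p ^+ 2))).
  rewrite /step_main -/D -/D' -/Q; move: (p) p0 q0 => y y0 yq; move: (D) (D') (Q) => x1 x2 x3; move: (2 / n%:R) => x4.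
  by field; rewrite !gt_eqF.
move: e1 e2 e3 e4 e5 e6.
move: (ln _) => x1; move: (ln _) => x2; move: (ln _) => x3; move: (ln _) => x4; move: (ln _) => x5; move: (ln _) => x6.
move: (_ / p - _) => y1; move: (_ / (1 - p) - _) => y2; move: (_ / p - _) => y3; move: (_ / (1 - p) - _) => y4.
move: (_ / (1 - p) - _) => y5; move: (_ / p - _) => y6; move: (L ^+ 10 * _) => t.
rewrite !ler_norml => /andP[? ?] /andP[? ?] /andP[? ?] /andP[? ?] /andP[? ?] /andP[? ?].
by apply/andP; split; lra.
Qed.

End Regime.

(** Dictionary for its use in [step_compare]: [a = (2 A)^-1], [b = (p (1 - p))^-1], [k = J / n],
    [q = chi_1 / n^2], [g = 1 - 2 lam], [h = 1 - 2 p], [i1 = (1 - lam)^-1], [i2 = (1 - p)^-1], and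
    [d], [d'] are degree deviations over [n]. The summands come from exchanging [p] for [lam], from
    [1 + k] against 1, or from terms beyond second order, so each is of third order at most. *)
Lemma step_bounds (R : realType) (L u a b k q g h i1 i2 d d' : R) :
  100 <= L -> 0 < u -> u <= 1 -> 100 * (L * u) <= 1 -> 0 < a -> 0 < b -> b <= L -> a <= L / 2 ->
  `|a - b| <= L ^+ 2 * u ^+ 2 -> 0 <= k -> k <= L * u -> `|q| <= L ^+ 2 * u ^+ 2 ->
  `|g| <= 1 -> `|h| <= 1 -> `|g - h| <= 4 * u ^+ 2 -> `|i1 - i2| <= L ^+ 2 * (2 * u ^+ 2) ->
  `|d| <= L * u -> `|d'| <= L * u ->
  `|(d + d') * (1 + k) * (a - b) + q * (a - b)
    + (g * a ^+ 2 * (d ^+ 2 + d' ^+ 2) / 2 - h * b ^+ 2 * (d ^+ 2 + d' ^+ 2) * (1 + k) ^+ 2 / 2)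
    + 2 * u ^+ 2 * (i1 - i2)
    + (k * a * u ^+ 2 + a * (u ^+ 2) ^+ 2 / 2 + g * (3 * (d + d') * u ^+ 2 + 2 * (u ^+ 2) ^+ 2) * a ^+ 2 / 6)|
  <= L ^+ 6 * u ^+ 3.
Proof.
move=> L100 u0 u1 S1 a0 b0 bL aL ab k0 k1 qk g1 h1 gh i12 dk dk'.
have L0 : 0 < L by lra.
have L1 : 1 <= L by lra.
have Lu0 : 0 <= L * u by rewrite mulr_ge0 // ltW.
have L2u2 : 0 <= L ^+ 2 * u ^+ 2 by rewrite mulr_ge0 // exprn_ge0 // ltW.
have L3u3 : 0 <= L ^+ 3 * u ^+ 3 by rewrite mulr_ge0 // exprn_ge0 // ltW.
have dd : `|d + d'| <= 2 * (L * u) by apply: le_trans (ler_normD _ _) _; lra.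
have k2 : `|1 + k| <= 2 by rewrite ger0_norm; lra.
have ai0 := ltW a0; have bi0 := ltW b0; have Li0 := ltW L0; have ui0 := ltW u0.
have aL1 : a <= L by lra.
have t1 : `|(d + d') * (1 + k) * (a - b) + q * (a - b)| <= 4 * (L * u) * (L ^+ 2 * u ^+ 2) + L ^+ 2 * u ^+ 2 * (L ^+ 2 * u ^+ 2).
  apply: le_trans (ler_normD _ _) _; apply: lerD; rewrite !normrM; last exact: ler_pM.
  have -> : 4 * (L * u) = 2 * (L * u) * 2 by ring.
  by apply: ler_pM => //; apply: ler_pM.
have d2 : d ^+ 2 + d' ^+ 2 <= 2 * (L ^+ 2 * u ^+ 2).
  have sq x : `|x| <= L * u -> x ^+ 2 <= L ^+ 2 * u ^+ 2.
    by move=> ?; rewrite -real_normK ?num_real // -exprMn; apply: lerXn2r; rewrite ?nnegrE.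
  by have := sq _ dk; have := sq _ dk'; lra.
have d20 : 0 <= d ^+ 2 + d' ^+ 2 by rewrite addr_ge0 // sqr_ge0.
have t2 : `|g * a ^+ 2 * (d ^+ 2 + d' ^+ 2) / 2 - h * b ^+ 2 * (d ^+ 2 + d' ^+ 2) * (1 + k) ^+ 2 / 2| <= 9 * (L ^+ 5 * u ^+ 3).
  have -> : g * a ^+ 2 * (d ^+ 2 + d' ^+ 2) / 2 - h * b ^+ 2 * (d ^+ 2 + d' ^+ 2) * (1 + k) ^+ 2 / 2 =
    ((d ^+ 2 + d' ^+ 2) / 2) * ((g - h) * (a * a) + h * ((a - b) * (a + b)) - h * (b * b) * (k * (2 + k))) by field.
  apply: le_trans (_ : (L ^+ 2 * u ^+ 2) * (4 * u ^+ 2 * (L * L) + L ^+ 2 * u ^+ 2 * (2 * L) + L * L * (L * u * 3)) <= _).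
    have bb : `|b * b| <= L * L by rewrite normrM; apply: ler_pM; rewrite ?normr_ge0 // gtr0_norm.
    have aa : `|a * a| <= L * L by rewrite normrM; apply: ler_pM; rewrite ?normr_ge0 // gtr0_norm.
    have kk : `|k * (2 + k)| <= L * u * 3.
      rewrite normrM; apply: ler_pM; rewrite ?normr_ge0 //; first by rewrite ger0_norm.
      by clear -k0 k1 S1; rewrite ger0_norm; lra.
    have dh : `|(d ^+ 2 + d' ^+ 2) / 2| <= L ^+ 2 * u ^+ 2 by clear -d2 d20; rewrite ger0_norm; lra.
    have sab : `|a + b| <= 2 * L by clear -ai0 bi0 aL1 bL; rewrite ger0_norm; lra.
    rewrite normrM; apply: ler_pM; rewrite ?normr_ge0 //.
    apply: le_trans (ler_normB _ _) _; apply: lerD; last first.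
      rewrite normrM; apply: ler_pM; rewrite ?normr_ge0 //.
      by rewrite normrM -[leRHS]mul1r; apply: ler_pM; rewrite ?normr_ge0.
    apply: le_trans (ler_normD _ _) _; apply: lerD.
      by rewrite normrM; apply: ler_pM; rewrite ?normr_ge0.
    rewrite normrM -[leRHS]mul1r; apply: ler_pM; rewrite ?normr_ge0 //.
    by rewrite normrM; apply: ler_pM; rewrite ?normr_ge0.
  have -> : (L ^+ 2 * u ^+ 2) * (4 * u ^+ 2 * (L * L) + L ^+ 2 * u ^+ 2 * (2 * L) + L * L * (L * u * 3)) =
    (L ^+ 5 * u ^+ 3) * (4 * u / L + 2 * u + 3) by field; rewrite gt_eqF.
  rewrite [leRHS]mulrC; apply: ler_wpM2l; first by rewrite mulr_ge0 // exprn_ge0.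
  have : 4 * u / L <= 4 by rewrite ler_pdivrMr //; nra.
  lra.
have t3 : `|2 * u ^+ 2 * (i1 - i2)| <= 4 * (L ^+ 2 * u ^+ 4).
  rewrite normrM ger0_norm; last by rewrite mulr_ge0 // exprn_ge0.
  have -> : 4 * (L ^+ 2 * u ^+ 4) = 2 * u ^+ 2 * (L ^+ 2 * (2 * u ^+ 2)) by ring.
  by rewrite ler_wpM2l // mulr_ge0 // exprn_ge0.
have u2 : 0 <= u ^+ 2 by rewrite exprn_ge0.
have t4 : `|k * a * u ^+ 2 + a * (u ^+ 2) ^+ 2 / 2 + g * (3 * (d + d') * u ^+ 2 + 2 * (u ^+ 2) ^+ 2) * a ^+ 2 / 6| <= 4 * (L ^+ 3 * u ^+ 3).
  have ku : k * a * u ^+ 2 <= L ^+ 3 * u ^+ 3.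
    have -> : L ^+ 3 * u ^+ 3 = (L * u * L * u ^+ 2) * L by ring.
    apply: le_trans (_ : L * u * L * u ^+ 2 <= _).
      by rewrite ler_wpM2r //; apply: ler_pM.
    by rewrite ler_peMr ?mulr_ge0 //; lra.
  have au : a * (u ^+ 2) ^+ 2 / 2 <= L ^+ 3 * u ^+ 3.
    apply: le_trans (_ : L * u ^+ 3 <= _); last first.
      by rewrite ler_wpM2r ?exprn_ge0 // -[leLHS]expr1 ler_weXn2l //; lra.
    have -> : a * (u ^+ 2) ^+ 2 / 2 = a * u ^+ 3 * (u / 2) by field.
    apply: le_trans (_ : a * u ^+ 3 * 1 <= _).
      by rewrite ler_wpM2l ?mulr_ge0 ?exprn_ge0 //; lra.
    by rewrite mulr1 ler_wpM2r // exprn_ge0.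
  have gu : `|g * (3 * (d + d') * u ^+ 2 + 2 * (u ^+ 2) ^+ 2) * a ^+ 2 / 6| <= 2 * (L ^+ 3 * u ^+ 3).
    have -> : g * (3 * (d + d') * u ^+ 2 + 2 * (u ^+ 2) ^+ 2) * a ^+ 2 / 6 =
      g * (((d + d') / 2 + u ^+ 2 / 3) * u ^+ 2) * (a * a) by field.
    have -> : 2 * (L ^+ 3 * u ^+ 3) = 1 * ((2 * (L * u)) * u ^+ 2) * (L * L) by ring.
    rewrite normrM; apply: ler_pM => //; last first.
      by rewrite ger0_norm ?mulr_ge0 //; apply: ler_pM.
    rewrite normrM; apply: ler_pM => //.
    rewrite normrM (ger0_norm u2) ler_wpM2r //.
    apply: le_trans (ler_normD _ _) _; rewrite normrM [`|2^-1|]ger0_norm // [`|u ^+ 2 / 3|]ger0_norm; last by rewrite divr_ge0.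
    have uu : u ^+ 2 <= L * u by rewrite expr2 ler_wpM2r //; clear -u1 L1; lra.
    by clear -uu dd Lu0; lra.
  apply: le_trans (ler_normD _ _) _.
  rewrite ger0_norm; last by rewrite addr_ge0 ?divr_ge0 ?mulr_ge0 // exprn_ge0.
  lra.
apply: le_trans (ler_normD _ _) _.
apply: le_trans (lerD (le_trans (ler_normD _ _) (lerD (le_trans (ler_normD _ _) (lerD t1 t2)) t3)) t4) _.
have -> : 4 * (L * u) * (L ^+ 2 * u ^+ 2) + L ^+ 2 * u ^+ 2 * (L ^+ 2 * u ^+ 2) + 9 * (L ^+ 5 * u ^+ 3) + 4 * (L ^+ 2 * u ^+ 4) + 4 * (L ^+ 3 * u ^+ 3) =
  u ^+ 3 * (4 * L ^+ 3 + L ^+ 4 * u + 9 * L ^+ 5 + 4 * (L ^+ 2 * u) + 4 * L ^+ 3) by ring.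
rewrite [leRHS]mulrC ler_wpM2l ?exprn_ge0 //.
have p2 : L ^+ 2 <= L ^+ 5 by rewrite ler_weXn2l.
have p3 : L ^+ 3 <= L ^+ 5 by rewrite ler_weXn2l.
have p4 : L ^+ 4 <= L ^+ 5 by rewrite ler_weXn2l.
have q2 : L ^+ 2 * u <= L ^+ 2 by rewrite ler_piMr // exprn_ge0.
have q4 : L ^+ 4 * u <= L ^+ 4 by rewrite ler_piMr // exprn_ge0.
have p6 : 100 * L ^+ 5 <= L ^+ 6 by rewrite (exprS _ 5) ler_wpM2r // exprn_ge0.
have p50 : 0 <= L ^+ 5 by rewrite exprn_ge0.
by clear -p2 p3 p4 q2 q4 p6 p50; lra.
Qed.

(** [chi2] and [chi3] stand for the sums over out-degrees and in-degrees together, as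
    [block_exponent] supplies them. *)
Definition exponent (R : realType) (n s J : nat) (chi1 chi2 chi3 : R) : R :=
  let lam := s%:R / n%:R in let A := 2^-1 * lam * (1 - lam) in
  (1 - 2 * lam) * chi1 / (2 * A * n%:R) - chi1 ^+ 2 / (4 * A * n%:R ^+ 2)
  - (n%:R + J%:R) * chi2 / (4 * A * n%:R ^+ 2)
  - (1 - 2 * lam) * chi3 / (24 * A ^+ 2 * n%:R ^+ 2).

Section Regime.
Variables (R : realType) (n s J : nat) (L w : R).
Hypothesis rg : regime n s J L w.
Local Notation lam := (s%:R / n%:R : R).
Local Notation A := (2^-1 * lam * (1 - lam) : R).
Local Notation p := (s%:R / (n%:R - 1) : R).

(** Compares the variance [p (1 - p)] of an arc with [2 A = lam (1 - lam)]: they differ by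
    [O(1 / n)] since only the denominators [n - 1] and [n] differ. *)
Lemma rg_variance : [/\ (p * (1 - p))^-1 <= L, (2 * A)^-1 <= L / 2, 0 < p * (1 - p)
  & `|(2 * A)^-1 - (p * (1 - p))^-1| <= L ^+ 2 * w^-1 ^+ 2].
Proof.
have /andP[pl1 pl2] := rg_p_lam rg; have [/andP[p0 p1] Lp Lq] := rg_p rg.
have l0 := lam_gt0 rg; have l1 := lam_lt1 rg; have L0 := rg_L0 rg.
have A0 := A_gt0 rg; have iA := invA_le rg; have u0 := rg_u0 rg.
have v0 : 0 < p * (1 - p) by rewrite mulr_gt0 // subr_gt0.
have A20 : 0 < 2 * A by rewrite mulr_gt0.
have dif : `|p * (1 - p) - 2 * A| <= 2 * w^-1 ^+ 2.
  have -> : p * (1 - p) - 2 * A = (p - lam) * (1 - p - lam) by field; rewrite !gt_eqF ?(rg_n0 rg) //; have := rg_n_large rg; lra.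
  rewrite normrM -[leRHS]mulr1 ler_pM //; first by rewrite ger0_norm.
  by rewrite ler_norml; apply/andP; split; lra.
have S1 : 100 * (L * w^-1) <= 1 by have := rg_small rg (isT : (1 < 60)%N); rewrite expr1.
have small : 2 * w^-1 ^+ 2 * L <= 1.
  have : w^-1 <= 1 by rewrite invf_le1 ?(rg_w0 rg) // (rg_w1 rg).
  rewrite expr2; nra.
have iA2 : (2 * A)^-1 <= L / 2 by rewrite invfM mulrC ler_pM2r // invr_gt0.
have vL : 1 <= L * (p * (1 - p)).
  have AL : 2 <= L * (2 * A) by have := rg_A rg; lra.
  move: dif; rewrite ler_norml => /andP[d1 d2].
  move: (2 * A) (p * (1 - p)) AL d1 d2 small => y1 y2 y3 d1 d2 sm; nra.
have iv : (p * (1 - p))^-1 <= L by rewrite -[_^-1]mul1r ler_pdivrMr.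
split=> //.
have -> : (2 * A)^-1 - (p * (1 - p))^-1 = (p * (1 - p) - 2 * A) * ((2 * A)^-1 * (p * (1 - p))^-1).
  by move: (2 * A) A20 (p * (1 - p)) v0 => y1 y10 y2 y20; field; rewrite !gt_eqF.
rewrite normrM; apply: le_trans (_ : 2 * w^-1 ^+ 2 * (L / 2 * L) <= _); last first.
  by rewrite le_eqVlt; apply/orP; left; apply/eqP; field; rewrite gt_eqF ?(rg_w0 rg).
apply: ler_pM => //; rewrite ger0_norm; last by rewrite mulr_ge0 // invr_ge0 ltW.
by apply: ler_pM => //; rewrite invr_ge0 ltW.
Qed.

(** One more arc raises [chi_1] by 1 and the higher sums by increments of squares and cubes at [d]
    and [d']. To second order the change of the exponent has the terms of [step_main], with [lam] in
    place of [p]. *)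
Lemma step_compare (d d' c1 c2 c3 : R) :
  `|d| <= J%:R -> `|d'| <= J%:R -> `|c1| <= J%:R ^+ 2 ->
  `|step_main n s J d d' c1 -
    (exponent n s J (c1 + 1) (c2 + (2 * d + 1) + (2 * d' + 1)) (c3 + (3 * d ^+ 2 + 3 * d + 1) + (3 * d' ^+ 2 + 3 * d' + 1))
     - exponent n s J c1 c2 c3)| <= L ^+ 6 * w^-1 ^+ 3.
Proof.
move=> dJ d'J cJ.
have /andP[pl1 pl2] := rg_p_lam rg; have [/andP[p0 p1] Lp Lq] := rg_p rg.
have l0 := lam_gt0 rg; have l1 := lam_lt1 rg.
have q1 : 0 < 1 - lam by lra.
have q2 : 0 < 1 - p by lra.
have pl : `|(1 - 2 * lam) - (1 - 2 * p)| <= 4 * w^-1 ^+ 2 by rewrite ler_norml; apply/andP; split; lra.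
have f1 : `|1 - 2 * lam| <= 1 by rewrite ler_norml; apply/andP; split; lra.
have f2 : `|1 - 2 * p| <= 1 by rewrite ler_norml; apply/andP; split; lra.
have L0 := rg_L0 rg; have L100 := rg_L rg; have [bL aL v0 ab] := rg_variance.
have A0 := A_gt0 rg; have u0 := rg_u0 rg; have n0 := rg_n0 rg.
have [ll1 ll2] := rg_lam rg.
have /andP[k0 k1] := rg_J_n rg.
have uE := rg_nV rg.
have S1 : 100 * (L * w^-1) <= 1 by have := rg_small rg (isT : (1 < 60)%N); rewrite expr1.
pose al := (2 * A)^-1; pose be := (p * (1 - p))^-1.
pose de := d / n%:R; pose de' := d' / n%:R; pose ka := J%:R / n%:R : R.
pose Q := c1 / n%:R ^+ 2.
have a0 : 0 < al by rewrite invr_gt0 mulr_gt0.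
have b0 : 0 < be by rewrite invr_gt0.
have iq : 0 < (1 - p)^-1 <= L.
  by rewrite invr_gt0 q2 /= -[_^-1]mul1r ler_pdivrMr.
have il : 0 < (1 - lam)^-1 <= L.
  by rewrite invr_gt0 q1 /= -[_^-1]mul1r ler_pdivrMr //; move: ll2; rewrite ler_pdivrMr //; lra.
(* Matches the pure [1 / n] terms: the contributions of [chi_1] and of the constants in the
   increments of [chi_2] combine to the [- 2 / n / (1 - p)] of [step_main]. *)
have lq : (1 - 2 * lam) * al - al = - (2 * (1 - lam)^-1).
  by rewrite /al; move: (lam) l0 l1 => y y0 y1; field; rewrite !gt_eqF //; lra.
have E : step_main n s J d d' c1 -
    (exponent n s J (c1 + 1) (c2 + (2 * d + 1) + (2 * d' + 1)) (c3 + (3 * d ^+ 2 + 3 * d + 1) + (3 * d' ^+ 2 + 3 * d' + 1))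
     - exponent n s J c1 c2 c3) =
  ((de + de') * (1 + ka) * (al - be) + Q * (al - be))
  + ((1 - 2 * lam) * al ^+ 2 * (de ^+ 2 + de' ^+ 2) / 2 - (1 - 2 * p) * be ^+ 2 * (de ^+ 2 + de' ^+ 2) * (1 + ka) ^+ 2 / 2)
  + 2 * n%:R^-1 * ((1 - lam)^-1 - (1 - p)^-1)
  + (ka * al * n%:R^-1 + al * n%:R^-1 ^+ 2 / 2 + (1 - 2 * lam) * (3 * (de + de') * n%:R^-1 + 2 * n%:R^-1 ^+ 2) * al ^+ 2 / 6).
  have E2 : exponent n s J (c1 + 1) (c2 + (2 * d + 1) + (2 * d' + 1)) (c3 + (3 * d ^+ 2 + 3 * d + 1) + (3 * d' ^+ 2 + 3 * d' + 1))
     - exponent n s J c1 c2 c3 = ((1 - 2 * lam) * al - al) * n%:R^-1 - Q * al - (de + de') * (1 + ka) * al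
       - (1 - 2 * lam) * al ^+ 2 * (de ^+ 2 + de' ^+ 2) / 2 -
    (ka * al * n%:R^-1 + al * n%:R^-1 ^+ 2 / 2 + (1 - 2 * lam) * (3 * (de + de') * n%:R^-1 + 2 * n%:R^-1 ^+ 2) * al ^+ 2 / 6).
    rewrite /exponent /al /Q /de /de' /ka.
    cbv zeta; move: (lam) (A) A0 => z y y0.
    by field; rewrite !gt_eqF.
  rewrite E2 lq /step_main /be /Q /de /de' /ka.
  move: (p) p0 q2 v0 => y y0 q0 v0; move: (al) ((1 - lam)^-1) (1 - 2 * lam) => z1 z2 z3.
  by field; rewrite !gt_eqF.
have dek : `|de| <= L * w^-1 /\ `|de'| <= L * w^-1.
  rewrite /de /de' !normrM !normfV (gtr0_norm n0).
  by split; apply: le_trans k1; rewrite ler_pM2r ?invr_gt0.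
have Qk : `|Q| <= L ^+ 2 * w^-1 ^+ 2.
  rewrite /Q normrM normfV normrX (gtr0_norm n0) -exprMn.
  apply: le_trans (_ : (J%:R / n%:R) ^+ 2 <= _).
    by rewrite exprMn exprVn ler_pM2r ?invr_gt0 ?exprn_gt0.
  by apply: lerXn2r; rewrite ?nnegrE // mulr_ge0 //; exact: ltW.
have lp : `|(1 - lam)^-1 - (1 - p)^-1| <= L ^+ 2 * (2 * w^-1 ^+ 2).
  have -> : (1 - lam)^-1 - (1 - p)^-1 = ((1 - lam)^-1 * (1 - p)^-1) * (- (p - lam)).
    by move: (lam) (p) q1 q2 => y z y0 z0; field; rewrite !gt_eqF.
  rewrite normrM; apply: ler_pM => //; last by rewrite normrN ger0_norm.
  have [/andP[i1 i2] /andP[i3 i4]] := (iq, il).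
  rewrite ger0_norm; last by apply: mulr_ge0; exact: ltW.
  by rewrite expr2; apply: ler_pM => //; exact: ltW.
rewrite E uE; clear E lq.
have u1 : w^-1 <= 1 by rewrite invf_le1 ?(rg_w0 rg) // (rg_w1 rg).
by rewrite uE in f1 pl lp; case: dek => dk dk'; apply: step_bounds.
Qed.

End Regime.

(** * Residual degrees expanded in powers of [J / n] *)

Section Regime.
Variables (R : realType) (n s J : nat) (L w : R).
Hypothesis rg : regime n s J L w.
Local Notation lam := (s%:R / n%:R : R).
Local Notation p := (s%:R / (n%:R - 1) : R).
Local Notation m := (n%:R - J%:R : R).
Local Notation u := (w^-1).

Lemma rg_J3 : J%:R ^+ 3 / n%:R ^+ 3 <= L ^+ 3 * u ^+ 3 :> R.
Proof.
have /andP[k0 k1] := rg_J_n rg.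
have -> : J%:R ^+ 3 / n%:R ^+ 3 = (J%:R / n%:R) ^+ 3 :> R by rewrite exprMn exprVn.
rewrite -exprMn; apply: lerXn2r; rewrite ?nnegrE //.
exact: le_trans k0 k1.
Qed.

(** Since [p (n - 1) = s], the residual degree [s - x] is exactly [p m - d]. The quotient is
    therefore [p - d / m], and [(n + J) / n^2] is [1 / m] up to relative order [(J / n)^2]. This is
    the origin of the factor [n + J] in the theorem. *)
Lemma degree_approx (x d : R) : d = x - p * (J%:R - 1) -> `|d| <= J%:R ->
  `|(s%:R - x) / m - (p - d * (n%:R + J%:R) / n%:R ^+ 2)| <= 2 * (L ^+ 3 * u ^+ 3).
Proof.
move=> dE dJ; have mn := rg_m rg; have n100 := rg_n_large rg; have n0 := rg_n0 rg.
have m0 : 0 < m by lra.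
have -> : (s%:R - x) / m - (p - d * (n%:R + J%:R) / n%:R ^+ 2) = - (d * J%:R ^+ 2 / (m * n%:R ^+ 2)).
  have xE : x = d + p * (J%:R - 1) by rewrite dE subrK.
  have n1 : 0 < n%:R - 1 :> R by lra.
  by rewrite xE; field; rewrite !gt_eqF.
rewrite normrN normrM normfV normrM normrX.
rewrite [`|J%:R|]ger0_norm // [`|m * _|]gtr0_norm ?mulr_gt0 ?exprn_gt0 //.
apply: le_trans (_ : J%:R * J%:R ^+ 2 / (n%:R / 2 * n%:R ^+ 2) <= _).
  apply: ler_pM; rewrite ?mulr_ge0 ?invr_ge0 ?mulr_ge0 ?exprn_ge0 //; first exact: ltW.
    by rewrite ler_wpM2r // exprn_ge0.
  rewrite lef_pV2 ?posrE ?mulr_gt0 ?exprn_gt0 ?invr_gt0 //.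
  rewrite ler_wpM2r ?exprn_ge0 //; lra.
have -> : J%:R * J%:R ^+ 2 / (n%:R / 2 * n%:R ^+ 2) = 2 * (J%:R ^+ 3 / n%:R ^+ 3) :> R by field; rewrite gt_eqF.
by rewrite ler_pM2l // rg_J3.
Qed.

Lemma inv_m_approx (q : R) : n%:R <= 2 * q -> q <= n%:R -> n%:R - q <= J%:R + 1 ->
  0 <= q^-1 - n%:R^-1 <= 2 * (L * u ^+ 3) + 2 * u ^+ 3.
Proof.
move=> q1 q2 q3; have n0 := rg_n0 rg; have u0 := rg_u0 rg; have uE := rg_nV rg.
have q0 : 0 < q by lra.
rewrite subr_ge0 lef_pV2 ?posrE // q2 /=.
have -> : q^-1 - n%:R^-1 = (n%:R - q) * (q^-1 * n%:R^-1) by field; rewrite !gt_eqF.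
have qi : q^-1 <= 2 * n%:R^-1.
  have -> : 2 * n%:R^-1 = (n%:R / 2)^-1 :> R by field; rewrite gt_eqF.
  rewrite lef_pV2 ?posrE //; lra.
apply: le_trans (_ : (J%:R + 1) * (2 * n%:R^-1 * n%:R^-1) <= _).
  apply: ler_pM => //; first by rewrite subr_ge0.
    by rewrite mulr_ge0 ?invr_ge0 // ltW.
  by rewrite ler_pM2r ?invr_gt0.
have /andP[k0 k1] := rg_J_n rg.
have -> : (J%:R + 1) * (2 * n%:R^-1 * n%:R^-1) = 2 * (J%:R / n%:R) * n%:R^-1 + 2 * n%:R^-1 * n%:R^-1 :> R by field; rewrite gt_eqF.
rewrite uE; have u1 : u <= 1 by rewrite invf_le1 ?(rg_w0 rg) // (rg_w1 rg).
have a1 : J%:R / n%:R * u ^+ 2 <= L * u * u ^+ 2 by rewrite ler_wpM2r // exprn_ge0 // ltW.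
have a2 : u ^+ 2 * u ^+ 2 <= u ^+ 3.
  have -> : u ^+ 2 * u ^+ 2 = u ^+ 3 * u by ring.
  by rewrite ler_piMr // exprn_ge0 // ltW.
have -> : 2 * (L * u ^+ 3) = 2 * (L * u * u ^+ 2) by ring.
rewrite uE in a1; lra.
Qed.

(** By [p (n - 1) = s] again, the quotient is exactly [p + (c1 + 1) / (m (m - 1))]. The 1 in [X + 1]
    is the arc being added. *)
Lemma total_approx (X c1 : R) : c1 = X - p * (J%:R * (J%:R - 1)) -> `|c1| <= J%:R ^+ 2 -> (0 < J)%N ->
  `|(s%:R - (J%:R * s%:R - (X + 1)) / m) / (m - 1) - (p + c1 / n%:R ^+ 2)| <= 12 * (L ^+ 3 * u ^+ 3) + 4 * u ^+ 3.
Proof.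
move=> cE cJ J0; have mn := rg_m rg; have n100 := rg_n_large rg; have n0 := rg_n0 rg.
have m0 : 0 < m by lra. have m1 : 0 < m - 1 by lra.
have J1 : 1 <= J%:R :> R by rewrite ler1n.
have u0 := rg_u0 rg.
have -> : (s%:R - (J%:R * s%:R - (X + 1)) / m) / (m - 1) - (p + c1 / n%:R ^+ 2) =
  c1 * ((J%:R * (n%:R + m) + m) / (m * (m - 1) * n%:R ^+ 2)) + (m * (m - 1))^-1.
  have XE : X = c1 + p * (J%:R * (J%:R - 1)) by rewrite cE subrK.
  have n1 : 0 < n%:R - 1 :> R by lra.
  by rewrite XE; field; rewrite !gt_eqF.
have mm : n%:R ^+ 2 / 4 <= m * (m - 1).
  have -> : n%:R ^+ 2 / 4 = (n%:R / 2) * (n%:R / 2) :> R by field.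
  by apply: ler_pM; lra.
have mmi : (m * (m - 1))^-1 <= 4 / n%:R ^+ 2.
  have -> : 4 / n%:R ^+ 2 = (n%:R ^+ 2 / 4)^-1 :> R by field; rewrite gt_eqF.
  rewrite lef_pV2 ?posrE ?mulr_gt0 ?exprn_gt0 ?invr_gt0 //.
have mmi0 : 0 <= (m * (m - 1))^-1 by rewrite invr_ge0 mulr_ge0 // ltW.
apply: le_trans (ler_normD _ _) _; apply: lerD; last first.
  rewrite ger0_norm //; apply: le_trans mmi _.
  have -> : 4 / n%:R ^+ 2 = 4 * (n%:R^-1 * n%:R^-1) :> R by field; rewrite gt_eqF.
  rewrite (rg_nV rg) ler_pM2l //.
  have -> : u ^+ 2 * u ^+ 2 = u ^+ 3 * u by ring.
  have u1 : u <= 1 by rewrite invf_le1 ?(rg_w0 rg) // (rg_w1 rg).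
  by rewrite ler_piMr // exprn_ge0 // ltW.
have J00 : 0 <= J%:R :> R by [].
have num : 0 <= J%:R * (n%:R + m) + m <= 3 * J%:R * n%:R.
  have Jm : 0 <= J%:R * m by rewrite mulr_ge0 // ltW.
  have Jn : n%:R <= J%:R * n%:R :> R by rewrite ler_peMl // ltW.
  have JJ : 0 <= J%:R * J%:R :> R by rewrite mulr_ge0.
  by apply/andP; split; lra.
case/andP: num => num0 num1.
rewrite normrM [X in _ * X]ger0_norm; last by rewrite divr_ge0 // !mulr_ge0 ?exprn_ge0 //; exact: ltW.
apply: le_trans (_ : J%:R ^+ 2 * (3 * J%:R * n%:R * (4 / n%:R ^+ 2 * (n%:R ^+ 2)^-1)) <= _).
  apply: ler_pM => //; first by rewrite divr_ge0 // !mulr_ge0 ?exprn_ge0 //; exact: ltW.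
  have e0 : 0 <= (n%:R ^+ 2)^-1 :> R by rewrite invr_ge0 exprn_ge0.
  rewrite invfM; apply: ler_pM => //; first by rewrite mulr_ge0.
  by rewrite ler_wpM2r.
have -> : J%:R ^+ 2 * (3 * J%:R * n%:R * (4 / n%:R ^+ 2 * (n%:R ^+ 2)^-1)) = 12 * (J%:R ^+ 3 / n%:R ^+ 3) :> R.
  by field; rewrite gt_eqF.
by rewrite ler_pM2l // rg_J3.
Qed.

End Regime.

(** * Digraphs on the block *)

Definition block n (J : nat) : digraph n :=
  [set e : 'I_n * 'I_n | [&& (e.1 < J)%N, (e.2 < J)%N & e.1 != e.2]].

(** The truncated subtraction is exact for [H] inside the block, because [J < s] by [rg_Js]. *)
Definition extensions n (s J : nat) (H : digraph n) : {set digraph n} :=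
  completions J (fun v => s - outdeg H v)%N (fun v => s - indeg H v)%N.

Definition block_exponent (R : realType) n (s J : nat) (H : digraph n) : R :=
  let p := s%:R / (n%:R - 1) in
  exponent n s J (chi H J p 1) (chi H J p 2 + chi' H J p 2) (chi H J p 3 + chi' H J p 3).

Section Degrees.
Variables n J : nat.
Implicit Types (H : digraph n) (v k : 'I_n).

Lemma outdegU1 H (j k v : 'I_n) : (j, k) \notin H ->
  outdeg ((j, k) |: H) v = (outdeg H v + (v == j))%N.
Proof.
by move=> jkH; rewrite (@outdegD1 _ _ j k v) ?finset.setU1K // !inE eqxx.
Qed.

Lemma indegU1 H (j k v : 'I_n) : (j, k) \notin H ->
  indeg ((j, k) |: H) v = (indeg H v + (v == k))%N.
Proof.
by move=> jkH; rewrite (@indegD1 _ _ j k v) ?finset.setU1K // !inE eqxx.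
Qed.

Lemma indeg_transpose H v : indeg H v = outdeg (transpose H) v.
Proof. by rewrite indegE outdegE; apply: eq_bigr => k _; rewrite inE. Qed.

Lemma transpose_block H : (transpose H \subset block n J) = (H \subset block n J).
Proof.
suff P H0 : H0 \subset block n J -> transpose H0 \subset block n J.
  by apply/idP/idP => [/P|/P //]; rewrite transposeK.
move=> /fintype.subsetP HB; apply/fintype.subsetP => -[a b]; rewrite inE /= => /HB.
by rewrite !inE /= eq_sym => /and3P[-> -> ->].
Qed.

Lemma sum_ltn_ord_le : (\sum_(k < n) (k < J) <= J)%N.
Proof.
have -> : (\sum_(k < n) (k < J) = #|[pred k : 'I_n | (k < J)%N]|)%N.
  by rewrite -sum1_card [RHS]big_mkcond; apply: eq_bigr => k _; rewrite inE; case: (k < J)%N.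
rewrite -[X in (_ <= X)%N]addn0.
apply: leq_trans (_ : #|predC (outside J ([::] : seq 'I_n))| <= _)%N.
  by apply: subset_leq_card; apply/fintype.subsetP => k; rewrite !inE /outside /= ltnNge => /negbTE ->.
exact: (card_predC_outside J ([::] : seq 'I_n)).
Qed.

(** One inequality serves two cases: the bound is [J - 1] at a vertex of the block, where the loop
    is excluded, and 0 at any other vertex. *)
Lemma outdeg_block H v : H \subset block n J -> (outdeg H v + (v < J) <= (v < J) * J)%N.
Proof.
move=> /fintype.subsetP HB; have [vJ|Jv] := ltnP v J; last first.
  rewrite addn0 mul0n leqn0 outdegE; apply/eqP/big1 => k _.
  case: (boolP (_ \in _)) => // /HB; rewrite inE /= ltnNge Jv //.
rewrite mul1n; apply: leq_trans sum_ltn_ord_le; rewrite outdegE.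
rewrite (bigD1 v) //= [X in (_ <= X)%N](bigD1 v) //= vJ addn1 -[(_ + _).+1]addSn.
apply: leq_add.
  by case: (boolP (_ \in _)) => // /HB; rewrite inE /= eqxx !andbF.
by apply: leq_sum => k _; case: (boolP (_ \in _)) => // /HB; rewrite inE /= => /and3P[_ -> _].
Qed.

Lemma indeg_block H v : H \subset block n J -> (indeg H v + (v < J) <= (v < J) * J)%N.
Proof. by rewrite indeg_transpose -transpose_block; exact: outdeg_block. Qed.

Lemma card_sum_outdeg H : H \subset block n J -> #|H| = (\sum_(v < n | (v < J)%N) outdeg H v)%N.
Proof.
move=> HB.
transitivity (\sum_v outdeg H v)%N; last first.
  rewrite (bigID (fun v : 'I_n => (v < J)%N)) /= [X in (_ + X)%N]big1 ?addn0 // => v vJ.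
  by have := outdeg_block v HB; rewrite (negbTE vJ) addn0 mul0n leqn0 => /eqP.
under eq_bigr => v _ do rewrite outdegE.
rewrite pair_bigA /= -sum1_card big_mkcond /=; apply: eq_bigr => -[a b] _ /=.
by case: (_ \in H).
Qed.

Lemma card_transpose H : #|transpose H| = #|H|.
Proof.
have -> : transpose H = [set (e.2, e.1) | e in H].
  apply/setP => -[a b]; rewrite inE /=; apply/idP/imsetP.
    by move=> abH; exists (b, a).
  by move=> [[c d] cdH [-> ->]].
by rewrite card_imset // => -[a b] [c d] [-> ->].
Qed.

Lemma card_sum_indeg H : H \subset block n J -> #|H| = (\sum_(v < n | (v < J)%N) indeg H v)%N.
Proof.
rewrite -transpose_block -card_transpose => /card_sum_outdeg ->.
by apply: eq_bigr => v _; rewrite indeg_transpose.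
Qed.

End Degrees.

Section Regime.
Variables (R : realType) (n s J : nat) (L w : R).
Hypothesis rg : regime n s J L w.
Local Notation lam := (s%:R / n%:R : R).
Local Notation p := (s%:R / (n%:R - 1) : R).
Local Notation m := (n%:R - J%:R : R).
Local Notation u := (w^-1).
Implicit Types (H : digraph n) (v k : 'I_n).

Lemma rg_Js : (J < s)%N.
Proof.
rewrite -(ltr_nat R) (sE rg); have [l2 _] := rg_lam rg; have n0 := rg_n0 rg.
have w0 := rg_w0 rg; have L0 := rg_L0 rg; have w2 := rg_w2 rg.
apply: lt_le_trans (_ : 2 / L * n%:R <= _); last by rewrite ler_pM2r.
apply: le_lt_trans (rg_J rg) _; rewrite -w2 mulrAC ltr_pdivlMr //.
have := rg_L100 rg (isT : (2 < 60)%N); rewrite expr2 => LL.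
have : w * (100 * (L * L)) <= w * w by rewrite ler_pM2l.
have : 0 < w * (L * L) by rewrite !mulr_gt0.
rewrite expr2; lra.
Qed.

Lemma card_ltn_ord : #|[pred k : 'I_n | (k < J)%N]|%:R = J%:R :> R.
Proof.
have := cardC [pred k : 'I_n | (J <= k)%N]; rewrite card_ord => /(congr1 (fun q => q%:R : R)).
rewrite natrD (card_geq rg).
have -> : #|[predC [pred k : 'I_n | (J <= k)%N]]| = #|[pred k : 'I_n | (k < J)%N]|.
  by apply: eq_card => k; rewrite !inE -ltnNge.
lra.
Qed.

Lemma sum_const_block (a : R) : \sum_(v < n | (v < J)%N) a = J%:R * a.
Proof. by rewrite -card_ltn_ord sumr_const mulr_natl. Qed.

Lemma chi_transpose H q : chi' H J p q = chi (transpose H) J p q.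
Proof. by apply: eq_bigr => v _; rewrite indeg_transpose. Qed.

Lemma chi1E H : H \subset block n J -> chi H J p 1 = #|H|%:R - p * (J%:R * (J%:R - 1)).
Proof.
move=> HB; rewrite /chi; under eq_bigr do rewrite expr1.
by rewrite sumrB -natr_sum -(card_sum_outdeg HB) sum_const_block; ring.
Qed.

Lemma chiU1 H (j k : 'I_n) q : (j < J)%N -> (j, k) \notin H ->
  let d := (outdeg H j)%:R - p * (J%:R - 1) in
  chi ((j, k) |: H) J p q = chi H J p q + ((d + 1) ^+ q - d ^+ q).
Proof.
move=> jJ jkH d; rewrite /chi (bigD1 j) //= [in RHS](bigD1 j) //=.
rewrite outdegU1 // eqxx natrD addrAC -/d.
rewrite (eq_bigr (fun v => ((outdeg H v)%:R - p * (J%:R - 1)) ^+ q)); first ring.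
by move=> v /andP[_ vj]; rewrite outdegU1 // (negbTE vj) addn0.
Qed.

Lemma transposeU1 H (j k : 'I_n) : transpose ((j, k) |: H) = (k, j) |: transpose H.
Proof. by apply/setP => -[a b]; rewrite !inE !xpair_eqE andbC. Qed.

Lemma chi'U1 H (j k : 'I_n) q : (k < J)%N -> (j, k) \notin H ->
  let d := (indeg H k)%:R - p * (J%:R - 1) in
  chi' ((j, k) |: H) J p q = chi' H J p q + ((d + 1) ^+ q - d ^+ q).
Proof.
move=> kJ jkH d; rewrite !chi_transpose transposeU1 chiU1 // ?mem_transpose //.
by rewrite /d indeg_transpose.
Qed.

Lemma degree_dev (x : nat) : (x + 1 <= J)%N -> `|x%:R - p * (J%:R - 1)| <= J%:R.
Proof.
move=> xJ; have [/andP[p0 p1] _ _] := rg_p rg.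
have J1 : 1 <= J%:R :> R by rewrite ler1n; lia.
have xJ' : x%:R + 1 <= J%:R :> R by rewrite natr1 ler_nat -addn1.
have x0 : 0 <= x%:R :> R by [].
have pJ : 0 <= p * (J%:R - 1) <= J%:R - 1.
  apply/andP; split; first by rewrite mulr_ge0 //; lra.
  by rewrite ler_piMl //; lra.
by case/andP: pJ => ? ?; rewrite ler_norml; apply/andP; split; lra.
Qed.

Lemma chi1_bound H : H \subset block n J -> `|chi H J p 1| <= J%:R ^+ 2.
Proof.
move=> HB; rewrite /chi; apply: le_trans (ler_norm_sum _ _ _) _.
apply: le_trans (_ : \sum_(v < n | (v < J)%N) J%:R <= _).
  apply: ler_sum => v vJ; rewrite expr1; apply: degree_dev.
  by have := outdeg_block v HB; rewrite vJ mul1n.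
by rewrite sum_const_block expr2.
Qed.

Lemma exists_outside : exists i l : 'I_n, [/\ (J <= i)%N, (J <= l)%N & i != l].
Proof.
have mn := rg_m rg; have n100 := rg_n_large rg.
have Jn : (J.+1 < n)%N by rewrite -(ltr_nat R) -natr1; lra.
have Jn1 : (J < n)%N by apply: ltn_trans Jn.
exists (Ordinal Jn1), (Ordinal Jn); split=> //=.
by rewrite -val_eqE /= neq_ltn ltnSn.
Qed.

Lemma shift_ge0 : 0 <= 2 * (L * u ^+ 3) + 2 * u ^+ 3.
Proof.
have u3 : 0 <= u ^+ 3 by rewrite exprn_ge0 // ltW // (rg_u0 rg).
have L0 := ltW (rg_L0 rg); have u0 := ltW (rg_u0 rg).
by rewrite addr_ge0 // !mulr_ge0.
Qed.

Lemma inv_out : 0 <= m^-1 - n%:R^-1 <= 2 * (L * u ^+ 3) + 2 * u ^+ 3.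
Proof.
have mn := rg_m rg; have Jr : 0 <= J%:R :> R by [].
by apply: (inv_m_approx rg); lra.
Qed.

Lemma inv_out_pred : 0 <= (m - 1)^-1 - n%:R^-1 <= 2 * (L * u ^+ 3) + 2 * u ^+ 3.
Proof.
have mn := rg_m rg; have n100 := rg_n_large rg; have Jr : 0 <= J%:R :> R by [].
by apply: (inv_m_approx rg); lra.
Qed.

(** As [L] is at least 100, one spare power of [L] absorbs a factor of 100. *)
Lemma power_gap (q k : nat) : (q < k)%N -> 100 * L ^+ q <= L ^+ k.
Proof.
have L1 := rg_L1 rg; have L100 := rg_L rg; have L0 := rg_L0 rg.
move=> qk; apply: le_trans (_ : L ^+ q.+1 <= _); last by rewrite ler_weXn2l.
by rewrite exprS ler_wpM2r // exprn_ge0 // ltW.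
Qed.

Lemma step_budget : L ^+ 7 * u ^+ 3 + (12 * (L ^+ 3 * u ^+ 3) + 4 * u ^+ 3) + (2 * (L * u ^+ 3) + 2 * u ^+ 3) <= L ^+ 8 * u ^+ 3.
Proof.
have -> : L ^+ 7 * u ^+ 3 + (12 * (L ^+ 3 * u ^+ 3) + 4 * u ^+ 3) + (2 * (L * u ^+ 3) + 2 * u ^+ 3) =
  (L ^+ 7 + 12 * L ^+ 3 + 6 + 2 * L) * u ^+ 3 by ring.
rewrite ler_wpM2r ?exprn_ge0 //; first by rewrite ltW // (rg_u0 rg).
have p7 := power_gap (isT : (7 < 8)%N); have p3 := power_gap (isT : (3 < 7)%N).
have p1 := power_gap (isT : (1 < 3)%N); rewrite expr1 in p1; have p0 := rg_L rg.
lra.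
Qed.

Lemma step_widen (y : R) : y <= 2 * (L ^+ 3 * u ^+ 3) -> y <= 12 * (L ^+ 3 * u ^+ 3) + 4 * u ^+ 3.
Proof.
have u3 : 0 <= u ^+ 3 by rewrite exprn_ge0 // ltW // (rg_u0 rg).
have L3u3 : 0 <= L ^+ 3 * u ^+ 3 by rewrite mulr_ge0 // exprn_ge0 // ltW // (rg_L0 rg).
lra.
Qed.

(** [t] is the gap between the [1 / m] or [1 / (m - 1)] due to a removed arc and the [1 / n] written
    in the expansion. *)
Lemma step_combine (a b g t : R) : `|a - b| <= L ^+ 7 * u ^+ 3 -> `|b + t - g| <= 12 * (L ^+ 3 * u ^+ 3) + 4 * u ^+ 3 ->
  0 <= t <= 2 * (L * u ^+ 3) + 2 * u ^+ 3 -> `|a - g| <= L ^+ 8 * u ^+ 3.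
Proof.
move=> h1 h2 /andP[t0 t1]; apply: le_trans step_budget.
have -> : a - g = (a - b) + (b + t - g) - t by ring.
apply: le_trans (ler_normB _ _) _; rewrite (ger0_norm t0); apply: lerD => //.
by apply: le_trans (ler_normD _ _) _; apply: lerD.
Qed.

Lemma shift0 : 0 <= (0 : R) <= 2 * (L * u ^+ 3) + 2 * u ^+ 3.
Proof. by rewrite lexx shift_ge0. Qed.

(** The degrees left by [H'] serve as [r] and [c], so that [H] leaves one more at [j] and one more
    at [k]. The auxiliary [i] and [l] are any two distinct vertices outside the block. *)
Lemma arc_step H (j k : 'I_n) : (j, k) |: H \subset block n J -> (j, k) \notin H ->
  (extensions s J H != finset.set0) = (extensions s J ((j, k) |: H) != finset.set0) /\
  (extensions s J H != finset.set0 ->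
   `|ln (#|extensions s J ((j, k) |: H)|%:R) - ln (#|extensions s J H|%:R) - ln (p / (1 - p))
     - (block_exponent R s J ((j, k) |: H) - block_exponent R s J H)| <= L ^+ 11 * u ^+ 3).
Proof.
move=> H'B jkH; set H' := (j, k) |: H.
have H'B' : H' \subset block n J := H'B.
have HB : H \subset block n J by apply: fintype.subset_trans H'B; exact: finset.subsetUr.
have /and3P[jJ kJ jk] : [&& (j < J)%N, (k < J)%N & j != k].
  by have := fintype.subsetP H'B (j, k); rewrite !inE eqxx => /(_ isT).
have [i [l [Ji Jl il]]] := exists_outside.
pose r v := (s - outdeg H' v)%N; pose c v := (s - indeg H' v)%N.
have Js := rg_Js.
have oH' v : (outdeg H' v <= J)%N.
  by apply: leq_trans (leq_addr _ _) (leq_trans (outdeg_block v H'B) _); case: ltnP; rewrite ?mul1n.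
have iH' v : (indeg H' v <= J)%N.
  by apply: leq_trans (leq_addr _ _) (leq_trans (indeg_block v H'B) _); case: ltnP; rewrite ?mul1n.
have oU v : outdeg H' v = (outdeg H v + (v == j))%N by apply: outdegU1.
have iU v : indeg H' v = (indeg H v + (v == k))%N by apply: indegU1.
have r_le v : (r v <= s)%N by exact: leq_subr.
have c_le v : (c v <= s)%N by exact: leq_subr.
have r_out v : (J <= v)%N -> r v = s.
  move=> Jv; have := outdeg_block v H'B; rewrite ltnNge Jv /= addn0 mul0n leqn0 => /eqP E.
  by rewrite /r E subn0.
have c_out v : (J <= v)%N -> c v = s.
  move=> Jv; have := indeg_block v H'B; rewrite ltnNge Jv /= addn0 mul0n leqn0 => /eqP E.
  by rewrite /c E subn0.
have r_in v : (v < J)%N -> (s <= r v + J)%N by rewrite /r; have := oH' v; lia.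
have c_in v : (v < J)%N -> (s <= c v + J)%N by rewrite /c; have := iH' v; lia.
have rj : (r j < s)%N by rewrite /r oU eqxx; lia.
have ck : (c k < s)%N by rewrite /c iU eqxx; lia.
have re : (r j + 1 + outdeg H j = s)%N.
  by rewrite /r; have := oH' j; rewrite oU eqxx addn1; lia.
have ce : (c k + 1 + indeg H k = s)%N.
  by rewrite /c; have := iH' k; rewrite iU eqxx addn1; lia.
have E0 : extensions s J H = completions J (fun v => r v + (v == j))%N (fun v => c v + (v == k))%N.
  apply/setP => M; rewrite !inE; congr (_ && _); apply: eq_forallb => v.
  have -> : (r v + (v == j) = s - outdeg H v)%N.
    by rewrite /r; have := oH' v; rewrite oU; case: (v == j) => /=; lia.
  have -> : (c v + (v == k) = s - indeg H v)%N.
    by rewrite /c; have := iH' v; rewrite iU; case: (v == k) => /=; lia.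
  by [].
have S3E : extensions s J H' = completions J r c by [].
rewrite E0 S3E (step_neq0 rg r_le c_le r_out c_out r_in c_in jJ kJ Ji Jl il rj ck); split=> // S3n.
have S0n := S3n; rewrite -(step_neq0 rg r_le c_le r_out c_out r_in c_in jJ kJ Ji Jl il rj ck) in S0n.
have [a1 [a2 [a3 [a4 [a5 [a6 [[h1 h2 h3 h4] [h5 h6 hN]]]]]]]] :=
  step_ratio rg r_le c_le r_out c_out r_in c_in jJ kJ Ji Jl il rj ck S3n.
set x : R := (outdeg H j)%:R; set y : R := (indeg H k)%:R.
pose d := x - p * (J%:R - 1); pose d' := y - p * (J%:R - 1).
have dJ : `|d| <= J%:R.
  by apply: degree_dev; have := oH' j; rewrite oU eqxx.
have d'J : `|d'| <= J%:R.
  by apply: degree_dev; have := iH' k; rewrite iU eqxx.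
have rE : (r j)%:R = s%:R - x - 1 :> R by rewrite -re !natrD -/x; ring.
have cE : (c k)%:R = s%:R - y - 1 :> R by rewrite -ce !natrD -/y; ring.
have BE : \sum_(v < n | (v < J)%N) (c v)%:R = J%:R * s%:R - (#|H|%:R + 1) :> R.
  rewrite (eq_bigr (fun v => s%:R - (indeg H' v)%:R)); last first.
    by move=> v _; rewrite natrB //; apply: leq_trans (iH' v) (ltnW Js).
  rewrite sumrB sum_const_block -natr_sum -(card_sum_indeg H'B').
  by rewrite cardsU1 jkH natrD [1 + _]addrC.
have J0 : (0 < J)%N by apply: leq_ltn_trans jJ.
have cB := chi1_bound HB.
have T := total_approx rg (chi1E HB) cB J0.
have D1 := degree_approx rg (erefl d) dJ; have D2 := degree_approx rg (erefl d') d'J.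
have delE : L ^+ 7 / w ^+ 3 = L ^+ 7 * u ^+ 3 by rewrite exprVn.
rewrite !delE in h1 h2 h3 h4 h5 h6.
have D1' : `|(s%:R - x) / m - (p - d * (n%:R + J%:R) / n%:R ^+ 2)| <= 12 * (L ^+ 3 * u ^+ 3) + 4 * u ^+ 3.
  exact: step_widen.
have D2' : `|(s%:R - y) / m - (p - d' * (n%:R + J%:R) / n%:R ^+ 2)| <= 12 * (L ^+ 3 * u ^+ 3) + 4 * u ^+ 3.
  exact: step_widen.
have g1 : `|a1 - (p - d * (n%:R + J%:R) / n%:R ^+ 2)| <= L ^+ 8 * u ^+ 3.
  apply: step_combine h1 _ shift0 => //; rewrite rE addr0.
  by have -> : s%:R - x - 1 + 1 = s%:R - x by ring.
have g3 : `|a3 - (p - d' * (n%:R + J%:R) / n%:R ^+ 2)| <= L ^+ 8 * u ^+ 3.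
  apply: step_combine h3 _ shift0 => //; rewrite cE addr0.
  by have -> : s%:R - y - 1 + 1 = s%:R - y by ring.
have g2 : `|a2 - (p - d * (n%:R + J%:R) / n%:R ^+ 2 - 2 / n%:R)| <= L ^+ 8 * u ^+ 3.
  apply: (step_combine (t := m^-1 - n%:R^-1) h2) _ inv_out.
  by rewrite rE; move: D1'; congr (`|_| <= _); ring.
have g4 : `|a4 - (p - d' * (n%:R + J%:R) / n%:R ^+ 2 - 2 / n%:R)| <= L ^+ 8 * u ^+ 3.
  apply: (step_combine (t := m^-1 - n%:R^-1) h4) _ inv_out.
  by rewrite cE; move: D2'; congr (`|_| <= _); ring.
rewrite BE in h5 h6.
have g6 : `|a6 - (p + chi H J p 1 / n%:R ^+ 2)| <= L ^+ 8 * u ^+ 3.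
  by apply: step_combine h6 _ shift0 => //; rewrite addr0.
have g5 : `|a5 - (p + chi H J p 1 / n%:R ^+ 2 - 2 / n%:R)| <= L ^+ 8 * u ^+ 3.
  apply: (step_combine (t := (m - 1)^-1 - n%:R^-1) h5) _ inv_out_pred.
  by move: T; congr (`|_| <= _); ring.
have [[b1 b2 b3 b4 [b5 b6]] SL] := step_log rg dJ d'J cB g1 g2 g3 g4 g5 g6.
have SC := step_compare rg (chi H J p 2 + chi' H J p 2) (chi H J p 3 + chi' H J p 3) dJ d'J cB.
have XE : block_exponent R s J H' - block_exponent R s J H =
  exponent n s J (chi H J p 1 + 1) (chi H J p 2 + chi' H J p 2 + (2 * d + 1) + (2 * d' + 1))
     (chi H J p 3 + chi' H J p 3 + (3 * d ^+ 2 + 3 * d + 1) + (3 * d' ^+ 2 + 3 * d' + 1))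
  - exponent n s J (chi H J p 1) (chi H J p 2 + chi' H J p 2) (chi H J p 3 + chi' H J p 3).
  rewrite /block_exponent /H' !(chiU1 _ jJ jkH) !(chi'U1 _ kJ jkH) -/x -/y -/d -/d'.
  by congr (exponent _ _ _ _ _ _ - _); ring.
rewrite XE.
have N0 : 0 < #|completions J (fun v => r v + (v == j))%N (fun v => c v + (v == k))%N|%:R :> R.
  by rewrite ltr0n card_gt0.
have N3 : 0 < #|completions J r c|%:R :> R by rewrite ltr0n card_gt0.
move: N0 N3 hN; move: #|completions J r c|%:R => N3; move: #|_|%:R => N0 N00 N30 hN.
have P : 0 < (1 - a2) * (1 - a4) * a6 by rewrite !mulr_gt0.
have E : ln N3 - ln N0 = ln (a1 * a3 * (1 - a5) / ((1 - a2) * (1 - a4) * a6)).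
  rewrite -ln_div ?posrE //; congr (ln _); apply/eqP.
  rewrite (eqr_div _ _ (lt0r_neq0 N00) (lt0r_neq0 P)).
  by rewrite hN mulrC.
rewrite E; set lnr := ln (a1 * _ * _ / _) in SL *; set lnp := ln (p / _) in SL *.
set mn1 := step_main _ _ _ _ _ _ in SL SC; set X := exponent _ _ _ _ _ _ - _ in SC *.
have -> : lnr - lnp - X = (lnr - lnp - mn1) + (mn1 - X) by ring.
apply: le_trans (ler_normD _ _) _; apply: le_trans (lerD SL SC) _.
have -> : 6 * (L ^+ 10 * u ^+ 3) + L ^+ 6 * u ^+ 3 = (6 * L ^+ 10 + L ^+ 6) * u ^+ 3 by ring.
rewrite ler_wpM2r //; first by rewrite exprn_ge0 // ltW // (rg_u0 rg).
apply: le_trans (power_gap (isT : (10 < 11)%N)).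
have -> : 100 * L ^+ 10 = 6 * L ^+ 10 + 94 * L ^+ 10 by ring.
rewrite lerD2l; have L0 := rg_L0 rg; have p6 := power_gap (isT : (6 < 10)%N).
by apply: le_trans (le_trans p6 _); rewrite ler_peMl // ?exprn_ge0 // ?ler1n // ltW.
Qed.

End Regime.

Section Path.
Variables (R : realType) (n s J : nat) (L w : R).
Hypothesis rg : regime n s J L w.
Local Notation p := (s%:R / (n%:R - 1) : R).
Local Notation u := (w^-1).
Implicit Types (H : digraph n).

(** [arc_step] telescopes along any order of the arcs of [H], starting from the empty digraph.
    Non-emptiness spreads as well: either every digraph on the block extends or none does. *)
Lemma extensions_path H : H \subset block n J ->
  (extensions s J (finset.set0 : digraph n) != finset.set0) = (extensions s J H != finset.set0) /\
  (extensions s J (finset.set0 : digraph n) != finset.set0 ->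
   `|ln (#|extensions s J H|%:R) - ln (#|extensions s J (finset.set0 : digraph n)|%:R) - #|H|%:R * ln (p / (1 - p))
     - (block_exponent R s J H - block_exponent R s J (finset.set0 : digraph n))| <= #|H|%:R * (L ^+ 11 * u ^+ 3)).
Proof.
elim: {H}_.+1 {-2}H (ltnSn #|H|) => // q IH H Hq HB.
have [->|/set0Pn[[j k] jkH]] := eqVneq H finset.set0.
  by rewrite cards0 !mul0r !subrr normr0.
pose H1 := H :\ (j, k).
have jkH1 : (j, k) \notin H1 by rewrite !inE eqxx.
have HE : H = (j, k) |: H1 by rewrite finset.setD1K.
have cH : #|H| = #|H1|.+1 by rewrite HE cardsU1 jkH1.
have H1B : H1 \subset block n J by apply: fintype.subset_trans HB; rewrite HE finset.subsetUr.
have H1q : (#|H1| < q)%N by rewrite -ltnS -cH.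
have [e1 b1] := IH _ H1q H1B.
have HB' : (j, k) |: H1 \subset block n J by rewrite -HE.
have [e2 b2] := arc_step rg HB' jkH1.
rewrite -HE in e2 b2; split; first by rewrite e1 e2.
move=> S0; have {}b1 := b1 S0; rewrite e1 in S0; have {}b2 := b2 S0.
rewrite cH -natr1 !mulrDl !mul1r.
have key (a0 a1 a2 t e d y0 y1 y2 : R) : `|a1 - a0 - d * t - (y1 - y0)| <= d * e ->
    `|a2 - a1 - t - (y2 - y1)| <= e -> `|a2 - a0 - (d * t + t) - (y2 - y0)| <= d * e + e.
  move=> h1 h2.
  have -> : a2 - a0 - (d * t + t) - (y2 - y0) = (a1 - a0 - d * t - (y1 - y0)) + (a2 - a1 - t - (y2 - y1)) by ring.
  by apply: le_trans (ler_normD _ _) _; apply: lerD.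
exact: key b1 b2.
Qed.

End Path.

(** * Regular digraphs and their induced subdigraphs *)

Section Count.
Variables (n s J : nat).
Implicit Types (G H M : digraph n).

Lemma induced_block G : loopless G -> Defs.induced G J \subset block n J.
Proof.
move=> /forall_inP lG; apply/fintype.subsetP => e; rewrite !inE => /andP[eG /andP[-> ->]] /=.
exact: lG.
Qed.

Lemma outdeg_disjoint M H v : [disjoint M & H] -> outdeg (M :|: H) v = (outdeg M v + outdeg H v)%N.
Proof.
move=> MH; rewrite !outdegE -big_split /=; apply: eq_bigr => k _; rewrite inE.
by case: (boolP (_ \in M)) => // vkM; rewrite (disjointFr MH vkM).
Qed.

Lemma indeg_disjoint M H v : [disjoint M & H] -> indeg (M :|: H) v = (indeg M v + indeg H v)%N.
Proof.
move=> MH; rewrite !indegE -big_split /=; apply: eq_bigr => k _; rewrite inE.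
by case: (boolP (_ \in M)) => // vkM; rewrite (disjointFr MH vkM).
Qed.

(** The bijection sends [M] to [M :|: H], with inverse [G :\: H]. *)
Lemma card_induced H : H \subset block n J ->
  (forall v, outdeg H v <= s)%N -> (forall v, indeg H v <= s)%N ->
  #|[set G in Dreg n s | Defs.induced G J == H]| = #|extensions s J H|.
Proof.
move=> HB os is_; have /fintype.subsetP HB' := HB.
have dis M : M \in extensions s J H -> [disjoint M & H].
  move=> /completionsP[Mf _ _]; rewrite -setI_eq0; apply/eqP/setP => e; rewrite !inE.
  apply/negP => /andP[/Mf + /HB']; rewrite /free_cell !inE => /andP[_ +] /and3P[eJ eJ' _].
  by rewrite eJ eJ'.
have inj : {in extensions s J H &, injective (fun M => M :|: H)}.
  move=> M M' /dis MH /dis M'H E; apply/setP => e.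
  have := congr1 (fun T : digraph n => e \in T) E; rewrite !inE.
  by case: (boolP (e \in H)) => eH; rewrite ?orbF // (disjointFl MH eH) (disjointFl M'H eH).
rewrite -(card_in_imset inj); apply: eq_card => G; rewrite [LHS]inE; apply/andP/imsetP.
  move=> [GD /eqP GH]; move: GD; rewrite inE => /andP[/forall_inP lG /forallP dG].
  have GHs e : e \in H -> e \in G by rewrite -GH inE => /andP[].
  have GE : G = (G :\: H) :|: H.
    by apply/setP => e; rewrite !inE; case: (boolP (e \in H)) => [/GHs ->|]; rewrite ?orbT ?orbF.
  have dGH : [disjoint G :\: H & H].
    by rewrite -setI_eq0; apply/eqP/setP => e; rewrite !inE; case: (e \in H); rewrite ?andbF.
  exists (G :\: H) => //; apply/completionsP; split=> [e|v|v].
  - rewrite !inE => /andP[eH eG]; rewrite /free_cell lG //=.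
    apply/negP => eJ; move: eH; rewrite -GH !inE eG eJ //.
  - have /andP[/eqP <- _] := dG v; rewrite [in RHS]GE outdeg_disjoint // addnK //.
  - have /andP[_ /eqP <-] := dG v; rewrite [in RHS]GE indeg_disjoint // addnK //.
move=> [M ME ->]; have MH := dis M ME; case/completionsP: ME => Mf oM iM; split.
  rewrite inE; apply/andP; split.
    apply/forall_inP => e; rewrite inE => /orP[/Mf/andP[] //|/HB']; rewrite inE => /and3P[_ _ //].
  by apply/forallP => v; rewrite outdeg_disjoint // indeg_disjoint // oM iM !subnK ?eqxx.
apply/eqP/setP => e; rewrite !inE; case: (boolP (e \in H)) => eH.
  by rewrite orbT /=; have := HB' e eH; rewrite inE => /and3P[-> -> _].
rewrite orbF; apply/negP => /andP[/Mf]; rewrite /free_cell => /andP[_ /negbTE ->] //.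
Qed.

(** With an empty block, the estimates for completions apply to the regular digraphs themselves. *)
Lemma Dreg_completions : Dreg n s = completions 0 (fun=> s) (fun=> s).
Proof.
apply/setP => G; rewrite !inE; congr (_ && _).
by apply: eq_forallb => e; rewrite /free_cell ltn0 /= andbT.
Qed.

Lemma Dreg_neq0 : (s < n)%N -> Dreg n s != finset.set0.
Proof.
case: n => // N; rewrite ltnS => sN.
(* A circulant digraph: its arcs are the pairs whose difference modulo [n] lies between 1 and
   [s]. *)
apply/set0Pn; exists [set e : 'I_N.+1 * 'I_N.+1 | (0 < (e.2 - e.1)%R <= s)%N].
have cnt (f : 'I_N.+1 -> 'I_N.+1) : injective f ->
   (\sum_k (0 < f k <= s)%N = s)%N.
  move=> finj; transitivity (\sum_(k < N.+1) (0 < k <= s)%N)%N.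
    by rewrite [RHS](reindex_inj finj).
  suff -> : (\sum_(k < N.+1) (0 < k <= s)%N = minn s N)%N by apply/minn_idPl.
  elim: N {f finj sN} => [|N IH]; first by rewrite big_ord1 minn0.
  by rewrite big_ord_recr IH /=; case: (leqP N.+1 s) => /=; lia.
rewrite inE; apply/andP; split.
  by apply/forall_inP => e; rewrite inE; apply: contraTneq => ->; rewrite subrr.
apply/forallP => v; rewrite outdegE indegE; apply/andP; split; apply/eqP.
  under eq_bigr do rewrite inE.
  by apply: (cnt (fun k => k - v)%R) => a b /addIr.
under eq_bigr do rewrite inE.
by apply: (cnt (fun k => v - k)%R) => a b /addrI/oppr_inj.
Qed.

End Count.

(** * Mean of the exponent *)

(** [E1], [E11], [E2] and [E3] are the means of [chi_1], [chi_1^2], [chi_2 + chi_2'] and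
    [chi_3 + chi_3']. Only the term with [E2] fails to be small: [E2] is near [2 J (J - 1) v], and
    since [al v] is near 1 it contributes about [- J^2 u^2], which the last summand cancels. *)
Lemma moment_bounds (R : realType) (L u J k al v g E1 E11 E2 E3 : R) :
  100 <= L -> 0 < u -> 100 * (L * u) <= 1 -> 0 <= J -> J * u <= L -> k = J * u ^+ 2 ->
  0 < al -> al <= L / 2 -> 0 < v -> v <= 1 -> `|al * v - 1| <= L ^+ 2 * u ^+ 2 -> `|g| <= 1 ->
  `|E1| <= J ^+ 2 * (L ^+ 2 * u ^+ 2) ->
  0 <= E11 <= J * (J ^+ 2 + J ^+ 3 * (L ^+ 2 * u ^+ 2)) ->
  `|E2 - 2 * (J * (J - 1) * v)| <= 2 * (J ^+ 3 * (L ^+ 2 * u ^+ 2)) ->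
  `|E3| <= 2 * (J * (J ^+ 2 + J ^+ 3 * (L ^+ 2 * u ^+ 2))) ->
  `|g * al * u ^+ 2 * E1 - al / 2 * u ^+ 4 * E11 - (1 + k) * al / 2 * u ^+ 2 * E2 - g * al ^+ 2 / 6 * u ^+ 4 * E3
    + J ^+ 2 * u ^+ 2| <= L ^+ 7 * u.
Proof.
move=> L100 u0 S1 J0 JL kE a0 aL v0 v1 av g1 h1 /andP[h11 h12] h2 h3.
have L0 : 0 < L by lra.
have Ju0 : 0 <= J * u by rewrite mulr_ge0 // ltW.
have aL1 : `|al| <= L by rewrite gtr0_norm //; clear -aL L0; lra.
have pw q : (J * u) ^+ q <= L ^+ q by apply: lerXn2r; rewrite ?nnegrE // ltW.
have pw0 q : 0 <= (J * u) ^+ q by rewrite exprn_ge0.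
have pl0 q : 0 <= L ^+ q by rewrite exprn_ge0 // ltW.
have u1 : u <= 1 by clear -S1 L100 u0; nra.
have k0 : 0 <= k by rewrite kE mulr_ge0 // exprn_ge0 // ltW.
have kL : k <= L * u by rewrite kE expr2 mulrA ler_wpM2r // ltW.
have k1 : k <= 1 by clear -kL S1 L0 u0; nra.
have ui := ltW u0; have Li := ltW L0.
set e := L ^+ 2 * u ^+ 2 in h1 h11 h12 h2 h3.
have e0 : 0 <= e by rewrite mulr_ge0 // exprn_ge0.
have L2u : L ^+ 2 * u <= L ^+ 2 by rewrite ler_piMr.
set X := J * (J ^+ 2 + J ^+ 3 * e) in h12 h3.
have X0 : 0 <= X by rewrite mulr_ge0 // addr_ge0 ?exprn_ge0 // mulr_ge0 ?exprn_ge0.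
have Xle : X * u ^+ 3 <= 2 * L ^+ 5.
  have -> : X * u ^+ 3 = (J * u) ^+ 3 + (J * u) ^+ 4 * (L * (L * u)) by rewrite /X /e; ring.
  have t1 : L * (L * u) <= L by rewrite ler_piMr //; clear -S1 ui Li; lra.
  have t2 : (J * u) ^+ 4 * (L * (L * u)) <= L ^+ 4 * L.
    by apply: ler_pM => //; rewrite !mulr_ge0.
  have t3 : L ^+ 3 <= L ^+ 5 by rewrite ler_weXn2l //; clear -L100; lra.
  rewrite -exprSr in t2; have t4 := pw 3%N.
  by clear -t2 t3 t4; lra.
have al1 : `|(1 + k) * al / 2 * u ^+ 2| <= L * u ^+ 2.
  have c0 : 0 <= (1 + k) * al / 2 <= L by clear -k0 k1 a0 aL L0; apply/andP; split; nra.
  case/andP: c0 => c0 c1; rewrite ger0_norm; last by rewrite mulr_ge0 ?exprn_ge0.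
  by rewrite ler_wpM2r ?exprn_ge0.
have b1 : `|g * al * u ^+ 2 * E1| <= L ^+ 5 * u.
  have -> : L ^+ 5 * u = (1 * L) * (L ^+ 2 * u) * L ^+ 2 by ring.
  have -> : g * al * u ^+ 2 * E1 = (g * al) * (u ^+ 2 * E1) by ring.
  rewrite normrM; apply: le_trans (_ : 1 * L * (L ^+ 2 * u * L ^+ 2) <= _); last by rewrite mulrA.
  apply: ler_pM; rewrite ?normr_ge0 //.
    by rewrite normrM; apply: ler_pM; rewrite ?normr_ge0.
  rewrite normrM ger0_norm ?exprn_ge0 //.
  apply: le_trans (_ : u ^+ 2 * (J ^+ 2 * e) <= _); first by rewrite ler_wpM2l ?exprn_ge0.
  have -> : u ^+ 2 * (J ^+ 2 * e) = (J * u) ^+ 2 * (L ^+ 2 * u) * u by rewrite /e; ring.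
  have t : (J * u) ^+ 2 * (L ^+ 2 * u) <= L ^+ 2 * (L ^+ 2 * u).
    by rewrite ler_wpM2r // mulr_ge0.
  apply: le_trans (_ : (J * u) ^+ 2 * (L ^+ 2 * u) * 1 <= _).
    by rewrite ler_wpM2l // !mulr_ge0.
  by rewrite mulr1; apply: le_trans t _; rewrite mulrC.
have b2 : `|al / 2 * u ^+ 4 * E11| <= L ^+ 6 * u.
  rewrite ger0_norm; last by rewrite !mulr_ge0 ?exprn_ge0 ?invr_ge0 // ltW.
  apply: le_trans (_ : L / 2 * (u ^+ 4 * X) <= _).
    rewrite -mulrA; apply: ler_pM; rewrite ?mulr_ge0 ?exprn_ge0 ?invr_ge0 //; first exact: ltW.
      by rewrite ler_wpM2r ?invr_ge0 //; clear -aL L0; lra.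
    by rewrite ler_wpM2l ?exprn_ge0.
  have -> : L / 2 * (u ^+ 4 * X) = L / 2 * u * (X * u ^+ 3) by ring.
  have -> : L ^+ 6 * u = L / 2 * u * (2 * L ^+ 5) by field.
  by rewrite ler_wpM2l // !mulr_ge0 // invr_ge0.
have b4 : `|g * al ^+ 2 / 6 * u ^+ 4 * E3| <= L ^+ 7 / 4 * u.
  have -> : g * al ^+ 2 / 6 * u ^+ 4 * E3 = g * (al / 6 * al) * (u ^+ 4 * E3) by field.
  have aa : 0 <= al / 6 * al <= L / 12 * (L / 2).
    have a6 : al / 6 <= L / 12 by clear -aL; lra.
    have a6' : 0 <= al / 6 by clear -a0; lra.
    by rewrite mulr_ge0 ?(ltW a0) //=; apply: ler_pM => //; exact: ltW.
  case/andP: aa => aa0 aa1.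
  have -> : L ^+ 7 / 4 * u = 1 * (L / 12 * (L / 2)) * (u * (6 * L ^+ 5)) by field.
  rewrite normrM; apply: ler_pM; rewrite ?normr_ge0 //.
    by rewrite normrM; apply: ler_pM; rewrite ?normr_ge0 // ger0_norm.
  rewrite normrM ger0_norm ?exprn_ge0 //.
  apply: le_trans (_ : u ^+ 4 * (2 * X) <= _); first by rewrite ler_wpM2l ?exprn_ge0.
  have -> : u ^+ 4 * (2 * X) = u * (2 * (X * u ^+ 3)) by ring.
  rewrite ler_wpM2l //; have := pl0 5%N; clear -Xle; lra.
have b3 : `|(1 + k) * al / 2 * u ^+ 2 * (E2 - 2 * (J * (J - 1) * v))| <= 2 * (L ^+ 6 * u).
  rewrite normrM; apply: le_trans (ler_pM _ _ al1 h2) _; rewrite ?normr_ge0 //.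
  have -> : L * u ^+ 2 * (2 * (J ^+ 3 * e)) = 2 * (L ^+ 3 * (J * u) ^+ 3 * u) by rewrite /e; ring.
  rewrite ler_pM2l //; have -> : L ^+ 6 * u = L ^+ 3 * L ^+ 3 * u by ring.
  by rewrite ler_wpM2r // ler_wpM2l.
have b5 : `|J ^+ 2 * u ^+ 2 - (1 + k) * al / 2 * u ^+ 2 * (2 * (J * (J - 1) * v))| <= 3 * (L ^+ 4 * u).
  have -> : J ^+ 2 * u ^+ 2 - (1 + k) * al / 2 * u ^+ 2 * (2 * (J * (J - 1) * v)) =
    (J * u) ^+ 2 * (- (al * v - 1) - k * (al * v)) + (1 + k) * (al * v) * k.
    by rewrite kE; field.
  have Lu1 : L ^+ 2 * u ^+ 2 <= u * L ^+ 2 by rewrite [leRHS]mulrC ler_wpM2l // expr2 ler_piMr.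
  have Lu2 : L ^+ 2 * u ^+ 2 <= 1.
    have -> : L ^+ 2 * u ^+ 2 = (L * u) * (L * u) by ring.
    have : 0 <= L * u by rewrite mulr_ge0.
    by clear -S1; nra.
  have av2 : `|al * v| <= 2.
    have -> : al * v = (al * v - 1) + 1 by ring.
    by apply: le_trans (ler_normD _ _) _; rewrite normr1; clear -av Lu2; lra.
  have k1' : `|1 + k| <= 2 by rewrite ger0_norm; clear -k0 k1; lra.
  have kk : `|k| <= L * u by rewrite ger0_norm.
  apply: le_trans (_ : L ^+ 2 * (u * L ^+ 2 + L * u * 2) + 2 * 2 * (L * u) <= _).
    apply: le_trans (ler_normD _ _) _; apply: lerD.
      rewrite normrM; apply: ler_pM; rewrite ?normr_ge0 //; first by rewrite ger0_norm.
      apply: le_trans (ler_normB _ _) _; rewrite normrN; apply: lerD; first exact: le_trans av Lu1.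
      by rewrite normrM; apply: ler_pM; rewrite ?normr_ge0.
    rewrite normrM; apply: ler_pM; rewrite ?normr_ge0 //.
    by rewrite normrM; apply: ler_pM; rewrite ?normr_ge0.
  have -> : L ^+ 2 * (u * L ^+ 2 + L * u * 2) + 2 * 2 * (L * u) = (L ^+ 4 + 2 * L ^+ 3 + 4 * L) * u by ring.
  rewrite [leRHS]mulrA ler_wpM2r //.
  have L1 : 1 <= L by clear -L100; lra.
  have p3 : 100 * L ^+ 3 <= L ^+ 4 by rewrite (exprS _ 3) ler_wpM2r.
  have p1 : L <= L ^+ 3 by rewrite -[leLHS]expr1 ler_weXn2l.
  by clear -p3 p1 L0; lra.
have -> : g * al * u ^+ 2 * E1 - al / 2 * u ^+ 4 * E11 - (1 + k) * al / 2 * u ^+ 2 * E2 - g * al ^+ 2 / 6 * u ^+ 4 * E3 + J ^+ 2 * u ^+ 2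
  = g * al * u ^+ 2 * E1 - al / 2 * u ^+ 4 * E11 - g * al ^+ 2 / 6 * u ^+ 4 * E3
    - (1 + k) * al / 2 * u ^+ 2 * (E2 - 2 * (J * (J - 1) * v))
    + (J ^+ 2 * u ^+ 2 - (1 + k) * al / 2 * u ^+ 2 * (2 * (J * (J - 1) * v))) by ring.
apply: le_trans (ler_normD _ _) _; apply: le_trans (lerD (ler_normB _ _) b5) _.
apply: le_trans (lerD (lerD (ler_normB _ _) b3) (lexx _)) _.
apply: le_trans (lerD (lerD (lerD (ler_normB _ _) b4) (lexx _)) (lexx _)) _.
apply: le_trans (lerD (lerD (lerD (lerD b1 b2) (lexx _)) (lexx _)) (lexx _)) _.
have -> : L ^+ 5 * u + L ^+ 6 * u + L ^+ 7 / 4 * u + 2 * (L ^+ 6 * u) + 3 * (L ^+ 4 * u) =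
  (L ^+ 5 + 3 * L ^+ 6 + L ^+ 7 / 4 + 3 * L ^+ 4) * u by ring.
rewrite ler_wpM2r //.
have L1 : 1 <= L by clear -L100; lra.
have p4 : L ^+ 4 <= L ^+ 6 by rewrite ler_weXn2l.
have p5 : L ^+ 5 <= L ^+ 6 by rewrite ler_weXn2l.
have p7 : 100 * L ^+ 6 <= L ^+ 7 by rewrite (exprS _ 6) ler_wpM2r.
have p60 := pl0 6%N.
clear -p4 p5 p7 p60; lra.
Qed.

Section Expectation.
Variables (R : realType) (n s J : nat) (L w : R).
Hypothesis rg : regime n s J L w.
Local Notation lam := (s%:R / n%:R : R).
Local Notation A := (2^-1 * lam * (1 - lam) : R).
Local Notation p := (s%:R / (n%:R - 1) : R).
Local Notation u := (w^-1).
Local Notation x := (@entry R n).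
Implicit Types (H : digraph n).

Variable q : digraph n -> R.
Hypothesis q0 : forall H, 0 <= q H.
Hypothesis q1 : \sum_(H : digraph n | H \subset block n J) q H = 1.

(** The law [q] is arbitrary because the section serves both the law of the induced subdigraph and
    the Bernoulli measure. *)
Definition expect (g : digraph n -> R) : R := \sum_(H : digraph n | H \subset block n J) q H * g H.

Lemma expectD f g : expect (fun H => f H + g H) = expect f + expect g.
Proof. by rewrite /expect -big_split; apply: eq_bigr => H _; rewrite /= mulrDr. Qed.

Lemma expectZ a f : expect (fun H => a * f H) = a * expect f.
Proof. by rewrite /expect mulr_sumr; apply: eq_bigr => H _; rewrite mulrCA. Qed.

Lemma expect_cst a : expect (fun=> a) = a.
Proof. by rewrite /expect -mulr_suml q1 mul1r. Qed.

Lemma expect_sum (I : Type) (r : seq I) (P : pred I) (F : I -> digraph n -> R) :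
  expect (fun H => \sum_(i <- r | P i) F i H) = \sum_(i <- r | P i) expect (F i).
Proof. by rewrite /expect exchange_big; apply: eq_bigr => H _; rewrite mulr_sumr. Qed.

Lemma eq_expect f g : (forall H, H \subset block n J -> f H = g H) -> expect f = expect g.
Proof. by move=> fg; apply: eq_bigr => H HB; rewrite fg. Qed.

Lemma le_expect f g : (forall H, H \subset block n J -> f H <= g H) -> expect f <= expect g.
Proof. by move=> fg; apply: ler_sum => H HB; rewrite ler_wpM2l // fg. Qed.

Lemma norm_expect f : `|expect f| <= expect (fun H => `|f H|).
Proof.
apply: le_trans (ler_norm_sum _ _ _) _; apply: ler_sum => H _.
by rewrite normrM ger0_norm.
Qed.

Lemma second_moment (T : pred 'I_n) (y : 'I_n -> digraph n -> R) (v e : R) : 0 <= e ->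
  (forall k, T k -> `|expect (fun H => y k H ^+ 2) - v| <= e) ->
  (forall k k', T k -> T k' -> k != k' -> `|expect (fun H => y k H * y k' H)| <= e) ->
  `|expect (fun H => (\sum_(k | T k) y k H) ^+ 2) - #|T|%:R * v| <= #|T|%:R ^+ 2 * e.
Proof.
move=> e0 h1 h2.
have EK (a : R) : \sum_(k | T k) a = #|T|%:R * a by rewrite sumr_const mulr_natl.
have -> : expect (fun H => (\sum_(k | T k) y k H) ^+ 2) =
    \sum_(k | T k) \sum_(k' | T k') expect (fun H => y k H * y k' H).
  under [RHS]eq_bigr => k _ do rewrite -expect_sum.
  rewrite -expect_sum; apply: eq_expect => H _.
  by rewrite expr2 mulr_suml; apply: eq_bigr => k _; rewrite mulr_sumr.
have -> : \sum_(k | T k) \sum_(k' | T k') expect (fun H => y k H * y k' H) - #|T|%:R * v =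
  \sum_(k | T k) \sum_(k' | T k') (expect (fun H => y k H * y k' H) - (k == k')%:R * v).
  rewrite -EK -sumrB; apply: eq_bigr => k Tk; rewrite sumrB; congr (_ - _).
  rewrite (bigD1 k) //= eqxx mul1r big1 ?addr0 // => k' /andP[_ /negbTE k'k].
  by rewrite eq_sym k'k mul0r.
apply: le_trans (ler_norm_sum _ _ _) _.
rewrite expr2 -mulrA -!EK; apply: ler_sum => k Tk; apply: le_trans (ler_norm_sum _ _ _) _.
apply: ler_sum => k' Tk'; have [<-|kk'] := eqVneq k k'.
  by rewrite mul1r; have := h1 k Tk; under eq_expect do rewrite expr2.
by rewrite mul0r subr0 h2.
Qed.

Hypothesis mean1 : forall j k : 'I_n, (j, k) \in block n J ->
  `|expect (fun H => x H j k) - p| <= L ^+ 2 * u ^+ 2.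
Hypothesis mean_row : forall j k k' : 'I_n, (j, k) \in block n J -> (j, k') \in block n J -> k != k' ->
  `|expect (fun H => (x H j k - p) * (x H j k' - p))| <= L ^+ 2 * u ^+ 2.
Hypothesis mean_col : forall j j' k : 'I_n, (j, k) \in block n J -> (j', k) \in block n J -> j != j' ->
  `|expect (fun H => (x H j k - p) * (x H j' k - p))| <= L ^+ 2 * u ^+ 2.

Let e : R := L ^+ 2 * u ^+ 2.
Let v : R := p * (1 - p).
Let e0 : 0 <= e. Proof. by rewrite mulr_ge0 // exprn_ge0 // ltW // ?(rg_u0 rg) ?(rg_L0 rg). Qed.
Let dev H (j : 'I_n) : R := (outdeg H j)%:R - p * (J%:R - 1).
Let dev' H (j : 'I_n) : R := (indeg H j)%:R - p * (J%:R - 1).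
Let T j : pred 'I_n := [pred k : 'I_n | (k < J)%N && (k != j)].

Let card_T (j : 'I_n) : (j < J)%N -> #|T j|%:R = J%:R - 1 :> R.
Proof.
move=> jJ; rewrite -(card_ltn_ord rg) (cardD1 j [pred k : 'I_n | (k < J)%N]) inE /= jJ natrD /= [_ + #|_|%:R]addrC addrK.
by congr (_%:R); apply: eq_card => k; rewrite !inE andbC.
Qed.

Let devE H (j : 'I_n) : H \subset block n J -> (j < J)%N -> dev H j = \sum_(k | T j k) (x H j k - p).
Proof.
move=> /fintype.subsetP HB jJ; rewrite sumrB sumr_const -[p *+ _]mulr_natl card_T // [_ * p]mulrC; congr (_ - _).
rewrite outdegE natr_sum (bigID (T j)) /= [X in _ + X]big1 ?addr0 // => k nT.
case: (boolP (_ \in H)) => // /HB; rewrite inE /= => /and3P[_ kJ jk].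
by move: nT; rewrite /T /= kJ eq_sym jk.
Qed.

Let devE' H (k : 'I_n) : H \subset block n J -> (k < J)%N -> dev' H k = \sum_(j | T k j) (x H j k - p).
Proof.
rewrite -transpose_block => HB kJ; rewrite /dev' indeg_transpose -/(dev _ _) devE //.
by apply: eq_bigr => j _; rewrite entry_transpose.
Qed.

(** As [x^2 = x], the difference [(x - p)^2 - p (1 - p)] equals [(1 - 2 p) (x - p)], so the second
    moment of an arc follows from its first. *)
Let mean_sq (j k : 'I_n) : (j, k) \in block n J -> `|expect (fun H => (x H j k - p) ^+ 2) - v| <= e.
Proof.
move=> jk; have [/andP[p0 p1] _ _] := rg_p rg.
have -> : expect (fun H => (x H j k - p) ^+ 2) - v = (1 - 2 * p) * (expect (fun H => x H j k) - p).
  rewrite (eq_expect (g := fun H => (1 - 2 * p) * x H j k + p ^+ 2)); last first.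
    by move=> H _; have := entry_idem R H j k; lra.
  by rewrite expectD expectZ expect_cst /v; ring.
rewrite normrM -[leRHS]mul1r; apply: ler_pM => //; last exact: mean1.
by rewrite ler_norml; apply/andP; split; lra.
Qed.

Let dev_sq (j : 'I_n) : (j < J)%N -> `|expect (fun H => dev H j ^+ 2) - (J%:R - 1) * v| <= (J%:R - 1) ^+ 2 * e.
Proof.
move=> jJ; rewrite (eq_expect (g := fun H => (\sum_(k | T j k) (x H j k - p)) ^+ 2)); last first.
  by move=> H HB; rewrite devE.
have inB k : T j k -> (j, k) \in block n J by move=> /andP[kJ kj]; rewrite inE /= jJ kJ eq_sym.
rewrite -(card_T jJ); apply: second_moment => // [k Tk|k k' Tk Tk' kk'].
  by apply: mean_sq; apply: inB.
by apply: mean_row => //; apply: inB.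
Qed.

Let dev_sq' (k : 'I_n) : (k < J)%N -> `|expect (fun H => dev' H k ^+ 2) - (J%:R - 1) * v| <= (J%:R - 1) ^+ 2 * e.
Proof.
move=> kJ; rewrite (eq_expect (g := fun H => (\sum_(j | T k j) (x H j k - p)) ^+ 2)); last first.
  by move=> H HB; rewrite devE'.
have inB j : T k j -> (j, k) \in block n J by move=> /andP[jJ jk]; rewrite inE /= jJ kJ.
rewrite -(card_T kJ); apply: second_moment => // [j Tj|j j' Tj Tj' jj'].
  by apply: mean_sq; apply: inB.
by apply: mean_col => //; apply: inB.
Qed.

Let Jsq : 0 <= J%:R - 1 :> R \/ J = 0%N.
Proof. by case: J => [|K]; [right|left; rewrite -natr1 addrK]. Qed.

Let chi2_mean : `|expect (fun H => chi H J p 2) - J%:R * (J%:R - 1) * v| <= J%:R ^+ 3 * e.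
Proof.
rewrite expect_sum -mulrA -(sum_const_block rg) -sumrB.
apply: le_trans (ler_norm_sum _ _ _) _.
have -> : J%:R ^+ 3 * e = \sum_(j < n | (j < J)%N) J%:R ^+ 2 * e by rewrite (sum_const_block rg); ring.
apply: ler_sum => j jJ; apply: le_trans (dev_sq jJ) _; rewrite ler_wpM2r //.
have J1 : 1 <= J%:R :> R by rewrite ler1n; apply: leq_ltn_trans jJ.
by apply: lerXn2r; rewrite ?nnegrE; lra.
Qed.

Let chi2_mean' : `|expect (fun H => chi' H J p 2) - J%:R * (J%:R - 1) * v| <= J%:R ^+ 3 * e.
Proof.
rewrite expect_sum -mulrA -(sum_const_block rg) -sumrB.
apply: le_trans (ler_norm_sum _ _ _) _.
have -> : J%:R ^+ 3 * e = \sum_(j < n | (j < J)%N) J%:R ^+ 2 * e by rewrite (sum_const_block rg); ring.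
apply: ler_sum => j jJ; apply: le_trans (dev_sq' jJ) _; rewrite ler_wpM2r //.
have J1 : 1 <= J%:R :> R by rewrite ler1n; apply: leq_ltn_trans jJ.
by apply: lerXn2r; rewrite ?nnegrE; lra.
Qed.

Let chi1_mean : `|expect (fun H => chi H J p 1)| <= J%:R ^+ 2 * e.
Proof.
rewrite expect_sum; apply: le_trans (ler_norm_sum _ _ _) _.
have -> : J%:R ^+ 2 * e = \sum_(j < n | (j < J)%N) J%:R * e by rewrite (sum_const_block rg); ring.
apply: ler_sum => j jJ.
rewrite (eq_expect (g := fun H => \sum_(k | T j k) (x H j k - p))); last first.
  by move=> H HB; rewrite expr1 -devE.
rewrite expect_sum; apply: le_trans (ler_norm_sum _ _ _) _.
apply: le_trans (_ : \sum_(k | T j k) e <= _).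
  apply: ler_sum => k /andP[kJ kj].
  rewrite (expectD (fun H => x H j k) (fun=> - p)) expect_cst.
  by apply: mean1; rewrite inE /= jJ kJ eq_sym.
have -> : \sum_(k | T j k) e = #|T j|%:R * e by rewrite sumr_const mulr_natl.
by rewrite card_T // ler_wpM2r //; lra.
Qed.

Let main_le : J%:R * (J%:R - 1) * v <= J%:R ^+ 2.
Proof.
have [/andP[p0 p1] _ _] := rg_p rg.
have v1 : 0 <= v <= 1 by rewrite /v; move: (p) p0 p1 => y y0 y1; apply/andP; split; nra.
case/andP: v1 => v0 v1; case: Jsq => [J1|->]; last by rewrite !mul0r sqr_ge0.
rewrite expr2 -mulrA ler_wpM2l //.
apply: le_trans (_ : (J%:R - 1) * 1 <= _); first by rewrite ler_wpM2l.
by rewrite mulr1; lra.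
Qed.

Let chi2_le : expect (fun H => chi H J p 2) <= J%:R ^+ 2 + J%:R ^+ 3 * e.
Proof.
have := le_trans (ler_norm _) chi2_mean; rewrite lerBlDl => /le_trans; apply.
by rewrite lerD2r; exact: main_le.
Qed.

Let chi2_le' : expect (fun H => chi' H J p 2) <= J%:R ^+ 2 + J%:R ^+ 3 * e.
Proof.
have := le_trans (ler_norm _) chi2_mean'; rewrite lerBlDl => /le_trans; apply.
by rewrite lerD2r; exact: main_le.
Qed.

(** By Cauchy-Schwarz [chi_1^2] is at most [J chi_2]. This avoids covariances of arcs sharing
    neither tail nor head, about which nothing is assumed. *)
Let chi1_sq : 0 <= expect (fun H => chi H J p 1 ^+ 2) <= J%:R * (J%:R ^+ 2 + J%:R ^+ 3 * e).
Proof.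
apply/andP; split.
  have -> : 0 = expect (fun=> 0) by rewrite expect_cst.
  by apply: le_expect => H _; exact: sqr_ge0.
apply: le_trans (_ : J%:R * expect (fun H => chi H J p 2) <= _); last by rewrite ler_wpM2l.
rewrite -expectZ; apply: le_expect => H _.
rewrite -(card_ltn_ord rg) /chi; under eq_bigr do rewrite expr1.
exact: (sqr_sum_le [pred j : 'I_n | (j < J)%N]).
Qed.

Let cube_le (d : R) : `|d| <= J%:R -> `|d ^+ 3| <= J%:R * d ^+ 2.
Proof.
move=> dJ; rewrite exprS normrM; apply: ler_pM; rewrite ?normr_ge0 //.
by rewrite ger0_norm ?sqr_ge0.
Qed.

(** Each deviation is at most [J], so a cube is at most [J] times a square and second moments
    suffice. *)
Let chi3_abs : `|expect (fun H => chi H J p 3 + chi' H J p 3)| <= 2 * (J%:R * (J%:R ^+ 2 + J%:R ^+ 3 * e)).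
Proof.
apply: le_trans (norm_expect _) _.
apply: le_trans (_ : expect (fun H => J%:R * chi H J p 2 + J%:R * chi' H J p 2) <= _).
  apply: le_expect => H HB; apply: le_trans (ler_normD _ _) _; rewrite /chi /chi' !mulr_sumr.
  apply: lerD; apply: le_trans (ler_norm_sum _ _ _) _; apply: ler_sum => j jJ; apply: cube_le.
    by apply: (degree_dev rg); have := outdeg_block j HB; rewrite jJ mul1n.
  by apply: (degree_dev rg); have := indeg_block j HB; rewrite jJ mul1n.
rewrite expectD !expectZ.
have c1 : J%:R * expect (fun H => chi H J p 2) <= J%:R * (J%:R ^+ 2 + J%:R ^+ 3 * e) by rewrite ler_wpM2l.
have c2 : J%:R * expect (fun H => chi' H J p 2) <= J%:R * (J%:R ^+ 2 + J%:R ^+ 3 * e) by rewrite ler_wpM2l.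
by apply: le_trans (lerD c1 c2) _; rewrite [leRHS]mulr_natl mulr2n.
Qed.

Lemma expect_exponent : `|expect (block_exponent R s J) + J%:R ^+ 2 / n%:R| <= L ^+ 7 * u.
Proof.
have [bL aL v0 ab] := rg_variance rg; rewrite -/v in bL v0 ab.
have [/andP[p0 p1] Lp Lq] := rg_p rg.
have l0 := lam_gt0 rg; have l1 := lam_lt1 rg; have uE := rg_nV rg; have n0 := rg_n0 rg.
have A0 := A_gt0 rg.
pose al := (2 * A)^-1; pose k := J%:R / n%:R : R.
have E : expect (block_exponent R s J) =
  (1 - 2 * lam) * al * u ^+ 2 * expect (fun H => chi H J p 1)
  - al / 2 * u ^+ 4 * expect (fun H => chi H J p 1 ^+ 2)
  - (1 + k) * al / 2 * u ^+ 2 * (expect (fun H => chi H J p 2 + chi' H J p 2))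
  - (1 - 2 * lam) * al ^+ 2 / 6 * u ^+ 4 * expect (fun H => chi H J p 3 + chi' H J p 3).
  rewrite -!mulNr -!expectZ -!expectD; apply: eq_expect => H _.
  rewrite -[u ^+ 4]/(u ^+ (2 * 2)) exprM -uE /block_exponent /exponent /al /k.
  cbv zeta; move: (chi H J p 1) (chi H J p 2) (chi' H J p 2) => c1 c2 c2'.
  move: (chi H J p 3) (chi' H J p 3) => c3 c3'; move: (lam) (A) A0 => y y' y0.
  by field; rewrite !gt_eqF.
have -> : J%:R ^+ 2 / n%:R = J%:R ^+ 2 * u ^+ 2 :> R by rewrite uE.
rewrite E; apply: (moment_bounds (v := v)) => //.
- exact: rg_L rg.
- exact: rg_u0 rg.
- by have := rg_small rg (isT : (1 < 60)%N); rewrite expr1.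
- by rewrite ler_pdivrMr ?(rg_w0 rg) // mulrC; exact: rg_J rg.
- by rewrite /k uE.
- by rewrite invr_gt0 mulr_gt0.
- by rewrite /v; move: (p) p0 p1 => y y0 y1; nra.
- have -> : al * v - 1 = v * (al - v^-1) by field; rewrite gt_eqF.
  rewrite normrM -[leRHS]mul1r; apply: ler_pM; rewrite ?normr_ge0 //.
  by rewrite gtr0_norm // /v; move: (p) p0 p1 => y y0 y1; nra.
- by rewrite ler_norml; apply/andP; split; lra.
- rewrite expectD.
  have -> : expect (fun H => chi H J p 2) + expect (fun H => chi' H J p 2) - 2 * (J%:R * (J%:R - 1) * v) =
    (expect (fun H => chi H J p 2) - J%:R * (J%:R - 1) * v) + (expect (fun H => chi' H J p 2) - J%:R * (J%:R - 1) * v) by ring.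
  apply: le_trans (ler_normD _ _) _.
  by apply: le_trans (lerD chi2_mean chi2_mean') _; rewrite [leRHS]mulr_natl mulr2n.
Qed.

End Expectation.

(** * Arc moments in a random regular digraph *)

Section RegularModel.
Variables (R : realType) (n s J : nat) (L w : R).
Hypothesis rg : regime n s J L w.
Local Notation p := (s%:R / (n%:R - 1) : R).
Local Notation u := (w^-1).
Local Notation x := (@entry R n).
Implicit Types (G H M : digraph n).

Let rg0 : regime n s 0 L w.
Proof.
case: rg => a1 a2 a3 a4 a5 a6 a7 a8; split=> //.
by rewrite mulr_ge0 // ?(ltW a1) //; apply: le_trans a3.
Qed.

Let near0 : @near_regular n 0 s (fun=> s).
Proof.
split=> // [i|]; first by rewrite leq_addr.
by rewrite big1 // => i _; rewrite subnn.
Qed.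

Local Notation S := (completions 0 (fun _ : 'I_n => s) (fun=> s)).

Let S0 : S != finset.set0.
Proof. by rewrite -Dreg_completions; apply: Dreg_neq0; exact: rg_sn rg. Qed.

Let t : R := 2 * (L / w ^+ 2).

Let t0 : 0 <= t.
Proof. by rewrite mulr_ge0 // divr_ge0 ?exprn_ge0 // ltW // ?(rg_L0 rg) ?(rg_w0 rg). Qed.

Let average (Y : digraph n -> R) (j k : 'I_n) (T : pred 'I_n) : j != k ->
  (forall M, `|Y M| <= 1) ->
  (forall k', T k' -> (j != k') /\ forall a b M, Y (flip k k' a b M) = Y M) ->
  `|#|T|%:R * mean S (fun M => Y M * x M j k) - \sum_(k' | T k') mean S (fun M => Y M * x M j k')| <= #|T|%:R * t.
Proof.
move=> jk Y1 YT.
have EK (a : R) : \sum_(k' | T k') a = #|T|%:R * a by rewrite sumr_const mulr_natl.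
rewrite -!EK -sumrB; apply: le_trans (ler_norm_sum _ _ _) _; apply: ler_sum => k' /YT[jk' YI].
have [<-|kk'] := eqVneq k k'; first by rewrite subrr normr0.
exact: (mean_compare rg0 near0 near0 S0).
Qed.

(** Without a block, the row sum is exactly [s] over [n - 1] columns. This makes [p = s / (n - 1)]
    the right centre, and only the error of [mean_compare] remains. *)
Lemma regular_mean (j k : 'I_n) : j != k -> `|mean S (fun M => x M j k) - p| <= t.
Proof.
move=> jk; pose T := [pred k' : 'I_n | k' != j].
have n100 := rg_n_large rg; have n0 : (0 < n)%N by have := rg_n0 rg; rewrite ltr0n.
have cT : #|T|%:R = n%:R - 1 :> R.
  have -> : n%:R = (#|T| + 1)%:R :> R.
    congr (_%:R); rewrite -[LHS]card_ord (cardD1 j) inE addnC; congr (_ + _)%N.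
    by apply: eq_card => i; rewrite !inE andbT.
  by rewrite natrD addrK.
have H : `|#|T|%:R * mean S (fun M => 1 * x M j k) - \sum_(k' | T k') mean S (fun M => 1 * x M j k')| <= #|T|%:R * t.
  apply: (average (Y := fun=> 1)) => // [M|k' k'j]; first by rewrite normr1.
  by split=> //; rewrite eq_sym.
move: H.
have mE k' : mean S (fun M => 1 * x M j k') = mean S (fun M => x M j k').
  by apply: eq_mean => M _; rewrite mul1r.
under eq_bigr do rewrite mE.
rewrite mE cT.
have -> : \sum_(k' | T k') mean S (fun M => x M j k') = s%:R.
  rewrite -mean_sum -[RHS](mean_cst S0); apply: eq_mean => M MS.
  by rewrite -(entry_row_sum R j MS) [RHS](bigD1 j) //= (entry_loop R _ MS) add0r.
have n1 : 0 < n%:R - 1 :> R by lra.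
move=> H; rewrite -(ler_pM2l n1) -[X in X * `|_|](gtr0_norm n1) -normrM.
by move: H; congr (`|_| <= _); field; rewrite gt_eqF.
Qed.

(** The centred first entry [Y] is the observable, and the second entry is averaged over the other
    [n - 2] columns, where the row sums to [s] minus the entry at [k]. As [Y] has mean [O(L / n)],
    what remains after division by [n - 2] is [O(L / n)]. *)
Lemma regular_pair (j k k' : 'I_n) : j != k -> j != k' -> k != k' ->
  `|mean S (fun M => (x M j k - p) * (x M j k' - p))| <= L ^+ 2 * u ^+ 2.
Proof.
move=> jk jk' kk'; pose T := [pred i : 'I_n | (i != j) && (i != k)].
have n100 := rg_n_large rg; have n0 := rg_n0 rg.
have [/andP[p0 p1] _ _] := rg_p rg.
have cT : #|T|%:R = n%:R - 2 :> R.
  have -> : n%:R = (#|T| + 2)%:R :> R.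
    congr (_%:R); rewrite -[LHS]card_ord (cardD1 j) (cardD1 k) !inE eq_sym jk addnA addnC.
    by congr (_ + _)%N; apply: eq_card => i; rewrite !inE andbT andbC.
  by rewrite natrD addrK.
pose Y M := x M j k - p.
have Y1 M : `|Y M| <= 1.
  by have /andP[? ?] := entry01 R M j k; rewrite ler_norml /Y; apply/andP; split; lra.
have H : `|#|T|%:R * mean S (fun M => Y M * x M j k') - \sum_(i | T i) mean S (fun M => Y M * x M j i)| <= #|T|%:R * t.
  apply: average => // i /andP[ij ik]; split; first by rewrite eq_sym.
  by move=> a b M; rewrite /Y /entry flip_col // eq_sym.
rewrite cT in H.
have E : \sum_(i | T i) mean S (fun M => Y M * x M j i) = s%:R * mean S Y - mean S (fun M => Y M * x M j k).
  rewrite -mean_sum -meanZ -meanB; apply: eq_mean => M MS.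
  rewrite -mulr_sumr -[s%:R * _]mulrC -mulrBr; congr (_ * _).
  rewrite -(entry_row_sum R j MS) [in RHS](bigD1 j) //= (entry_loop R _ MS) add0r.
  by rewrite [in RHS](bigD1 k) 1?eq_sym //= addrAC subrr add0r.
rewrite E in H.
have mY : `|mean S Y| <= t by rewrite meanB (mean_cst S0) regular_mean.
have mYx : `|mean S (fun M => Y M * x M j k)| <= 1.
  apply: mean_norm_le => // M _; rewrite normrM -[leRHS]mul1r; apply: ler_pM; rewrite ?normr_ge0 //.
  by rewrite ger0_norm ?entry_ge0 ?entry_le1.
have -> : mean S (fun M => (x M j k - p) * (x M j k' - p)) = mean S (fun M => Y M * x M j k') - p * mean S Y.
  by rewrite -meanZ -meanB; apply: eq_mean => M _; rewrite /Y; ring.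
have ps : p * (n%:R - 1) = s%:R by rewrite divfK // gt_eqF //; lra.
have sn := rg_s_lt rg.
move: (mean S Y) (mean S (fun M => Y M * x M j k)) (mean S (fun M => Y M * x M j k')) H mY mYx => a b d H mY mYx.
move: (p) p0 p1 ps => y p0 p1 ps.
have n2 : 0 < n%:R - 2 :> R by lra.
rewrite -(ler_pM2l n2) -[X in X * `|_|](gtr0_norm n2) -normrM.
have -> : (n%:R - 2) * (d - y * a) = ((n%:R - 2) * d - (s%:R * a - b)) + (y * a - b) by rewrite -ps; ring.
have h3 : `|y * a - b| <= t + 1.
  apply: le_trans (ler_normB _ _) _; apply: lerD => //.
  by rewrite normrM gtr0_norm // -[leRHS]mul1r; apply: ler_pM; rewrite ?normr_ge0 // ltW.
apply: le_trans (ler_normD _ _) _; apply: le_trans (lerD H h3) _.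
have w0 := rg_w0 rg; have w2 := rg_w2 rg; have L100 := rg_L rg; have u0 := rg_u0 rg.
have tE : t = 2 * L * u ^+ 2 by rewrite /t exprVn mulrA.
have u2 : 1 <= 2 * ((n%:R - 2) * u ^+ 2).
  rewrite -(rg_nV rg); have -> : 2 * ((n%:R - 2) * n%:R^-1) = 2 - 4 / n%:R :> R by field; rewrite gt_eqF.
  have : 4 / n%:R <= 1 :> R by rewrite ler_pdivrMr //; lra.
  by lra.
have u20 : 0 <= (n%:R - 2) * u ^+ 2 by rewrite mulr_ge0 ?exprn_ge0 //; exact: ltW.
have tle : t <= (n%:R - 2) * t by rewrite ler_peMl //; lra.
apply: le_trans (_ : 2 * ((n%:R - 2) * t) + 2 * ((n%:R - 2) * u ^+ 2) <= _); first by lra.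
have -> : 2 * ((n%:R - 2) * t) + 2 * ((n%:R - 2) * u ^+ 2) = (4 * L + 2) * ((n%:R - 2) * u ^+ 2) by rewrite tE; ring.
rewrite [leRHS]mulrCA; apply: ler_wpM2r => //.
by nra.
Qed.

Lemma regular_pair_col (j j' k : 'I_n) : j != k -> j' != k -> j != j' ->
  `|mean S (fun M => (x M j k - p) * (x M j' k - p))| <= L ^+ 2 * u ^+ 2.
Proof.
move=> jk j'k jj'; rewrite mean_transpose.
have -> : mean S (fun M => (x (transpose M) j k - p) * (x (transpose M) j' k - p)) =
   mean S (fun M => (x M k j - p) * (x M k j' - p)).
  by apply: eq_mean => M _; rewrite !entry_transpose.
by apply: regular_pair => //; rewrite eq_sym.
Qed.

Lemma regular_mean_le (j k : 'I_n) : j != k -> `|mean S (fun M => x M j k) - p| <= L ^+ 2 * u ^+ 2.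
Proof.
move=> jk; apply: le_trans (regular_mean jk) _; rewrite /t -exprVn mulrA ler_wpM2r //.
  by rewrite exprn_ge0 // ltW // (rg_u0 rg).
by have := rg_L rg => L100; nra.
Qed.

Definition block_law (H : digraph n) : R := #|extensions s J H|%:R / #|Dreg n s|%:R.

Lemma block_degree_le H : H \subset block n J -> (forall v, outdeg H v <= s)%N /\ (forall v, indeg H v <= s)%N.
Proof.
move=> HB; have Js := rg_Js rg; split=> v.
  have := outdeg_block v HB; case: (v < J)%N; rewrite ?mul1n ?mul0n; lia.
have := indeg_block v HB; case: (v < J)%N; rewrite ?mul1n ?mul0n; lia.
Qed.

Lemma expect_block_law (g : digraph n -> R) :
  expect J block_law g = mean (Dreg n s) (fun G => g (Defs.induced G J)).
Proof.
rewrite /expect /block_law /mean mulr_suml.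
rewrite [RHS](partition_big (fun G => Defs.induced G J) (fun H => H \subset block n J)); last first.
  by move=> G; rewrite inE => /andP[/induced_block -> _].
apply: eq_bigr => H HB; have [os is_] := block_degree_le HB.
rewrite -(card_induced HB os is_).
rewrite (eq_bigr (fun=> g H / #|Dreg n s|%:R)); last by move=> G /andP[_ /eqP ->].
transitivity (\sum_(G in [set G in Dreg n s | Defs.induced G J == H]) (g H / #|Dreg n s|%:R)).
  by rewrite sumr_const -[RHS]mulr_natl mulrAC mulrA.
by apply: eq_bigl => G; rewrite [LHS]inE.
Qed.

End RegularModel.

(** * Comparison with the Bernoulli measure *)


Definition bernoulli_set (R : realType) (T : finType) (B : {set T}) (p : R) (H : {set T}) : R :=
  p ^+ #|H| * (1 - p) ^+ (#|B| - #|H|)%N.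

Section BernoulliSet.
Variables (R : realType) (T : finType) (B : {set T}) (p : R).
Implicit Types H : {set T}.
Local Notation bern := (bernoulli_set B p).

(** The binomial theorem, grouping the subsets of [B] by cardinality. *)
Lemma sum_bernoulli : \sum_(H : {set T} | H \subset B) bern H = 1.
Proof.
have -> : 1 = ((1 - p) + p) ^+ #|B| by rewrite subrK expr1n.
rewrite exprDn (partition_big (fun H : {set T} => inord #|H| : 'I_#|B|.+1) predT) //=.
apply: eq_bigr => k _; rewrite -[in RHS](cards_draws B k) -sumr_const.
apply: eq_big => H.
  rewrite inE; have [HB|//] := boolP (H \subset B) => /=.
  by rewrite -(inj_eq val_inj) /= inordK // ltnS subset_leq_card.
case/andP=> HB /eqP <-; rewrite inordK ?ltnS ?subset_leq_card //.
by rewrite mulrC.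
Qed.

Lemma bernoulliU1 e H : e \in B -> H \subset B -> e \notin H ->
  (1 - p) * bern (e |: H) = p * bern H.
Proof.
move=> eB HB eH; rewrite /bernoulli_set cardsU1 eH add1n.
have : (#|H| < #|B|)%N.
  by have := subset_leq_card (_ : e |: H \subset B); rewrite cardsU1 eH finset.subUset finset.sub1set eB; apply.
by move=> lt; rewrite -(subnSK lt) !exprS; ring.
Qed.

(** Independence of the arc [e] from a function that does not look at it: pairing [H] with [e |: H]
    gives [(1 - p) S1 = p S0] for the parts with and without [e]. *)
Lemma sum_bernoulli_mem (e : T) (g : {set T} -> R) : e \in B ->
  (forall H, g (e |: H) = g H) ->
  \sum_(H : {set T} | H \subset B) bern H * ((e \in H)%:R * g H) = p * \sum_(H : {set T} | H \subset B) bern H * g H.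
Proof.
move=> eB gI; set S1 := LHS.
pose S0 := \sum_(H : {set T} | (H \subset B) && (e \notin H)) bern H * g H.
have S1E : S1 = \sum_(H : {set T} | (H \subset B) && (e \in H)) bern H * g H.
  rewrite /S1 big_mkcondr; apply: eq_bigr => H _.
  by case: (e \in H); rewrite ?mul1r // mul0r mulr0.
have -> : \sum_(H : {set T} | H \subset B) bern H * g H = S1 + S0 by rewrite S1E (bigID (fun H : {set T} => e \in H)).
suff : (1 - p) * S1 = p * S0 by move=> E; rewrite mulrDr -E; ring.
rewrite S1E (reindex_onto (fun H : {set T} => e |: H) (fun H => H :\ e)) /=; last first.
  by move=> H /andP[_ eH]; rewrite finset.setD1K.
rewrite !mulr_sumr; apply: eq_big => H.
  rewrite finset.subUset finset.sub1set eB /= finset.setU11 andbT; congr (_ && _).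
  apply/eqP/idP => [<-|eH]; first by rewrite !inE eqxx.
  by rewrite finset.setU1K.
case/andP=> /andP[HB _] /eqP eH; rewrite gI !(mulrA _ (bern _)); congr (_ * _).
apply: bernoulliU1 => //; first by move: HB; rewrite finset.subUset => /andP[].
by rewrite -eH !inE eqxx.
Qed.

Lemma sum_bernoulli_mem1 (e : T) : e \in B ->
  \sum_(H : {set T} | H \subset B) bern H * (e \in H)%:R = p.
Proof.
move=> eB; have /= := sum_bernoulli_mem eB (g := fun=> 1) (fun=> erefl).
rewrite -[X in _ = _ * X]mulr_suml sum_bernoulli !mulr1 => E.
by rewrite -[RHS]E; apply: eq_bigr => H _; rewrite mulr1.
Qed.

Lemma sum_bernoulli_pair (e e' : T) : e \in B -> e' \in B -> e != e' ->
  \sum_(H : {set T} | H \subset B) bern H * (((e \in H)%:R - p) * ((e' \in H)%:R - p)) = 0.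
Proof.
move=> eB e'B ee'.
have gI H : (e' \in e |: H)%:R = (e' \in H)%:R :> R by rewrite !inE eq_sym (negbTE ee').
have E := sum_bernoulli_mem eB gI; rewrite (sum_bernoulli_mem1 e'B) in E.
transitivity (\sum_(H : {set T} | H \subset B) bern H * ((e \in H)%:R * (e' \in H)%:R)
    - p * (\sum_(H : {set T} | H \subset B) bern H * (e \in H)%:R)
    - p * (\sum_(H : {set T} | H \subset B) bern H * (e' \in H)%:R)
    + p * p * \sum_(H : {set T} | H \subset B) bern H).
  by rewrite !mulr_sumr -!sumrB -big_split /=; apply: eq_bigr => H _; ring.
by rewrite E !sum_bernoulli_mem1 // sum_bernoulli; ring.
Qed.

End BernoulliSet.

Section BlockProbability.
Variables (R : realType) (n s J : nat) (L w : R).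
Hypothesis rg : regime n s J L w.
Local Notation p := (s%:R / (n%:R - 1) : R).
Local Notation u := (w^-1).
Local Notation x := (@entry R n).
Local Notation B := (block n J).
Local Notation bern := (bernoulli_set B p).
Local Notation law := (@block_law R n s J).
Local Notation Phi := (@block_exponent R n s J).
Implicit Types (G H : digraph n).

Lemma card_block : #|B| = (J * (J - 1))%N.
Proof.
have cJ : #|[pred k : 'I_n | (k < J)%N]| = J.
  by apply/eqP; rewrite -(eqr_nat R) (card_ltn_ord rg).
rewrite (@card_sum_outdeg n J) // (eq_bigr (fun=> (J - 1)%N)) => [|v vJ].
  by rewrite sum_nat_const cJ.
rewrite -[in RHS]cJ (cardD1 v [pred k : 'I_n | (k < J)%N]) inE vJ addKn outdegE -sum1_card [RHS]big_mkcond /=.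
apply: eq_bigr => k _; rewrite !inE /= vJ. by rewrite andTb [v == k]eq_sym andbC; case: ifP.
Qed.

Let bern_gt0 H : 0 < bern H.
Proof.
have [/andP[p0 p1] _ _] := rg_p rg.
by rewrite mulr_gt0 // exprn_gt0 // subr_gt0.
Qed.

Let err_ge0 : 0 <= L ^+ 2 * u ^+ 2.
Proof. by rewrite mulr_ge0 // exprn_ge0 // ltW // ?(rg_u0 rg) ?(rg_L0 rg). Qed.

Let expect_bern : `|expect J bern Phi + J%:R ^+ 2 / n%:R| <= L ^+ 7 * u.
Proof.
apply: (expect_exponent rg) => [H||j k jk|j k k' jk jk' kk'|j j' k jk j'k jj'].
- exact: ltW.
- exact: sum_bernoulli.
- by rewrite [expect _ _ _](sum_bernoulli_mem1 p jk) subrr normr0.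
- rewrite [expect _ _ _](sum_bernoulli_pair p jk jk') ?normr0 //.
  by apply: contra kk' => /eqP[->].
- rewrite [expect _ _ _](sum_bernoulli_pair p jk j'k) ?normr0 //.
  by apply: contra jj' => /eqP[->].
Qed.

Let law_ge0 H : 0 <= law H.
Proof. by rewrite divr_ge0. Qed.

Let D0 : Dreg n s != finset.set0.
Proof. by apply: Dreg_neq0; exact: rg_sn rg. Qed.

Let sum_law : \sum_(H : digraph n | H \subset B) law H = 1.
Proof.
have := expect_block_law rg (fun=> 1); rewrite (mean_cst D0) => <-.
by apply: eq_bigr => H _; rewrite mulr1.
Qed.

Let entry_induced G (j k : 'I_n) : (j, k) \in B -> x (Defs.induced G J) j k = x G j k.
Proof. by rewrite /entry !inE /= => /and3P[-> -> _]; rewrite !andbT. Qed.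

Let expect_law : `|expect J law Phi + J%:R ^+ 2 / n%:R| <= L ^+ 7 * u.
Proof.
apply: (expect_exponent rg) => // [j k jk|j k k' jk jk' kk'|j j' k jk j'k jj'];
  rewrite (expect_block_law rg) Dreg_completions.
- under eq_mean do rewrite entry_induced //.
  by apply: (regular_mean_le rg); move: jk; rewrite inE => /and3P[_ _].
- under eq_mean do rewrite !entry_induced //.
  move: jk jk'; rewrite !inE /= => /and3P[_ _ jk] /and3P[_ _ jk'].
  exact: (regular_pair rg).
- under eq_mean do rewrite !entry_induced //.
  move: jk j'k; rewrite !inE /= => /and3P[_ _ jk] /and3P[_ _ j'k].
  exact: (regular_pair_col rg).
Qed.

(** If the empty digraph did not extend, no digraph on the block would, and [law] could not have
    total mass 1. *)
Let ext0 : extensions s J (finset.set0 : digraph n) != finset.set0.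
Proof.
have [//|] := boolP (extensions s J (finset.set0 : digraph n) != finset.set0).
move=> /negbTE e0; have : (1 : R) = 0.
  rewrite -sum_law big1 // => H HB; have [E _] := extensions_path rg HB.
  by rewrite /block_law; move: E; rewrite e0 => /esym/negbFE/eqP ->; rewrite cards0 mul0r.
by move/eqP; rewrite oner_eq0.
Qed.

Let law_gt0 H : H \subset B -> 0 < law H.
Proof.
move=> HB; have [E _] := extensions_path rg HB.
by rewrite divr_gt0 // ltr0n card_gt0 -?E.
Qed.

(** At most [J^2 <= (w L)^2] arcs are added, each with an error of [L^11 u^3]. *)
Let eta : R := L ^+ 13 * u.

Let kappa : R := ln (law finset.set0 / bern finset.set0) - Phi finset.set0.

Let log_ratio H : H \subset B -> `|ln (law H / bern H) - (kappa + Phi H)| <= eta.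
Proof.
move=> HB; have [E /(_ ext0) b] := extensions_path rg HB.
have [/andP[p0 p1] _ _] := rg_p rg; have q0 : 0 < 1 - p by lra.
have w0 := rg_w0 rg; have u0 := rg_u0 rg; have L0 := rg_L0 rg.
have cH : (#|H| <= #|B|)%N := subset_leq_card HB.
have D1 : 0 < #|Dreg n s|%:R :> R by rewrite ltr0n card_gt0.
have lnlaw H' : H' \subset B -> ln (law H') = ln #|extensions s J H'|%:R - ln #|Dreg n s|%:R.
  move=> H'B; have [E' _] := extensions_path rg H'B.
  by rewrite ln_div // posrE ltr0n card_gt0 -?E'.
have lnbern H' : ln (bern H') = #|H'|%:R * ln p + (#|B| - #|H'|)%:R * ln (1 - p).
  by rewrite lnM ?posrE ?exprn_gt0 // !lnXn // !mulr_natl.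
have ss : finset.set0 \subset B by rewrite finset.sub0set.
have lnr H' : H' \subset B -> ln (law H' / bern H') = ln (law H') - ln (bern H').
  by move=> H'B; apply: ln_div; rewrite posrE //; exact: law_gt0.
rewrite /kappa !lnr // !lnlaw // !lnbern cards0 subn0 natrB //.
move: b; rewrite ln_div ?posrE // => b.
have -> : ln #|extensions s J H|%:R - ln #|Dreg n s|%:R - (#|H|%:R * ln p + (#|B|%:R - #|H|%:R) * ln (1 - p))
  - (ln #|extensions s J (finset.set0 : digraph n)|%:R - ln #|Dreg n s|%:R - (0%:R * ln p + #|B|%:R * ln (1 - p))
     - Phi finset.set0 + Phi H) =
  ln #|extensions s J H|%:R - ln #|extensions s J (finset.set0 : digraph n)|%:R
    - #|H|%:R * (ln p - ln (1 - p)) - (Phi H - Phi finset.set0) by ring.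
apply: le_trans b _.
have JwL := rg_J rg.
have -> : eta = (w * L) ^+ 2 * (L ^+ 11 * u ^+ 3) by rewrite /eta; field; rewrite gt_eqF.
apply: ler_wpM2r; first by rewrite mulr_ge0 // exprn_ge0 // ltW.
apply: le_trans (_ : J%:R ^+ 2 <= _).
  rewrite -natrX ler_nat (leq_trans cH) // card_block expnS expn1 leq_mul2l.
  by rewrite leq_subr orbT.
by rewrite lerXn2r ?nnegrE // mulr_ge0 // ltW.
Qed.

Let mul_exp_ln (a b : R) : 0 < a -> 0 < b -> a = b * expR (ln (a / b)).
Proof.
move=> a0 b0; have ab : 0 < a / b by exact: divr_gt0.
by rewrite lnK ?posrE // mulrC divfK // gt_eqF.
Qed.

(* Jensen for the exponential, via [1 + y <= exp y], applied to both measures. *)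
Let kappa_le : kappa <= eta - expect J bern Phi.
Proof.
have b1 : \sum_(H : digraph n | H \subset B) bern H = 1 := sum_bernoulli B p.
have : expect J bern (fun H => 1 + (kappa - eta + Phi H)) <= 1.
  rewrite -[leRHS]sum_law; apply: ler_sum => H HB.
  rewrite (mul_exp_ln (law_gt0 HB) (bern_gt0 H)).
  apply: ler_wpM2l; first exact: ltW.
  apply: le_trans (expR_ge1Dx _) _; rewrite ler_expR.
  by have := log_ratio HB; rewrite ler_norml => /andP[h _]; lra.
rewrite (expectD _ _ (fun=> 1)) (expectD _ _ (fun=> kappa - eta)) !(expect_cst b1); lra.
Qed.

Let kappa_ge : - eta - expect J law Phi <= kappa.
Proof.
have : expect J law (fun H => 1 + (- kappa - eta + (-1) * Phi H)) <= 1.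
  rewrite -[leRHS](sum_bernoulli B p); apply: ler_sum => H HB.
  have lH := law_gt0 HB; have bH := bern_gt0 H.
  have f0 : 0 < law H / bern H by exact: divr_gt0.
  rewrite (mul_exp_ln bH lH) -invf_div lnV ?posrE //.
  apply: ler_wpM2l; first exact: ltW.
  apply: le_trans (expR_ge1Dx _) _; rewrite ler_expR.
  by have := log_ratio HB; rewrite ler_norml => /andP[_ h]; lra.
rewrite (expectD _ _ (fun=> 1)) (expectD _ _ (fun=> - kappa - eta)) expectZ !(expect_cst sum_law); lra.
Qed.

(** The two Jensen bounds place [kappa] within [eta + L^7 u] of [J^2 / n]; two more powers of [L]
    cover the sum of this error and that of [log_ratio]. *)
Lemma block_probability H : H \subset B ->
  0 < law H /\ `|ln (law H / bern H) - (J%:R ^+ 2 / n%:R + Phi H)| <= L ^+ 15 * u.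
Proof.
move=> HB; split; first exact: law_gt0.
have u0 := rg_u0 rg; have L100 := rg_L rg; have L0 := rg_L0 rg.
have := log_ratio HB; have := expect_bern; have := expect_law; have := kappa_le; have := kappa_ge.
have e7 : L ^+ 7 * u <= L ^+ 13 * u.
  by apply: ler_wpM2r; [exact: ltW | apply: ler_weXn2l => //; exact: rg_L1 rg].
have e15 : 3 * (L ^+ 13 * u) <= L ^+ 15 * u.
  have -> : L ^+ 15 * u = (L * L) * (L ^+ 13 * u) by ring.
  apply: ler_wpM2r; first by rewrite mulr_ge0 ?exprn_ge0 // ltW.
  by nra.
rewrite /eta; move: kappa (expect J law Phi) (expect J bern Phi) (Phi H) (J%:R ^+ 2 / n%:R) (ln _).
move: (L ^+ 7 * u) (L ^+ 13 * u) (L ^+ 15 * u) e7 e15 => a7 a13 a15 e7 e15 k el eb ph jn l.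
rewrite !ler_norml => h1 h2 /andP[h3 h4] /andP[h5 h6] /andP[h7 h8].
by apply/andP; split; lra.
Qed.

End BlockProbability.

(** * Asymptotics *)


Section Asymptotics.
Variable R : realType.

Lemma ln_le_powR (e x : R) : 0 < e -> 0 < x -> ln x <= e^-1 * x `^ e.
Proof.
move=> e0 x0; rewrite mulrC ler_pdivlMr // mulrC -ln_powR ltW // ln_sublinear //.
exact: powR_gt0.
Qed.

Lemma powR_ge_eventually (e T : R) : 0 < e -> 0 < T ->
  exists N, forall n, (N <= n)%N -> T <= n%:R `^ e.
Proof.
move=> e0 T0; exists (Num.truncn (T `^ e^-1)).+1 => n Nn.
have -> : T = (T `^ e^-1) `^ e by rewrite -powRrM mulVf ?gt_eqF // powRr1 // ltW.
apply: ge0_ler_powR; rewrite ?nnegrE ?powR_ge0 //; first exact: ltW.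
by apply: le_trans (ltW (truncnS_gt _)) _; rewrite ler_nat.
Qed.

(* The scales [w = n^(1/2)] and [L = n^(2 eps)] turn the hypothesis
   [(1 - 2 lam)^2 / (3 A) <= a ln n] into [1 <= L A] because [(1 - 2 lam)^2 = 1 - 8 A]. *)
Lemma eventually_regime (a eps C : R) : 0 < a -> 0 < eps -> 240 * eps <= 1 -> 0 < C ->
  exists N : nat, forall n s J : nat, (N <= n)%N -> (0 < s)%N -> (s < n)%N ->
    J%:R <= C * n%:R `^ (2^-1 + eps) ->
    let lam : R := s%:R / n%:R in
    let A : R := 2^-1 * lam * (1 - lam) in
    (1 - 2 * lam) ^+ 2 / (3 * A) <= a * ln n%:R ->
    regime n s J (n%:R `^ (2 * eps)) (n%:R `^ 2^-1).
Proof.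
(* The three parts of [T] serve [J <= w L], [L >= 100] and the absorption of the logarithm through
   [a ln n <= a / eps * Y]. *)
move=> a0 e0 e1 C0; pose T := C + 10 + 3 * a / eps.
have c0 : 0 < 3 * a / eps by rewrite divr_gt0 // mulr_gt0.
have T0 : 0 < T by rewrite /T; lra.
have [N NP] := powR_ge_eventually e0 T0; exists N => n s J Nn s0 sn HJ lam A HA.
have {NP} := NP n Nn; set Y := n%:R `^ eps => TY.
have n1 : 1 <= n%:R :> R by rewrite ler1n; apply: leq_ltn_trans sn.
have n0 : 0 < n%:R :> R by apply: lt_le_trans n1.
have w0 : 0 < n%:R `^ 2^-1 :> R by exact: powR_gt0.
have LE : n%:R `^ (2 * eps) = Y * Y by rewrite [2 * eps]mulrC powRrM powR_mulrn ?powR_ge0.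
have YT : 10 + C + 3 * a / eps <= Y by apply: le_trans TY; rewrite /T; lra.
have Y0 : 0 < Y by lra.
have l0 : 0 < lam by rewrite divr_gt0 // ltr0n.
have l1 : lam < 1 by rewrite ltr_pdivrMr // mul1r ltr_nat.
have A0 : 0 < A by apply: mulr_gt0; rewrite ?subr_gt0 // mulr_gt0 // invr_gt0.
split=> //.
- by rewrite -powR_mulrn ?powR_ge0 // -powRrM mulVf // powRr1 // ltW.
- by rewrite LE; clear -YT C0 c0; nra.
- rewrite -powR_mulrn ?powR_ge0 // -powRrM; apply: ler_powR => //.
  by clear -e1; lra.
- apply: le_trans HJ _; rewrite powRD ?(gt_eqF n0) ?implybT // LE -/Y.
  rewrite mulrCA ler_pM2l // ler_pM2r //; clear -YT C0 c0; lra.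
- rewrite -/lam -/A LE.
  have E : (1 - 2 * lam) ^+ 2 = 1 - 8 * A by rewrite /A; field.
  move: HA; rewrite E ler_pdivrMr; last exact: mulr_gt0.
  move=> HA.
  have HL : a * ln n%:R * (3 * A) <= (3 * a / eps * Y) * A.
    have -> : a * ln n%:R * (3 * A) = 3 * a * A * ln n%:R by ring.
    have -> : 3 * a / eps * Y * A = 3 * a * A * (eps^-1 * Y) by ring.
    by apply: ler_wpM2l; [apply: ltW; do 2![apply: mulr_gt0 => //] | exact: ln_le_powR].
  have YY : 8 + 3 * a / eps * Y <= Y * Y by move: (3 * a / eps) c0 YT => c c0 YT; clear -c0 YT C0; nra.
  have := ler_wpM2r (ltW A0) YY; rewrite mulrDl; clear -HA HL; lra.
Qed.

End Asymptotics.

Theorem theorem3p3 (R : realType) (a b : R) :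
  0 < a -> 0 < b -> a + b < 2^-1 ->
  exists eps0 : R, 0 < eps0 /\
  forall eps : R, 0 < eps -> eps < eps0 ->
  forall C : R, 0 < C ->
  exists K : R, exists N : nat,
  forall (n s J : nat) (H : digraph n),
    (N <= n)%N -> (0 < s)%N -> (s < n)%N -> (J <= n)%N ->
    (forall e, e \in H -> (e.1 < J)%N && (e.2 < J)%N) ->
    loopless H ->
    (forall j, (outdeg H j)%:R <= C * n%:R `^ (2^-1 + eps)) ->
    (forall j, (indeg H j)%:R <= C * n%:R `^ (2^-1 + eps)) ->
    (#|H|)%:R <= C * n%:R `^ (1 + 2 * eps) ->
    J%:R <= C * n%:R `^ (2^-1 + eps) ->
    let lam : R := s%:R / n%:R in
    let A : R := 2^-1 * lam * (1 - lam) in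
    let p : R := s%:R / (n%:R - 1) in
    let X : nat := #|H| in
    (1 - 2 * lam) ^+ 2 / (3 * A) <= a * ln (n%:R) ->
    exists delta : R, `|delta| <= K * n%:R `^ (- b) /\
    prob_induced R s J H =
      p ^+ X * (1 - p) ^+ (J * (J - 1) - X)%N *
      expR ((J%:R) ^+ 2 / n%:R
            + (1 - 2 * lam) * chi H J p 1 / (2 * A * n%:R)
            - (chi H J p 1) ^+ 2 / (4 * A * n%:R ^+ 2)
            - (n%:R + J%:R) * (chi H J p 2 + chi' H J p 2) / (4 * A * n%:R ^+ 2)
            - (1 - 2 * lam) * (chi H J p 3 + chi' H J p 3) / (24 * A ^+ 2 * n%:R ^+ 2)
            + delta).
Proof.
(* The error [L^15 / w = n^(30 eps - 1/2)] requires [30 eps <= 1/2 - b], and [L^60 <= w] requires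
   [240 eps <= 1]; the divisor 120 ensures both because [1/2 - b < 1/2]. *)
move=> a0 b0 ab; exists ((2^-1 - b) / 120); split; first by rewrite divr_gt0 //; lra.
move=> eps e0 e1 C C0.
have e30 : 120 * eps <= 2^-1 - b by move: e1; rewrite ltr_pdivlMr //; lra.
have e240 : 240 * eps <= 1 by lra.
have [N NP] := eventually_regime a0 e0 e240 C0.
(* [K = 1] suffices: the constant [C] is already absorbed in [L], at the price of a larger [N]. *)
exists 1, N => n s J H Nn s0 sn _ HJ lH _ _ _ JC lam A p X HA.
have rg := NP n s J Nn s0 sn JC HA.
have n1 : 1 <= n%:R :> R by rewrite ler1n; apply: leq_ltn_trans sn.
have HB : H \subset block n J.
  apply/fintype.subsetP => e eH; rewrite inE; have /andP[-> ->] := HJ e eH.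
  by move/forall_inP: lH; apply.
have [P0 dP] := block_probability rg HB.
have indH : Defs.induced H J = H.
  by apply/setP => e; rewrite !inE; case: (boolP (e \in H)) => // /HJ ->.
have [os is_] := block_degree_le rg HB.
have PE : prob_induced R s J H = block_law R s J H.
  by rewrite /prob_induced /block_law indH card_induced.
have bE : bernoulli_set (block n J) p H = p ^+ X * (1 - p) ^+ (J * (J - 1) - X)%N.
  by rewrite /bernoulli_set (card_block rg).
have [/andP[p0 p1] _ _] := rg_p rg.
have bern0 : 0 < bernoulli_set (block n J) p H.
  by apply: mulr_gt0; apply: exprn_gt0; rewrite ?subr_gt0.
(* [delta] is the exact logarithmic error, so the formula holds by construction and only the bound
   has content. *)
exists (ln (block_law R s J H / bernoulli_set (block n J) p H)
  - (J%:R ^+ 2 / n%:R + block_exponent R s J H)); split.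
  apply: le_trans dP _; rewrite mul1r -powR_mulrn ?powR_ge0 // -powRrM -powRN.
  rewrite -powRD; last by rewrite (gt_eqF (rg_n0 rg)) implybT.
  by apply: ler_powR => //; lra.
rewrite PE -bE.
set E := (X in expR X).
have -> : E = ln (block_law R s J H / bernoulli_set (block n J) p H).
  rewrite /E /block_exponent /exponent; cbv zeta; rewrite -/lam -/A -/p; ring.
rewrite lnK ?posrE; last exact: divr_gt0.
by rewrite mulrC divfK // gt_eqF.
Qed.
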